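(* Let $r>1$, $\lambda>0$ and $d\ge1$. For all $\varepsilon>0$ let $L_\varepsilon\colon(0,+\infty)\times\mathbb R^d\times\mathbb R^d\to[0,+\infty)$ be Borel functions, and set $$\mathcal L_\varepsilon(u,I)=\int_IL_\varepsilon(t,u(t),u'(t))\,dt\quad\text{for }I\subset(0,+\infty)\text{ a bounded open interval and }u\in W^{1,r}(I;\mathbb R^d),$$ $$\mathcal L^\lambda_\varepsilon(u)=\int_0^{+\infty}L_\varepsilon(t,u(t),u'(t))\,e^{-\lambda t}dt\quad\text{for }u\in W^{1,r}_\lambda((0,+\infty);\mathbb R^d).$$ Assume that: (i) there exists a Borel function $L_0\colon(0,+\infty)\times\mathbb R^d\times\mathbb R^d\to[0,+\infty)$ such that for all bounded open intervals $I$ of $(0,+\infty)$ the functionals $\mathcal L_\varepsilon(\cdot,I)$ $\Gamma$-converge, as $\varepsilon\to0^+$, with respect to the weak topology of $W^{1,r}(I;\mathbb R^d)$ to the functional $\mathcal L_0(u,I)=\int_IL_0(t,u(t),u'(t))\,dt$, $u\in W^{1,r}(I;\mathbb R^d)$; (ii) for all bounded open intervals $I$ of $(0,+\infty)$ and for all $u\in W^{1,r}(I;\mathbb R^d)$ there exists a sequence $u_\varepsilon$ converging to $u$ weakly in $W^{1,r}(I;\mathbb R^d)$ such that $u_\varepsilon=u$ at the endpoints of $I$ and $\mathcal L_\varepsilon(u_\varepsilon,I)$ tends to $\mathcal L_0(u,I)$; (iii) there exists a constant $C>0$ such that $L_\varepsilon(t,0,0)\le C$ for every $\varepsilon>0$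 and $t>0$; (iv) $L_0$ is a Carathéodory function satisfying $L_0(t,x,\xi)\le C(1+|\xi|^r)$ for every $t>0$ and $x,\xi\in\mathbb R^d$. Then the functionals $\mathcal L^\lambda_\varepsilon$ $\Gamma$-converge, as $\varepsilon\to0^+$, with respect to the weak topology of $W^{1,r}_\lambda((0,+\infty);\mathbb R^d)$ to the functional $$\mathcal L^\lambda_0(u)=\int_0^{+\infty}L_0(t,u(t),u'(t))\,e^{-\lambda t}dt,\qquad u\in W^{1,r}_\lambda((0,+\infty);\mathbb R^d).$$
   Context: $W^{1,r}_\lambda((0,+\infty);\mathbb R^d)$ is the space of all $u\colon(0,+\infty)\to\mathbb R^d$ such that $u\in W^{1,r}((0,t_0);\mathbb R^d)$ for all $t_0>0$ and $\int_0^{+\infty}|u'(t)|^re^{-\lambda t}dt<+\infty$, endowed with the norm $\|u\|_\lambda=\big(|u(0)|^r+\int_0^{+\infty}|u'(t)|^re^{-\lambda t}dt\big)^{1/r}$, with which it is a Banach space. Here $L_0$ Carathéodory means: measurable in $t$ and continuous in $(x,\xi)$. $\Gamma$-convergence of $E_\varepsilon$ to $E$ as $\varepsilon\to0^+$ on a topological space $X$ means that for every $u\in X$, $E(u)=\sup_{U}\liminf_{\varepsilon\to0^+}\inf_{v\in U}E_\varepsilon(v)=\sup_{U}\limsup_{\varepsilon\to0^+}\inf_{v\in U}E_\varepsilon(v)$, the suprema being over all open neighbourhoods $U$ of $u$. *)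

(* Defs.v *)
From HB Require Import structures.
From mathcomp Require Import all_boot all_order all_algebra.
From mathcomp Require Import ring.
From mathcomp Require Import all_classical all_reals all_analysis.
From mathcomp Require Import measurable_realfun.

Set Implicit Arguments.
Unset Strict Implicit.
Unset Printing Implicit Defensive.

Import Order.TTheory GRing.Theory Num.Theory.
Import numFieldNormedType.Exports.

Local Open Scope classical_set_scope.
Local Open Scope ring_scope.

Section gamma_convergence.
Context {R : realType} {X : topologicalType}.

Definition gamma_liminf (E : R -> X -> \bar R) (u : X) : \bar R :=
  ereal_sup [set limf_einf (fun e => ereal_inf (E e @` U)) (0 : R)^'+
            | U in open_nbhs u].

Definition gamma_limsup (E : R -> X -> \bar R) (u : X) : \bar R :=
  ereal_sup [set limf_esup (fun e => ereal_inf (E e @` U)) (0 : R)^'+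
            | U in open_nbhs u].

Definition gamma_cvg (E : R -> X -> \bar R) (E0 : X -> \bar R) : Prop :=
  forall u : X, E0 u = gamma_liminf E u /\ E0 u = gamma_limsup E u.

End gamma_convergence.

Section weak_topology.
Context {R : realType} {V : lmodType R}.

Definition top_dual (N : V -> R) : set {linear V -> R^o} :=
  [set l | exists C : R, forall v, `|l v| <= C * N v].

(* The coarsest topology on [V] making every functional in [top_dual N]
   continuous: it is pulled back from pointwise convergence on the dual *)
Definition weak_top (N : V -> R) : topologicalType :=
  initial_topology
    (fun v : V => (fun l => val l v) : {ptws top_dual N -> R^o}).

End weak_topology.

Section weak_derivative.
Context {R : realType} {d : nat}.
Implicit Types (O : set R) (u g : R -> 'rV[R]_d).
Local Notation mu := (@lebesgue_measure R).

Definition euclidean_norm (x : 'rV[R]_d) : R :=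
  Num.sqrt (\sum_i (x 0 i) ^+ 2).

(* [C^1_c(O)]: these test functions yield the same weak derivatives as
   [C^oo_c(O)] *)
Definition C1c O : set (R -> R) :=
  [set phi : R -> R | [/\ forall t : R, derivable phi t 1,
    continuous (phi^`())%classic &
    exists K, [/\ compact K, K `<=` O & forall t, ~ K t -> phi t = 0]]].

Definition L1loc O u : Prop :=
  forall i, locally_integrable O (fun t => u t 0 i).

Definition is_weak_derivative O u g : Prop :=
  [/\ L1loc O u, L1loc O g & forall phi, C1c O phi -> forall i,
    (\int[mu]_(t in O) (u t 0 i * (phi^`())%classic t)%:E =
     - \int[mu]_(t in O) (g t 0 i * phi t)%:E)%E].

(* An arbitrary representative, unique up to a null subset of [O] when it exists *)
Definition weak_derivative O u : R -> 'rV[R]_d :=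
  xget 0 [set g | is_weak_derivative O u g].

(* [L^r(O, w(t) dt; R^d)] for a nonnegative weight [w] *)
Definition weighted_Lr (w : R -> R) (r : R) O u : Prop :=
  (forall i, measurable_fun O (fun t => u t 0 i)) /\
  (\int[mu]_(t in O) (euclidean_norm (u t) `^ r * w t)%:E < +oo)%E.

Definition is_Lr := weighted_Lr (cst 1).

Definition int_pow (w : R -> R) (r : R) O u : R :=
  fine (\int[mu]_(t in O) (euclidean_norm (u t) `^ r * w t)%:E).

End weak_derivative.

Section closure_properties.
Context {R : realType} {d : nat}.
Implicit Types (O : set R) (u v g h : R -> 'rV[R]_d) (w : R -> R).
Local Notation mu := (@lebesgue_measure R).

Lemma euclidean_norm_ge0 (x : 'rV[R]_d) : 0 <= euclidean_norm x.
Proof. exact: sqrtr_ge0. Qed.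

Lemma euclidean_norm0 : euclidean_norm (0 : 'rV[R]_d) = 0.
Proof.
rewrite /euclidean_norm big1 ?sqrtr0// => i _.
by rewrite mxE expr0n.
Qed.

Lemma euclidean_normZ a (x : 'rV[R]_d) :
  euclidean_norm (a *: x) = `|a| * euclidean_norm x.
Proof.
rewrite /euclidean_norm -sqrtr_sqr -sqrtrM ?sqr_ge0//; congr Num.sqrt.
by rewrite mulr_sumr; apply: eq_bigr => i _; rewrite mxE exprMn.
Qed.

Lemma euclidean_normD_le (x y : 'rV[R]_d) :
  euclidean_norm (x + y) <= 2 * Num.max (euclidean_norm x) (euclidean_norm y).
Proof.
have S0 (z : 'rV[R]_d) : 0 <= \sum_i (z 0 i) ^+ 2.
  by apply: sumr_ge0 => i _; exact: sqr_ge0.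
have m0 : 0 <= Num.max (euclidean_norm x) (euclidean_norm y).
  by rewrite le_max euclidean_norm_ge0.
rewrite -ler_sqr ?nnegrE ?euclidean_norm_ge0 ?mulr_ge0//.
rewrite {1}/euclidean_norm sqr_sqrtr//.
set m := Num.max _ _.
have xm : \sum_i (x 0 i) ^+ 2 <= m ^+ 2.
  rewrite -(sqr_sqrtr (S0 x)) ler_sqr ?nnegrE ?sqrtr_ge0//.
  by rewrite le_max lexx.
have ym : \sum_i (y 0 i) ^+ 2 <= m ^+ 2.
  rewrite -(sqr_sqrtr (S0 y)) ler_sqr ?nnegrE ?sqrtr_ge0//.
  by rewrite le_max lexx orbT.
apply: (@le_trans _ _ (\sum_i (2 * (x 0 i) ^+ 2 + 2 * (y 0 i) ^+ 2))).
  apply: ler_sum => i _; rewrite mxE -subr_ge0.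
  have -> : 2 * x 0 i ^+ 2 + 2 * y 0 i ^+ 2 - (x 0 i + y 0 i) ^+ 2 =
            (x 0 i - y 0 i) ^+ 2.
    by ring.
  exact: sqr_ge0.
rewrite big_split/= -!mulr_sumr exprMn.
have -> : 2 ^+ 2 * m ^+ 2 = 2 * m ^+ 2 + 2 * m ^+ 2.
  by rewrite -mulrDl -natrD -natrX.
by rewrite lerD// ler_pM2l.
Qed.

Lemma measurable_euclidean_norm O u :
  (forall i, measurable_fun O (fun t => u t 0 i)) ->
  measurable_fun O (fun t => euclidean_norm (u t)).
Proof.
move=> mu_; rewrite /euclidean_norm.
have -> : (fun t => Num.sqrt (\sum_i (u t 0 i) ^+ 2)) =
          (@powR R ^~ 2^-1) \o (fun t => \sum_i (u t 0 i) ^+ 2).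
  apply/funext => t /=; rewrite powR12_sqrt//.
  by apply: sumr_ge0 => i _; exact: sqr_ge0.
apply: (@measurableT_comp _ _ _ _ _ _ (@powR R ^~ _)) => //.
by apply: measurable_sum => i; exact: measurable_funX.
Qed.

Lemma weighted_Lr0 w r O : r != 0 ->
  weighted_Lr w r O (0 : R -> 'rV[R]_d).
Proof.
move=> r0; split=> [i|].
  by under eq_fun do rewrite mxE; exact: measurable_cst.
under eq_integral do rewrite euclidean_norm0 powR0// mul0r.
by rewrite integral0.
Qed.

Lemma weighted_LrP w r O a u v : 0 < r -> measurable O ->
  measurable_fun O w -> (forall t, 0 <= w t) ->
  weighted_Lr w r O u -> weighted_Lr w r O v ->
  weighted_Lr w r O (a *: u + v).
Proof.
move=> r0 mO mw w0 [mu_ fu] [mv fv].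
have m_ i : measurable_fun O (fun t => (a *: u + v) t 0 i).
  under eq_fun do rewrite !mxE.
  by apply: measurable_funD => //; exact: measurable_funM.
have mN g : (forall i, measurable_fun O (fun t => g t 0 i)) ->
    measurable_fun O (fun t => (euclidean_norm (g t) `^ r * w t)%:E).
  move=> mg; apply/measurable_EFinP/measurable_funM => //.
  apply: (@measurableT_comp _ _ _ _ _ _ (@powR R ^~ _)) => //.
  exact: measurable_euclidean_norm.
split; first exact: m_.
pose A := (2 * `|a|) `^ r; pose B := (2 : R) `^ r.
apply: (@le_lt_trans _ _ (\int[mu]_(t in O)
   (A%:E * (euclidean_norm (u t) `^ r * w t)%:E +
    B%:E * (euclidean_norm (v t) `^ r * w t)%:E))%E).
  apply: ge0_le_integral; first exact: mO.
  - by move=> t _; rewrite lee_fin mulr_ge0 ?powR_ge0 ?w0.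
  - exact: mN.
  - by apply: emeasurable_funD; apply: measurable_funeM; exact: mN.
  move=> t _; rewrite -!EFinM -EFinD lee_fin !mulrA -mulrDl ler_wpM2r//.
  rewrite /A /B -!powRM ?euclidean_norm_ge0 ?mulr_ge0//.
  rewrite -mulrA -euclidean_normZ.
  have uv := euclidean_normD_le (a *: u t) (v t).
  apply: (le_trans (ge0_ler_powR (ltW r0) _ _ uv)).
  - by rewrite nnegrE euclidean_norm_ge0.
  - by rewrite nnegrE mulr_ge0// le_max euclidean_norm_ge0.
  rewrite maxEle; case: ifPn => _.
    by rewrite lerDr powR_ge0.
  by rewrite lerDl powR_ge0.
rewrite ge0_integralD//=; first last.
- by apply: measurable_funeM; exact: mN.
- by move=> t _; rewrite mule_ge0 ?lee_fin ?mulr_ge0 ?powR_ge0.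
- by apply: measurable_funeM; exact: mN.
- by move=> t _; rewrite mule_ge0 ?lee_fin ?mulr_ge0 ?powR_ge0.
rewrite !ge0_integralZl//; first last.
- by rewrite lee_fin powR_ge0.
- by move=> t _; rewrite lee_fin mulr_ge0 ?powR_ge0.
- exact: mN.
- by rewrite lee_fin powR_ge0.
- by move=> t _; rewrite lee_fin mulr_ge0 ?powR_ge0.
- exact: mN.
apply: lte_add_pinfty; apply: lte_mul_pinfty.
- by rewrite lee_fin powR_ge0.
- by [].
- exact: fu.
- by rewrite lee_fin powR_ge0.
- by [].
- exact: fv.
Qed.

Lemma L1loc0 O : open O -> L1loc O (0 : R -> 'rV[R]_d).
Proof.
move=> oO i.
have -> : (fun t => (0 : R -> 'rV[R]_d) t 0 i) = cst 0.
  by apply/funext => t; rewrite mxE.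
split; [exact: measurable_cst|exact: oO|].
move=> K _ _; under eq_integral do rewrite normr0.
by rewrite integral0.
Qed.

Lemma L1locP O a u v : L1loc O u -> L1loc O v -> L1loc O (a *: u + v).
Proof.
move=> lu lv i.
have -> : (fun t => (a *: u + v) t 0 i) =
          (fun t => a * u t 0 i) \+ (fun t => v t 0 i).
  by apply/funext => t; rewrite !mxE.
apply: locally_integrableD; last exact: lv.
have [m oO fin] := lu i; split => //; first exact: measurable_funM.
move=> K KO cK; under eq_integral do rewrite normrM EFinM.
rewrite ge0_integralZl//.
- by rewrite lte_mul_pinfty// ?lee_fin//; exact: fin.
- exact: compact_measurable.
- apply/measurable_EFinP/measurableT_comp => //.
  by apply: measurable_funS m => //; exact: open_measurable.
Qed.

Lemma locally_integrable_test O (f psi : R -> R) K : compact K -> K `<=` O ->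
  locally_integrable O f -> continuous psi -> (forall t, ~ K t -> psi t = 0) ->
  mu.-integrable O (fun t => (f t * psi t)%:E).
Proof.
move=> cK KO [mf oO fin] cpsi psi0.
have mK : measurable K by exact: compact_measurable.
have mO : measurable O by exact: open_measurable.
have mpsi A : measurable A -> measurable_fun A psi.
  by move=> mA; apply: (measurable_funS measurableT) => //;
    exact: continuous_measurable_fun.
have mfp : measurable_fun O (fun t => (f t * psi t)%:E).
  by apply/measurable_EFinP/measurable_funM => //; exact: mpsi.
apply/integrableP; split => //.
have -> : (\int[mu]_(x in O) `|(f x * psi x)%:E| =
           \int[mu]_(x in K) `|(f x * psi x)%:E|)%E.
  rewrite -[in RHS](setIidr KO) integral_mkcondr; apply: eq_integral => x _.
  rewrite patchE; case: ifPn => // /negP xK.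
  by rewrite psi0 ?mulr0 ?normr0//= ?normr0// => Kx; apply: xK; exact/mem_set.
suff /integrableP[] : mu.-integrable K ((EFin \o f) \* (EFin \o psi))%E by [].
apply: integrableMl => //.
- apply/integrableP; split; last exact: fin.
  by apply/measurable_EFinP; exact: measurable_funS mf.
- exact: mpsi.
- have := @compact_bounded R R^o (psi @` K) _.
  case.
    by apply: continuous_compact => //; exact: continuous_subspaceT.
  move=> M [Mr MM]; exists M; split=> // x Mx y Ky.
  by apply: (MM x Mx); exists y.
Qed.

Lemma C1c_integrable O (f phi : R -> R) : locally_integrable O f -> C1c O phi ->
  mu.-integrable O (fun t => (f t * phi t)%:E) /\
  mu.-integrable O (fun t => (f t * (phi^`())%classic t)%:E).
Proof.
move=> lf [dphi cphi' [K [cK KO phi0]]]; split.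
  apply: (locally_integrable_test cK KO lf) => // x.
  by apply/differentiable_continuous/derivable1_diffP; exact: dphi.
apply: (locally_integrable_test cK KO lf) => // t Kt.
have oK : open (~` K).
  by apply: closed_openC; apply: compact_closed => //; exact: order_hausdorff.
have -> : (phi^`())%classic t = ((cst 0 : R -> R)^`())%classic t.
  rewrite !derive1E; apply: near_eq_derive.
  have : \forall x \near t, (~` K) x by exact: open_nbhs_nbhs.
  by apply: filterS => x; exact: phi0.
by rewrite derive1_cst.
Qed.

Lemma is_weak_derivative0 O : open O ->
  is_weak_derivative O (0 : R -> 'rV[R]_d) 0.
Proof.
move=> oO; split; [exact: L1loc0|exact: L1loc0|] => phi _ i.
under eq_integral do rewrite mxE mul0r.
under [in RHS]eq_integral do rewrite mxE mul0r.
by rewrite integral0 oppe0.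
Qed.

Lemma is_weak_derivativeP O a u g v h :
  is_weak_derivative O u g -> is_weak_derivative O v h ->
  is_weak_derivative O (a *: u + v) (a *: g + h).
Proof.
move=> [lu lg ug] [lv lh vh]; split; [exact: L1locP|exact: L1locP|].
move=> phi phiO i.
have mO : measurable O by apply: open_measurable; have [] := lu i.
have lin (f1 f2 : R -> 'rV[R]_d) psi :
    mu.-integrable O (fun t => (f1 t 0 i * psi t)%:E) ->
    mu.-integrable O (fun t => (f2 t 0 i * psi t)%:E) ->
    (\int[mu]_(t in O) ((a *: f1 + f2) t 0 i * psi t)%:E =
     a%:E * \int[mu]_(t in O) (f1 t 0 i * psi t)%:E +
     \int[mu]_(t in O) (f2 t 0 i * psi t)%:E)%E.
  move=> i1 i2.
  rewrite -integralZl// -integralD//; last exact: integrableZl.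
  by apply: eq_integral => t _; rewrite !mxE mulrDl EFinD -EFinM mulrA.
have [iu iu'] := C1c_integrable (lu i) phiO.
have [iv iv'] := C1c_integrable (lv i) phiO.
have [ig _] := C1c_integrable (lg i) phiO.
have [ih _] := C1c_integrable (lh i) phiO.
have fh : (\int[mu]_(t in O) (h t 0 i * phi t)%:E)%E \is a fin_num.
  exact: integrable_fin_num.
by rewrite !lin// ug// vh// muleN [RHS]fin_num_oppeD ?fh.
Qed.

End closure_properties.

Section sobolev_interval.
Context {R : realType} (d : nat) (r a b : R) (r1 : 1 < r).

(* Continuous representatives, so that values at [a] and [b] make sense *)
Definition W1r : set (R -> 'rV[R]_d) :=
  [set u | [/\ {within `[a, b], continuous u}, is_Lr r `]a, b[ u &
    exists2 g, is_weak_derivative `]a, b[ u g & is_Lr r `]a, b[ g]].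

Lemma W1r0 : W1r 0.
Proof.
have r0 : r != 0 by rewrite gt_eqF// (lt_trans ltr01).
split; [|exact: weighted_Lr0|].
  by apply: continuous_subspaceT => x; exact: cst_continuous.
exists 0; last exact: weighted_Lr0.
by apply: is_weak_derivative0; exact: interval_open.
Qed.

Lemma W1rP k u v : W1r u -> W1r v -> W1r (k *: u + v).
Proof.
have r0 : 0 < r by exact: lt_trans r1.
have c1 : measurable_fun `]a, b[ (cst 1 : R -> R) by exact: measurable_cst.
have c0 (t : R) : 0 <= (cst 1 : R -> R) t by exact: ler01.
move=> [cu Lu [g ug Lg]] [cv Lv [h vh Lh]]; split.
- apply: within_continuousD => //.
  by move=> x; apply: continuousZl_tmp; exact: cu.
- exact: (weighted_LrP k r0 (measurable_itv _) c1 c0 Lu Lv).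
- exists (k *: g + h); first exact: is_weak_derivativeP.
  exact: (weighted_LrP k r0 (measurable_itv _) c1 c0 Lg Lh).
Qed.

(* [r1] is a parameter of the type because the module structure needs it.
   Extending by [0] outside [[a, b]] makes equality of functions on [R] agree
   with equality in the Sobolev space *)
Definition sobolev_pred of 1 < r : {pred R -> 'rV[R]_d} :=
  mem [set u | W1r u /\ forall t, t \notin `[a, b] -> u t = 0].

Lemma sobolev_submod_closed : submod_closed (sobolev_pred r1).
Proof.
split; first by rewrite inE; split => //; exact: W1r0.
move=> k u v /[!inE] -[Wu u0] [Wv v0]; split; first exact: W1rP.
by move=> t tab; rewrite -[LHS]/(k *: u t + v t) u0// v0// scaler0 addr0.
Qed.

HB.instance Definition _ :=
  GRing.isSubmodClosed.Build R (R -> 'rV[R]_d) (sobolev_pred r1)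
    sobolev_submod_closed.

Record sobolev (h : 1 < r) := Sobolev {
  sobolev_fun :> R -> 'rV[R]_d ; _ : sobolev_fun \in sobolev_pred h }.

HB.instance Definition _ := [isSub for @sobolev_fun r1].
HB.instance Definition _ := [Choice of sobolev r1 by <:].
HB.instance Definition _ := [SubChoice_isSubLmodule of sobolev r1 by <:].

Definition sobolev_norm (u : sobolev r1) : R :=
  (int_pow (cst 1) r `]a, b[ u +
   int_pow (cst 1) r `]a, b[ (weak_derivative `]a, b[ u)) `^ r^-1.

Definition weak_sobolev : topologicalType := weak_top sobolev_norm.

End sobolev_interval.

Arguments sobolev {R} d {r} a b h.
Arguments weak_sobolev {R} d {r} a b r1.

Section sobolev_half_line.
Context {R : realType} (d : nat) (r lambda : R) (r1 : 1 < r).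

Definition discount (t : R) : R := expR (- (lambda * t)).

Definition W1r_discounted : set (R -> 'rV[R]_d) :=
  [set u | (forall t0, 0 < t0 -> W1r r 0 t0 u) /\
    exists2 g, is_weak_derivative `]0, +oo[ u g &
      weighted_Lr discount r `]0, +oo[ g].

Lemma W1r_discounted0 : W1r_discounted 0.
Proof.
have r0 : r != 0 by rewrite gt_eqF// (lt_trans ltr01).
split; first by move=> t0 _; exact: W1r0.
exists 0; last exact: weighted_Lr0.
by apply: is_weak_derivative0; exact: interval_open.
Qed.

Lemma measurable_discount (O : set R) : measurable_fun O discount.
Proof.
apply: measurable_funTS; apply: measurableT_comp; first exact: measurable_expR.
exact: measurableT_comp.
Qed.

Lemma W1r_discountedP k u v :
  W1r_discounted u -> W1r_discounted v -> W1r_discounted (k *: u + v).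
Proof.
have r0 : 0 < r by exact: lt_trans r1.
have w0 t : 0 <= discount t by exact: expR_ge0.
move=> [Wu [g ug Lg]] [Wv [h vh Lh]]; split.
  by move=> t0 t0_gt0; apply: W1rP => //; [exact: Wu|exact: Wv].
exists (k *: g + h); first exact: is_weak_derivativeP.
exact: (weighted_LrP k r0 (measurable_itv _) (@measurable_discount _) w0 Lg Lh).
Qed.

Definition sobolev_discounted_pred of 1 < r : {pred R -> 'rV[R]_d} :=
  mem [set u | W1r_discounted u /\ forall t, t < 0 -> u t = 0].

Lemma sobolev_discounted_submod_closed :
  submod_closed (sobolev_discounted_pred r1).
Proof.
split; first by rewrite inE; split => //; exact: W1r_discounted0.
move=> k u v /[!inE] -[Wu u0] [Wv v0]; split; first exact: W1r_discountedP.
by move=> t t0; rewrite -[LHS]/(k *: u t + v t) u0// v0// scaler0 addr0.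
Qed.

HB.instance Definition _ :=
  GRing.isSubmodClosed.Build R (R -> 'rV[R]_d) (sobolev_discounted_pred r1)
    sobolev_discounted_submod_closed.

Record sobolev_discounted (h : 1 < r) := SobolevDiscounted {
  sobolev_discounted_fun :> R -> 'rV[R]_d ;
  _ : sobolev_discounted_fun \in sobolev_discounted_pred h }.

HB.instance Definition _ := [isSub for @sobolev_discounted_fun r1].
HB.instance Definition _ := [Choice of sobolev_discounted r1 by <:].
HB.instance Definition _ :=
  [SubChoice_isSubLmodule of sobolev_discounted r1 by <:].

Definition sobolev_discounted_norm (u : sobolev_discounted r1) : R :=
  (euclidean_norm (u 0) `^ r +
   int_pow discount r `]0, +oo[ (weak_derivative `]0, +oo[ u)) `^ r^-1.

Definition weak_sobolev_discounted : topologicalType :=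
  weak_top sobolev_discounted_norm.

End sobolev_half_line.

Arguments sobolev_discounted {R} d {r} lambda h.
Arguments weak_sobolev_discounted {R} d {r} lambda r1.

Section integrands.
Context {R : realType} {d : nat}.
Implicit Types L : R -> 'rV[R]_d -> 'rV[R]_d -> R.
Local Notation mu := (@lebesgue_measure R).
Local Notation Rdd := (R * 'rV[R]_d * 'rV[R]_d)%type.

(* The Borel sigma-algebra of the product, generated by its open sets *)
Definition borel_integrand L : Prop :=
  @measurable_fun _ _ (g_sigma_algebraType (@open Rdd)) R
    [set p : Rdd | 0 < p.1.1] (fun p : Rdd => L p.1.1 p.1.2 p.2).

Definition caratheodory L : Prop :=
  (forall x xi : 'rV[R]_d,
    @measurable_fun _ _ R R `]0, +oo[ (fun t => L t x xi)) /\
  (forall t : R, 0 < t ->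
    continuous (fun p : 'rV[R]_d * 'rV[R]_d => L t p.1 p.2)).

Definition energy (I : set R) L (u : R -> 'rV[R]_d) : \bar R :=
  (\int[mu]_(t in I) (L t (u t) (weak_derivative I u t))%:E)%E.

Definition discounted_energy (lambda : R) L (u : R -> 'rV[R]_d) : \bar R :=
  energy `]0, +oo[ (fun t x xi => L t x xi * discount lambda t) u.

End integrands.

(* Main.v *)
Require Import Defs.
From HB Require Import structures.
From mathcomp Require Import all_boot all_order all_algebra.
From mathcomp Require Import ring lra.
From mathcomp Require Import all_classical all_reals all_analysis.
From mathcomp Require Import measurable_realfun.

Set Implicit Arguments.
Unset Strict Implicit.
Unset Printing Implicit Defensive.

Import Order.TTheory GRing.Theory Num.Theory.
Import numFieldNormedType.Exports.

Local Open Scope classical_set_scope.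
Local Open Scope ring_scope.

(** The limit is proved in the form liminf inequality plus limsup inequality,
    by cutting the half line into pieces on which the discount factor
    exp (- lambda t) is almost constant, and applying the hypotheses for
    bounded intervals on each piece.

    Transfer between the half line and an interval. Restriction to an interval
    ([sobolev_restrict]) and extension by constants ([sobolev_extend]) are
    linear and norm-bounded between the Sobolev spaces, hence continuous for
    the weak topologies: a bounded linear map pulls bounded functionals back to
    bounded functionals ([bounded_linear_weak_continuous]). On functions
    vanishing at both endpoints the constant extension is the extension by
    zero, which is what allows gluing. Both directions rest on two facts on
    weak derivatives: the integration by parts formula up to the boundary
    ([weak_ibp]), and the almost everywhere uniqueness
    ([weak_derivative_unique]), thanks to which energies may be computed with
    any weak derivative at hand.

    Liminf inequality ([discounted_liminf]). On an interval of length del the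
    discount factor varies by a ratio exp (lambda del). Adding up the liminf
    inequalities on the intervals of a partition of ]0, T[ of mesh del gives,
    for functions in a weak neighbourhood of u, a lower bound by
    exp (- lambda del) times the discounted limit energy of u on ]0, T[, up to
    an arbitrarily small error. As the integrands are nonnegative, the part
    beyond T may be dropped; then del tends to 0 and T to infinity.

    Limsup inequality ([discounted_limsup]). By [gamma_limsup_le], it suffices
    to find in every weak neighbourhood of u functions of energy at most that
    of u plus a small error. Let w be u up to time T, affine on [T, T + 1] and
    0 afterwards ([cutoff_after]). The norm of w - u and the energy of w on
    [T, T + 1] are controlled by (1 + |u(T)|^r) exp (- lambda T) and by the tail
    of the discounted integral of |u'|^r. Both vanish as T tends to infinity
    along the integers; for |u(T)|^r exp (- lambda T) this is [value_decay], a weighted form of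
    the growth estimate for functions of bounded r-energy. On ]0, T + 1[ the
    recovery sequences of w on the intervals of a fine partition agree with w
    at the endpoints, so they glue to functions w + z_e with z_e weakly
    convergent to 0 and supported in [0, T + 1] ([recovery_partition]). Beyond
    T + 1 the glued functions vanish, and the bound on L_e (t, 0, 0) makes
    their energy there at most C times the integral of the discount factor,
    which is small for T large ([zero_tail_energy]). *)

(** * Weak topologies *)

Section weak.
Context {R : realType}.

Lemma ptws_cvgP (U : eqType) (V : topologicalType) (F : set_system (U -> V))
    (f : U -> V) : Filter F ->
  F --> (f : {ptws U -> V}) <-> forall t, (fun g => g t) @ F --> f t.
Proof.
move=> FF; split.
  move=> Ff t.
  have := @proj_continuous U (fun=> V) t f.
  move=> h A /h; exact: Ff.
move=> h; apply/cvg_sup => i A [_ [[B oB <-] /= Bfi BA]].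
apply: filterS BA _; apply: (h i B).
exact: open_nbhs_nbhs.
Qed.

Lemma weak_cvgP (V : lmodType R) (N : V -> R) (T : Type) (F : set_system T)
    (x_ : T -> V) (x : V) : Filter F ->
  (x_ : T -> weak_top N) @ F --> (x : weak_top N) <->
  forall l : {linear V -> R^o}, top_dual N l -> l (x_ t) @[t --> F] --> l x.
Proof.
move=> FF; split.
  move=> h l Nl.
  have c := @initial_continuous _ _
    (fun v : V => (fun l => val l v) : {ptws top_dual N -> R^o}).
  have := cvg_comp x_ _ h (c x).
  move=> /ptws_cvgP /(_ (exist _ l (mem_set Nl))).
  exact.
move=> h A [_ [[B oB <-] /= Bx BA]].
have : (fun t => (fun l : top_dual N => val l (x_ t))) @ F -->
    ((fun l => val l x) : {ptws top_dual N -> R^o}).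
  apply/ptws_cvgP => -[l Nl] /=; exact: h l (set_mem Nl).
move=> /(_ B) /(_ (open_nbhs_nbhs (conj oB Bx))) /=.
by apply: (@filterS _ F) => t; exact: BA.
Qed.

(** The functional l o f is bounded by a multiple of N whenever l is bounded by a
    multiple of M, so continuity can be tested on the functionals defining the
    weak topology of V. *)
Lemma bounded_linear_weak_continuous (V W : lmodType R) (N : V -> R) (M : W -> R)
    (f : {linear V -> W}) (K : R) :
  (forall w, 0 <= M w) -> (forall v, M (f v) <= K * N v) ->
  continuous (f : weak_top N -> weak_top M).
Proof.
move=> M0 fK x.
have FF : Filter (nbhs (x : weak_top N)) := nbhs_filter (x : weak_top N).
apply: (weak_cvgP M _ _ FF).2 => l [c lc].
have /(weak_cvgP N _ _ FF) /(_ (l \o f)) :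
  @id (weak_top N) @ nbhs (x : weak_top N) --> (x : weak_top N) by [].
apply; exists (Num.max c 0 * K) => v /=.
(* The constant c may be negative when M vanishes identically, whence the max. *)
rewrite (le_trans (lc _))// (@le_trans _ _ (Num.max c 0 * M (f v)))//.
  by rewrite ler_wpM2r// le_max lexx.
by rewrite -mulrA ler_wpM2l// le_max lexx orbT.
Qed.
End weak.

(** * Gamma-limits tested on neighbourhoods *)

Section gamma.
Context {R : realType} {X : topologicalType}.
Implicit Types (E : R -> X -> \bar R) (u : X).

Lemma lt_gamma_liminf E u (M : \bar R) : (M < gamma_liminf E u)%E ->
  exists2 U, open_nbhs u U & \forall e \near 0^'+, forall v, U v -> (M <= E e v)%E.
Proof.
move=> /ereal_sup_gt[_ [U uU <-]]; rewrite limf_einfE.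
move=> /ereal_sup_gt[_ [V V0 <-]] MV; exists U => //.
apply: filterS V0 => e Ve v Uv; apply/ltW/(lt_le_trans MV).
apply: (@le_trans _ _ (ereal_inf (E e @` U))).
  by apply: ereal_inf_lbound; exists e.
by apply: ereal_inf_lbound; exists v.
Qed.

Lemma le_gamma_liminf E u (M : \bar R) U : open_nbhs u U ->
  (\forall e \near 0^'+, forall v, U v -> (M <= E e v)%E) ->
  (M <= gamma_liminf E u)%E.
Proof.
move=> uU UM; apply: le_ereal_sup_tmp.
exists (limf_einf (fun e => ereal_inf (E e @` U)) 0^'+); first by exists U.
rewrite limf_einfE; apply: le_ereal_sup_tmp.
eexists; first by eexists; [exact: UM|reflexivity].
apply: le_ereal_inf_tmp => _ [e /= Ue <-].
by apply: le_ereal_inf_tmp => _ [v Uv <-]; exact: Ue.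
Qed.

Lemma gamma_limsup_le E u (M : \bar R) :
  (forall U, open_nbhs u U ->
    \forall e \near 0^'+, exists2 v, U v & (E e v <= M)%E) ->
  (gamma_limsup E u <= M)%E.
Proof.
move=> UM; apply: ge_ereal_sup => _ [U /UM uU <-].
rewrite limf_esupE; apply: ge_ereal_inf.
eexists; first by eexists; [exact: uU|reflexivity].
apply: ge_ereal_sup => _ [e /= [v Uv Ev] <-].
by apply: le_trans Ev; apply: ereal_inf_lbound; exists v.
Qed.

Lemma gamma_liminf_le_limsup E u : (gamma_liminf E u <= gamma_limsup E u)%E.
Proof.
apply: ge_ereal_sup => _ [U uU <-].
apply: le_ereal_sup_tmp.
exists (limf_esup (fun e => ereal_inf (E e @` U)) 0^'+); first by exists U.
rewrite limf_einfE limf_esupE.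
apply: ge_ereal_sup => _ [V V0 <-]; apply: le_ereal_inf_tmp => _ [W W0 <-].
have [e [Ve We]] : (V `&` W) !=set0.
  by apply: (@filter_ex _ (0 : R)^'+); exact: filterI.
apply: (@le_trans _ _ (ereal_inf (E e @` U))).
  by apply: ereal_inf_lbound; exists e.
by apply: ereal_sup_ubound; exists e.
Qed.
End gamma.

(** * A smooth step *)

Section cutoff.
Context {R : realType}.
Local Notation mu := (@lebesgue_measure R).
Implicit Types (a b x N : R).

(** The positive part squared is the simplest C^1 function that vanishes on a
    half line and only there; test functions need no more regularity. *)
Definition pos_sqr x := Num.max 0 x ^+ 2.

Lemma is_derive_pos_sqr x : is_derive x 1 pos_sqr (2 * Num.max 0 x).
Proof.
have [x0|x0|<-] := ltgtP 0 x.
- have -> : 2 * x = x *: 1 + x *: (1:R).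
    by rewrite /GRing.scale/= mulr1 mulr_natl.
  apply: (@near_eq_is_derive _ _ _ (fun y : R => y * y)).
  near=> y; rewrite /pos_sqr max_r ?expr2//; apply/ltW; near: y.
  exact: lt_nbhsr.
- rewrite mulr0.
  apply: (@near_eq_is_derive _ _ _ (cst 0)).
  near=> y; rewrite /pos_sqr max_l ?expr0n//; apply/ltW; near: y.
  exact: lt_nbhsl.
- rewrite mulr0.
  (* At the origin the difference quotient is bounded by |h|. *)
  have H : h^-1 *: (pos_sqr (h *: (1:R) + 0) - pos_sqr 0) @[h --> 0^'] --> (0:R).
    apply/cvgr0Pnorm_le => e e0; near=> h.
    have h0 : h != 0 by near: h; exact: nbhs_dnbhs_neq.
    rewrite /pos_sqr addr0 maxxx expr0n subr0 /GRing.scale/= mulr1 normrM normfV normrX.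
    have hm : `|Num.max 0 h| <= `|h|.
      by have [h1|h1] := leP 0 h; rewrite ?normr0 ?normr_ge0.
    have he : `|h| <= e.
      near: h; apply: dnbhs0_le; exact: e0.
    rewrite ler_pdivrMl ?normr_gt0// expr2.
    by apply: (le_trans (ler_pM _ _ hm hm)) => //; exact: ler_wpM2l.
  apply: DeriveDef.
    by apply/cvg_ex; exists 0.
  by apply/cvg_lim.
Unshelve. all: by end_near. Qed.

Lemma continuous_max0 (f : R -> R) : continuous f ->
  continuous (fun x => Num.max 0 (f x)).
Proof.
move=> cf x; apply: continuous_max; [exact: cvg_cst|exact: cf].
Qed.

(** A nondecreasing C^1 transition from 0 on ]-oo, 0] to 1 on [1, +oo[: for x in
    [0, 1] this is 1 - (1 - x^2)^2, and the positive parts freeze it outside. *)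
Definition smoothstep x := 1 - pos_sqr (1 - pos_sqr x).
Definition dsmoothstep x := 2 * Num.max 0 (1 - pos_sqr x) * (2 * Num.max 0 x).

Lemma is_derive_smoothstep x : is_derive x 1 smoothstep (dsmoothstep x).
Proof.
have h1 : is_derive x 1 (fun y => 1 - pos_sqr y) (- (2 * Num.max 0 x)).
  rewrite -[X in is_derive _ _ _ X]sub0r; apply: is_deriveB.
  exact: is_derive_pos_sqr.
have -> : dsmoothstep x = 0 - 2 * Num.max 0 (1 - pos_sqr x) * - (2 * Num.max 0 x).
  by rewrite sub0r mulrN opprK.
apply: is_deriveB; apply: is_derive1_comp; exact: is_derive_pos_sqr.
Qed.

Lemma continuous_pos_sqr : continuous pos_sqr.
Proof.
move=> x; apply/differentiable_continuous/derivable1_diffP.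
exact: (@ex_derive _ _ _ _ _ _ _ (is_derive_pos_sqr x)).
Qed.

Lemma continuous_dsmoothstep : continuous dsmoothstep.
Proof.
move=> x; rewrite /dsmoothstep.
apply: cvgM; apply: cvgM; try exact: cvg_cst.
- apply: (@continuous_max0 (fun x => 1 - pos_sqr x)) => y.
  by apply: cvgB; [exact: cvg_cst|exact: continuous_pos_sqr].
- by apply: (@continuous_max0 id) => y.
Qed.

Lemma smoothstep_le0 x : x <= 0 -> smoothstep x = 0.
Proof.
move=> x0; rewrite /smoothstep /pos_sqr (max_l x0) expr0n/= subr0.
by rewrite max_r ?ler01// expr1n subrr.
Qed.

Lemma smoothstep_ge1 x : 1 <= x -> smoothstep x = 1.
Proof.
move=> x1; have x0 : 0 <= x by exact: le_trans x1.
rewrite /smoothstep /pos_sqr (max_r x0) max_l ?expr0n/= ?subr0//.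
by rewrite subr_le0 exprn_ege1.
Qed.

Lemma smoothstep01 x : 0 <= smoothstep x <= 1.
Proof.
rewrite /smoothstep/= gerBl sqr_ge0 andbT subr_ge0 {1}/pos_sqr.
have m0 : 0 <= Num.max 0 (1 - pos_sqr x) by rewrite le_max lexx.
by rewrite expr_le1// ge_max ler01/= gerBl sqr_ge0.
Qed.

Lemma smoothstep_nd x y : x <= y -> smoothstep x <= smoothstep y.
Proof.
move=> xy; have p u v : u <= v -> pos_sqr u <= pos_sqr v.
  have m0 (z : R) : 0 <= Num.max 0 z by rewrite le_max lexx.
  move=> uv; rewrite /pos_sqr ler_sqr ?nnegrE//.
  by rewrite ge_max !le_max lexx uv orbT.
by rewrite lerB// p// lerB// p.
Qed.

Lemma dsmoothstep_ge0 x : 0 <= dsmoothstep x.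
Proof. by rewrite /dsmoothstep !mulr_ge0 ?le_max ?lexx. Qed.

Lemma dsmoothstep_neq0 x : dsmoothstep x != 0 -> 0 <= x <= 1.
Proof.
apply: contra_neqT; rewrite negb_and -!ltNge /dsmoothstep => /orP[x0|x1].
  by rewrite (max_l (ltW x0)) !mulr0.
have x0 : 0 <= x by rewrite (le_trans ler01)// ltW.
rewrite [X in _ * X * _]max_l ?mulr0 ?mul0r//.
by rewrite subr_le0 /pos_sqr (max_r x0) exprn_ege1// ltW.
Qed.

End cutoff.

(** * Integration by parts up to the boundary *)

(** An approximate Dirac mass: averaging psi against a probability density al that
    lives where psi is close to c gives a value close to c. *)
Lemma average_close (R : realType) d (T : measurableType d) (mu : {measure set T -> \bar R})
    (D : set T) (al psi : T -> R) (c e : R) : measurable D -> 0 <= e ->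
  (forall x, D x -> 0 <= al x) ->
  mu.-integrable D (EFin \o al) -> mu.-integrable D (fun x => (al x * psi x)%:E) ->
  (\int[mu]_(x in D) al x)%R = 1 ->
  (forall x, D x -> al x != 0 -> `|psi x - c| <= e) ->
  `|(\int[mu]_(x in D) (al x * psi x))%R - c| <= e.
Proof.
move=> mD e0 al0 ial ialpsi int1 close.
have iac : mu.-integrable D (EFin \o (fun x => c * al x)).
  exact: (integrableZl mD c ial).
have -> : c = (\int[mu]_(x in D) (c * al x))%R by rewrite RintegralZl// int1 mulr1.
rewrite -RintegralB//.
have iB : mu.-integrable D (EFin \o (fun x => al x * psi x - c * al x)).
  exact: (integrableB mD ialpsi iac).
apply: (le_trans (le_normr_Rintegral mD iB)).
have -> : e = (\int[mu]_(x in D) (e * al x))%R by rewrite RintegralZl// int1 mulr1.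
apply: le_Rintegral => //.
- exact: (integrable_norm iB).
- exact: (integrableZl mD e ial).
move=> x Dx; have [->|ax] := eqVneq (al x) 0.
  by rewrite mul0r !mulr0 subrr normr0.
rewrite [al x * _]mulrC -mulrBl normrM (ger0_norm (al0 _ Dx)) ler_wpM2r ?al0//.
exact: close.
Qed.

Lemma within_continuous_dist {R : realType} (f : R -> R) (A : set R) (x e : R) :
  {within A, continuous f} -> A x -> 0 < e ->
  exists2 del, 0 < del & forall y, A y -> `|x - y| < del -> `|f x - f y| <= e.
Proof.
move=> cf Ax e0; have := subspace_continuousP A f.
move=> [/(_ cf x Ax) /cvgrPdist_le/(_ _ e0) + _].
rewrite near_withinE => -[del /= del0 Hdel]; exists del => // y Ay xy.
exact: Hdel.
Qed.

Section ibp.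
Context {R : realType}.
Local Notation mu := (@lebesgue_measure R).
Implicit Types (a b x N : R).

Lemma is_derive_affine (k s c x : R) : is_derive x 1 (fun y => k * (y - s) + c) k.
Proof.
have h1 : is_derive x 1 (fun y : R => y - s) (1 - 0) by apply: is_deriveB.
have h2 := is_deriveM (is_derive_cst k x 1) h1.
have h3 := is_deriveD h2 (is_derive_cst c x 1).
apply: (is_derive_eq h3).
by rewrite subr0 scaler0 !addr0 /GRing.scale/= mulr1.
Qed.

Lemma is_derive_continuous (f df : R -> R) :
  (forall x, is_derive x 1 f (df x)) -> continuous f.
Proof.
move=> h x; apply/differentiable_continuous/derivable1_diffP.
exact: (@ex_derive _ _ _ _ _ _ _ (h x)).
Qed.

Lemma derive1_is_derive (f df : R -> R) :
  (forall x, is_derive x 1 f (df x)) -> (f^`())%classic = df.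
Proof. by move=> h; apply/funext => x; rewrite derive1E; exact: derive_val. Qed.

Lemma integrable_continuous_oo (f : R -> R) a b : {within `[a, b], continuous f} ->
  mu.-integrable `]a, b[ (EFin \o f).
Proof.
move=> cf; have := continuous_compact_integrable (@segment_compact _ a b) cf.
by apply: integrableS => //; exact: subset_itv_oo_cc.
Qed.

Lemma bounded_continuous_oo (f : R -> R) a b : {within `[a, b], continuous f} ->
  exists2 M, 0 <= M & forall x, a <= x <= b -> `|f x| <= M.
Proof.
move=> cf; have [M [Mr MM]] := compact_bounded (continuous_compact cf (@segment_compact _ a b)).
exists (`|M| + 1); first by rewrite addr_ge0.
move=> x xab; apply: (MM (`|M| + 1)).
  by rewrite (le_lt_trans (ler_norm M))// ltrDl.
by exists x; rewrite //= in_itv.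
Qed.

Lemma integrableM_continuous (f g : R -> R) a b : {within `[a, b], continuous f} ->
  mu.-integrable `]a, b[ (EFin \o g) ->
  mu.-integrable `]a, b[ (fun x => (g x * f x)%:E).
Proof.
move=> cf ig; have [M M0 MM] := bounded_continuous_oo cf.
suff : mu.-integrable `]a, b[ ((EFin \o g) \* (EFin \o f))%E by [].
apply: integrableMl => //.
  have /integrableP[mf _] := integrable_continuous_oo cf.
  exact/measurable_EFinP.
exists M; split; first exact: num_real.
move=> N MN x /=; rewrite in_itv/= => /andP[ax xb].
by rewrite (le_trans (MM x _) (ltW MN))// !ltW.
Qed.

Lemma Rintegral_is_derive (F f : R -> R) a b : a < b ->
  (forall x, is_derive x 1 F (f x)) -> continuous f ->
  (\int[mu]_(x in `]a, b[) f x)%R = F b - F a.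
Proof.
move=> ab dF cf; have cF := is_derive_continuous dF.
have wf : {within `[a, b], continuous f} by exact: continuous_subspaceT.
rewrite Rintegral_itv_obnd_cbnd; last exact: integrable_continuous_oo.
rewrite Rintegral_itv_bndo_bndc; last first.
  have := continuous_compact_integrable (@segment_compact _ a b) wf.
  by apply: integrableS => //; exact: subset_itv_co_cc.
rewrite /Rintegral (continuous_FTC2 ab wf (F := F))//.
  split.
  - by move=> x _; exact: (@ex_derive _ _ _ _ _ _ _ (dF x)).
  - by apply: cvg_at_right_filter; exact: cF.
  - by apply: cvg_at_left_filter; exact: cF.
by move=> x _; rewrite (derive1_is_derive dF).
Qed.

Lemma C1c_intro (O : set R) (phi dphi : R -> R) K :
  (forall x, is_derive x 1 phi (dphi x)) -> continuous dphi ->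
  compact K -> K `<=` O -> (forall t, ~ K t -> phi t = 0) -> C1c O phi.
Proof.
move=> dp cp cK KO phi0; split.
- by move=> t; exact: (@ex_derive _ _ _ _ _ _ _ (dp t)).
- by rewrite (derive1_is_derive dp).
- by exists K.
Qed.

End ibp.

Section ibp.
Context {R : realType}.
Local Notation mu := (@lebesgue_measure R).
Variables (a b : R).
Hypothesis ab : a < b.

(** For N (b - a) >= 4 this is a smooth trapezoid: it rises on [a + 1/N, a + 2/N], is 1
    until b - 2/N, and is back to 0 from b - 1/N on. Its derivative is
    [rise N - fall N], two probability densities concentrating at a and at b as
    N grows. *)
Definition cutoff (N x : R) := smoothstep (N * (x - a) - 1) - smoothstep (N * (x - b) + 2).
Definition rise (N x : R) := dsmoothstep (N * (x - a) - 1) * N.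
Definition fall (N x : R) := dsmoothstep (N * (x - b) + 2) * N.

Lemma is_derive_cutoff (N x : R) : is_derive x 1 (cutoff N) (rise N x - fall N x).
Proof.
apply: is_deriveB.
  apply: is_derive1_comp; first exact: is_derive_smoothstep.
  exact: is_derive_affine.
apply: is_derive1_comp; first exact: is_derive_smoothstep.
exact: is_derive_affine.
Qed.

Lemma is_derive_rise (N x : R) :
  is_derive x 1 (fun y => smoothstep (N * (y - a) - 1)) (rise N x).
Proof.
apply: is_derive1_comp; first exact: is_derive_smoothstep.
exact: is_derive_affine.
Qed.

Lemma is_derive_fall (N x : R) :
  is_derive x 1 (fun y => smoothstep (N * (y - b) + 2)) (fall N x).
Proof.
apply: is_derive1_comp; first exact: is_derive_smoothstep.
exact: is_derive_affine.
Qed.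

Lemma continuous_dsmoothstep_affine (N s c : R) :
  continuous (fun x : R => dsmoothstep (N * (x - s) + c) * N).
Proof.
move=> x; apply: cvgM; last exact: cvg_cst.
apply: (@continuous_comp _ _ _ (fun y => N * (y - s) + c) dsmoothstep).
  exact: (is_derive_continuous (is_derive_affine N s c)).
exact: continuous_dsmoothstep.
Qed.

Lemma continuous_rise (N : R) : continuous (rise N).
Proof. exact: continuous_dsmoothstep_affine. Qed.

Lemma continuous_fall (N : R) : continuous (fall N).
Proof. exact: continuous_dsmoothstep_affine. Qed.

Let NE (N x : R) : N * (x - b) = N * (x - a) - N * (b - a).
Proof. by ring. Qed.

Let NE' (N x : R) : N * (b - x) = N * (b - a) - N * (x - a).
Proof. by ring. Qed.

Lemma cutoff01 (N x : R) : 4 <= N * (b - a) -> 0 <= cutoff N x <= 1.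
Proof.
move=> Nab; apply/andP; split; rewrite /cutoff.
  by rewrite subr_ge0; apply: smoothstep_nd; rewrite NE; lra.
have /andP[_ h1] := smoothstep01 (N * (x - a) - 1).
have /andP[h2 _] := smoothstep01 (N * (x - b) + 2).
lra.
Qed.

Lemma cutoff_eq0 (N x : R) : 4 <= N * (b - a) ->
  N * (x - a) <= 1 \/ N * (b - x) <= 1 -> cutoff N x = 0.
Proof.
rewrite /cutoff; move=> Nab [h|h].
  by rewrite !smoothstep_le0 ?subrr// ?NE; lra.
by move: h; rewrite NE' => h; rewrite !smoothstep_ge1 ?subrr// ?NE; lra.
Qed.

Lemma cutoff_eq1 (N x : R) : 2 <= N * (x - a) -> 2 <= N * (b - x) -> cutoff N x = 1.
Proof.
move=> h1 h2; rewrite /cutoff smoothstep_ge1; last by lra.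
by move: h2; rewrite NE' => h2; rewrite smoothstep_le0 ?subr0// NE; lra.
Qed.

Lemma Rintegral_rise (N : R) : 4 <= N * (b - a) ->
  (\int[mu]_(x in `]a, b[) rise N x)%R = 1.
Proof.
move=> Nab; rewrite (Rintegral_is_derive ab (is_derive_rise N) (@continuous_rise N)).
by rewrite smoothstep_ge1 ?smoothstep_le0 ?subr0// ?subrr ?mulr0; lra.
Qed.

Lemma Rintegral_fall (N : R) : 4 <= N * (b - a) ->
  (\int[mu]_(x in `]a, b[) fall N x)%R = 1.
Proof.
move=> Nab; rewrite (Rintegral_is_derive ab (is_derive_fall N) (@continuous_fall N)).
by rewrite smoothstep_ge1 ?smoothstep_le0 ?subr0// ?NE ?subrr ?mulr0; lra.
Qed.

Lemma rise_ge0 (N x : R) : 0 <= N -> 0 <= rise N x.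
Proof. by move=> N0; rewrite mulr_ge0 ?dsmoothstep_ge0. Qed.

Lemma fall_ge0 (N x : R) : 0 <= N -> 0 <= fall N x.
Proof. by move=> N0; rewrite mulr_ge0 ?dsmoothstep_ge0. Qed.

Lemma rise_neq0 (N x : R) : rise N x != 0 -> N * (x - a) <= 2.
Proof.
rewrite mulf_eq0 negb_or => /andP[/dsmoothstep_neq0/andP[_ h] _]; lra.
Qed.

Lemma fall_neq0 (N x : R) : fall N x != 0 -> N * (b - x) <= 2.
Proof.
rewrite mulf_eq0 negb_or NE' => /andP[/dsmoothstep_neq0/andP[h _] _].
by move: h; rewrite NE; lra.
Qed.

Lemma C1c_cutoff (N : R) (phi dphi : R -> R) : 0 < N -> 4 <= N * (b - a) ->
  (forall x : R, is_derive x 1 phi (dphi x)) -> continuous dphi ->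
  C1c `]a, b[ (fun x => cutoff N x * phi x) /\
  ((fun x => cutoff N x * phi x)^`())%classic =
     (fun x => cutoff N x * dphi x + (rise N x - fall N x) * phi x).
Proof.
move=> N0 Nab dp cdp.
have D (x : R) : is_derive x 1 (fun x => cutoff N x * phi x)
     (cutoff N x * dphi x + (rise N x - fall N x) * phi x).
  have H := is_deriveM (is_derive_cutoff N x) (dp x).
  by apply: (is_derive_eq H); rewrite /GRing.scale/= [phi x * _]mulrC.
split; last exact: derive1_is_derive D.
apply: (C1c_intro D (K := `[a + N^-1, b - N^-1]%classic)).
- move=> x; apply: cvgD; apply: cvgM.
  + exact: (is_derive_continuous (is_derive_cutoff N)).
  + exact: cdp.
  + by apply: cvgB; [exact: continuous_rise|exact: continuous_fall].
  + exact: (is_derive_continuous dp).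
- exact: segment_compact.
- move=> x /=; rewrite !in_itv/= => /andP[h1 h2].
  have N0' : 0 < N^-1 by rewrite invr_gt0.
  by apply/andP; split; lra.
- move=> t ht; rewrite cutoff_eq0 ?mul0r//.
  have [h|h] := leP (N * (t - a)) 1; first by left.
  have [h'|h'] := leP (N * (b - t)) 1; first by right.
  exfalso; apply: ht; rewrite /= in_itv/=; apply/andP; split.
    have : N^-1 <= t - a by rewrite -[leLHS]mul1r ler_pdivrMr// mulrC ltW.
    lra.
  have : N^-1 <= b - t by rewrite -[leLHS]mul1r ler_pdivrMr// mulrC ltW.
  lra.
Qed.

Lemma scaled_cvg_itv (N0 : R) (x s : R) : s < x ->
  \forall n \near \oo, 2 <= (n%:R + N0) * (x - s).
Proof.
move=> sx; near=> n.
have : 2 / (x - s) - N0 <= n%:R by near: n; exact: nbhs_infty_ger.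
by rewrite lerBlDr ler_pdivrMr// subr_gt0.
Unshelve. all: by end_near. Qed.

(** A weak derivative is tested against functions vanishing near the endpoints only;
    the boundary terms come out when a general [phi] is multiplied by [cutoff N]
    and N tends to infinity. The derivative of the cutoff contributes averages of
    f phi near a and near b, which converge because f is continuous up to the
    boundary. *)
Lemma weak_ibp (f g phi dphi : R -> R) : {within `[a, b], continuous f} ->
  mu.-integrable `]a, b[ (EFin \o g) ->
  (forall psi, C1c `]a, b[ psi ->
    (\int[mu]_(t in `]a, b[) (f t * (psi^`())%classic t)%:E =
     - \int[mu]_(t in `]a, b[) (g t * psi t)%:E)%E) ->
  (forall x : R, is_derive x 1 phi (dphi x)) -> continuous dphi ->
  (\int[mu]_(t in `]a, b[) (f t * dphi t + g t * phi t))%R =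
  f b * phi b - f a * phi a.
Proof.
move=> cf ig weak dp cdp.
have cphi : continuous phi := is_derive_continuous dp.
have w (h : R -> R) : continuous h -> {within `[a, b], continuous h}.
  exact: continuous_subspaceT.
have wM (h k : R -> R) : {within `[a, b], continuous h} ->
    {within `[a, b], continuous k} -> {within `[a, b], continuous (fun x => h x * k x)}.
  by move=> ch ck x; apply: cvgM; [exact: ch|exact: ck].
(* The offset M makes the rising and falling parts disjoint for every n. *)
pose M := 4 / (b - a); pose N (n : nat) : R := n%:R + M.
have M0 : 0 < M by rewrite divr_gt0// subr_gt0.
have N0 n : 0 < N n by rewrite ltr_wpDl.
have Nab n : 4 <= N n * (b - a).
  rewrite mulrDl /M divfK; last by rewrite gt_eqF// subr_gt0.
  by rewrite lerDr mulr_ge0// subr_ge0 ltW.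
have mI : measurable (`]a, b[%classic : set (measurableTypeR R)) by [].
pose h x := f x * phi x; pose k x := f x * dphi x + g x * phi x.
have ch : {within `[a, b], continuous h} by apply: wM => //; exact: w.
have ifd : mu.-integrable `]a, b[ (fun x => (f x * dphi x)%:E).
  apply: integrable_continuous_oo; apply: wM => //; exact: w.
have ik : mu.-integrable `]a, b[ (EFin \o k).
  have igp : mu.-integrable `]a, b[ (fun x => (g x * phi x)%:E).
    by apply: integrableM_continuous => //; exact: w.
  have H := integrableD mI ifd igp; exact: H.
pose A n := (\int[mu]_(x in `]a, b[) (rise (N n) x * h x))%R.
pose B n := (\int[mu]_(x in `]a, b[) (fall (N n) x * h x))%R.
pose I n := (\int[mu]_(x in `]a, b[) (cutoff (N n) x * k x))%R.
have irise n : mu.-integrable `]a, b[ (fun x => (rise (N n) x * h x)%:E).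
  by apply: integrable_continuous_oo; apply: wM => //; apply: w; exact: continuous_rise.
have ifall n : mu.-integrable `]a, b[ (fun x => (fall (N n) x * h x)%:E).
  by apply: integrable_continuous_oo; apply: wM => //; apply: w; exact: continuous_fall.
have ccut n : continuous (cutoff (N n)) := is_derive_continuous (is_derive_cutoff (N n)).
have icut n : mu.-integrable `]a, b[ (fun x => (cutoff (N n) x * k x)%:E).
  have -> : (fun x => (cutoff (N n) x * k x)%:E) = (fun x => (k x * cutoff (N n) x)%:E).
    by apply/funext => x; rewrite mulrC.
  by apply: integrableM_continuous => //; apply: w; exact: ccut.
(* The weak formulation tested with cutoff times phi. *)
have key n : A n - B n + I n = 0.
  have [C1 dC] := C1c_cutoff (N0 n) (Nab n) dp cdp.
  have := weak _ C1; rewrite dC => E.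
  have i1 : mu.-integrable `]a, b[ (fun x => (f x * (cutoff (N n) x * dphi x +
      (rise (N n) x - fall (N n) x) * phi x))%:E).
    apply: integrable_continuous_oo; apply: wM => //; apply: w => x.
    apply: cvgD; apply: cvgM; [exact: ccut|exact: cdp| |exact: cphi].
    by apply: cvgB; [exact: continuous_rise|exact: continuous_fall].
  have i2 : mu.-integrable `]a, b[ (fun x => (g x * (cutoff (N n) x * phi x))%:E).
    apply: integrableM_continuous => //; apply: w => x.
    by apply: cvgM; [exact: ccut|exact: cphi].
  have E2 : (\int[mu]_(x in `]a, b[) (f x * (cutoff (N n) x * dphi x +
      (rise (N n) x - fall (N n) x) * phi x)))%R =
      - (\int[mu]_(x in `]a, b[) (g x * (cutoff (N n) x * phi x)))%R.
    by rewrite /Rintegral E fineN.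
  have iB := integrableB mI (irise n) (ifall n).
  rewrite /A /B /I -RintegralB; [|exact: mI|exact: irise|exact: ifall].
  rewrite -RintegralD; [|exact: mI|exact: iB|exact: icut].
  rewrite -[RHS](addNr (\int[mu]_(x in `]a, b[) (g x * (cutoff (N n) x * phi x)))%R).
  rewrite -E2 -RintegralD; [|exact: mI|exact: i1|exact: i2]; apply: eq_Rintegral => x _.
  by rewrite /h /k; ring.
have cA : A n @[n --> \oo] --> h a.
  apply/cvgrPdist_le => e e0.
  have aab : `[a, b]%classic a by rewrite /= in_itv/= lexx ltW.
  have [del del0 Hdel] := within_continuous_dist ch aab e0.
  near=> n; rewrite distrC; apply: average_close => //.
  - exact: ltW.
  - by move=> x _; rewrite rise_ge0// ltW.
  - by apply: integrable_continuous_oo; apply: w; exact: continuous_rise.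
  - exact: Rintegral_rise.
  move=> x /=; rewrite in_itv/= => /andP[ax xb] /rise_neq0 Nx.
  rewrite distrC; apply: Hdel; first by rewrite /= in_itv/= !ltW.
  rewrite ltr0_norm ?subr_lt0// opprB.
  have : 2 <= N n * (a + del / 2 - a).
    near: n; apply: scaled_cvg_itv; rewrite ltrDl divr_gt0//.
  rewrite addrAC subrr add0r => N2.
  have : x - a <= del / 2 by rewrite -(ler_pM2l (N0 n)) (le_trans Nx).
  move=> /le_lt_trans; apply; rewrite ltr_pdivrMr// ltr_pMr//.
  by rewrite ltr1n.
have cB : B n @[n --> \oo] --> h b.
  apply/cvgrPdist_le => e e0.
  have bab : `[a, b]%classic b by rewrite /= in_itv/= lexx ltW.
  have [del del0 Hdel] := within_continuous_dist ch bab e0.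
  near=> n; rewrite distrC; apply: average_close => //.
  - exact: ltW.
  - by move=> x _; rewrite fall_ge0// ltW.
  - by apply: integrable_continuous_oo; apply: w; exact: continuous_fall.
  - exact: Rintegral_fall.
  move=> x /=; rewrite in_itv/= => /andP[ax xb] /fall_neq0 Nx.
  rewrite distrC; apply: Hdel; first by rewrite /= in_itv/= !ltW.
  rewrite gtr0_norm ?subr_gt0//.
  have : 2 <= N n * (a + del / 2 - a).
    near: n; apply: scaled_cvg_itv; rewrite ltrDl divr_gt0//.
  rewrite addrAC subrr add0r => N2.
  have : b - x <= del / 2 by rewrite -(ler_pM2l (N0 n)) (le_trans Nx).
  move=> /le_lt_trans; apply; rewrite ltr_pdivrMr// ltr_pMr//.
  by rewrite ltr1n.
have cI : I n @[n --> \oo] --> (\int[mu]_(x in `]a, b[) k x)%R.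
  have mk := measurable_int _ ik.
  apply: fine_cvg; rewrite fineK; last exact: integrable_fin_num.
  apply: (@dominated_cvg _ _ R mu `]a, b[%classic _ _ _ (fun x => `|k x|%:E)) => //.
  - by move=> n; exact: measurable_int (icut n).
  - move=> x /=; rewrite in_itv/= => /andP[ax xb].
    apply: cvg_near_cst; near=> n; rewrite cutoff_eq1 ?mul1r//.
      near: n; exact: scaled_cvg_itv.
    near: n; exact: scaled_cvg_itv.
  - exact: (integrable_norm ik).
  - move=> n x _; rewrite /= lee_fin normrM.
    have /andP[c0 c1] := cutoff01 x (Nab n).
    by rewrite (ger0_norm c0) ler_piMl.
have c0 : (A n - B n + I n) @[n --> \oo] --> h a - h b + (\int[mu]_(x in `]a, b[) k x)%R.
  by apply: cvgD => //; exact: cvgB.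
have := cvg_lim (@Rhausdorff R) c0.
under eq_fun do rewrite key.
rewrite lim_cst// => E.
apply/eqP; rewrite -/(h a) -/(h b) -subr_eq0 opprB [h a - h b]addrC addrA.
by apply/eqP; rewrite [RHS]E /k; ring.
Unshelve. all: by end_near. Qed.
End ibp.

(** * Weak derivatives on open sets *)

Lemma continuous_coord {R : realType} {d : nat} (T : topologicalType)
    (V : T -> 'rV[R]_d) i : continuous V -> continuous (fun t => V t 0 i).
Proof.
move=> cV t; apply: (@continuous_comp _ _ _ V (fun z : 'rV[R]_d => z 0 i)).
  exact: cV.
exact: coord_continuous.
Qed.

Section weak_derivative_theory.
Context {R : realType}.
Local Notation mu := (@lebesgue_measure R).

(** By Lebesgue differentiation, almost everywhere k is the derivative of its
    primitive, which is constant. *)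
Lemma ae_eq0_itv (k : R -> R) (s t : R) : mu.-integrable `]s, t[ (EFin \o k) ->
  (forall x, s < x < t -> (\int[mu]_(y in `]s, x[) k y)%R = 0) ->
  {ae mu, forall x, s < x < t -> k x = 0}.
Proof.
move=> ik k0; pose k' := k \_ `]s, t[.
have ik' : mu.-integrable setT (EFin \o k').
  rewrite /k' -restrict_EFin.
  by rewrite -integrable_mkcond.
have := @FTC1 R k' (BRight s) _ _.
case.
- by move=> y; apply: integrableS ik'.
- by apply: open_integrable_locally => //; exact: openT.
move=> N [mN N0 NP]; exists N; split => // x /= nx; apply: NP => /= H.
apply: nx => /andP[sx xt].
have Hsx : (BRight s < BRight x)%O by rewrite bnd_simp.
have [_] := H Hsx; rewrite /k' patchE mem_set/=; last by rewrite in_itv/= sx xt.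
move=> <-; rewrite derive1E -[RHS](derive_cst (0 : R) x (1:R)).
apply: near_eq_derive.
near=> y.
have sy : s < y by near: y; exact: lt_nbhsr.
have yt : y < t by near: y; exact: lt_nbhsl.
rewrite -Rintegral_itv_bndo_bndc; last by apply: integrableS ik'.
rewrite -[RHS](k0 y) ?sy//; apply: eq_Rintegral => z; rewrite inE/= in_itv/= => /andP[sz zy].
by rewrite patchE mem_set//= in_itv/= sz (lt_trans zy).
Unshelve. all: by end_near. Qed.

Context {d : nat}.
Implicit Types (O : set R) (u v g h : R -> 'rV[R]_d).

Lemma C1c_deriv0 (phi : R -> R) K t : compact K ->
  (forall t, ~ K t -> phi t = 0) -> ~ K t -> (phi^`())%classic t = 0.
Proof.
move=> cK phi0 Kt.
have oK : open (~` K).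
  by apply: closed_openC; apply: compact_closed => //; exact: order_hausdorff.
have -> : (phi^`())%classic t = ((cst 0 : R -> R)^`())%classic t.
  rewrite !derive1E; apply: near_eq_derive.
  have : \forall x \near t, (~` K) x by exact: open_nbhs_nbhs.
  by apply: filterS => x; exact: phi0.
by rewrite derive1_cst.
Qed.

Lemma locally_integrableS O O' (f : R -> R) : open O' -> O' `<=` O ->
  locally_integrable O f -> locally_integrable O' f.
Proof.
move=> oO' sO [mf oO fin]; split => //.
- by apply: measurable_funS mf => //; exact: open_measurable.
- by move=> K KO; apply: fin; exact: subset_trans KO sO.
Qed.

Lemma is_weak_derivativeS O O' u g : open O' -> O' `<=` O ->
  is_weak_derivative O u g -> is_weak_derivative O' u g.
Proof.
move=> oO' sO [lu lg ug]; split.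
- by move=> i; exact: locally_integrableS (lu i).
- by move=> i; exact: locally_integrableS (lg i).
move=> phi [p1 p2 [K [cK KO phi0]]] i.
have E (f psi : R -> R) : (forall t, ~ K t -> psi t = 0) ->
  (\int[mu]_(t in O') (f t * psi t)%:E = \int[mu]_(t in O) (f t * psi t)%:E)%E.
  move=> psi0; rewrite -[in LHS](setIidr sO) integral_mkcondr.
  apply: eq_integral => t _; rewrite patchE; case: ifPn => // /negP tO'.
  by rewrite psi0 ?mulr0// => Kt; apply: tO'; apply/mem_set/KO.
rewrite !E//; last by move=> t; exact: C1c_deriv0.
apply: ug; split => //; exists K; split => //; exact: subset_trans KO sO.
Qed.

Lemma eq_is_weak_derivative O u v g : {in O, u =1 v} ->
  is_weak_derivative O u g -> is_weak_derivative O v g.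
Proof.
move=> uv [lu lg ug]; split => //.
- move=> i; have [mf oO fin] := lu i; split => //.
    by apply: eq_measurable_fun mf => t tO; rewrite uv.
  move=> K KO cK; apply: le_lt_trans (fin K KO cK); rewrite le_eqVlt.
  apply/orP; left; apply/eqP; apply: eq_integral => t /set_mem Kt.
  by rewrite uv//; apply/mem_set/KO.
move=> phi phiO i; rewrite -ug//; apply: eq_integral => t tO.
by rewrite uv.
Qed.

Lemma locally_integrable_itv O (f : R -> R) (s t : R) : `[s, t] `<=` O ->
  locally_integrable O f -> mu.-integrable `]s, t[ (EFin \o f).
Proof.
move=> sO [mf oO fin]; apply: (@integrableS _ _ R mu `[s, t]) => //.
  exact: subset_itv_oo_cc.
apply/integrableP; split; last by apply: fin => //; exact: segment_compact.
by apply/measurable_EFinP; apply: measurable_funS mf => //; exact: open_measurable.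
Qed.

Lemma L1loc_continuous O u : open O -> continuous u -> L1loc O u.
Proof.
move=> oO cu i; have cui : continuous (fun t => u t 0 i) by exact: continuous_coord.
split => //; first by apply: measurable_funTS; exact: continuous_measurable_fun.
move=> K _ cK.
have /integrableP[_] // : mu.-integrable K (EFin \o (fun t => u t 0 i)).
by apply: continuous_compact_integrable => //; exact: continuous_subspaceT.
Qed.

Lemma weak_ftc u g i (s t : R) : s < t ->
  {within `[s, t], continuous (fun x => u x 0 i)} ->
  mu.-integrable `]s, t[ (EFin \o (fun x => g x 0 i)) ->
  is_weak_derivative `]s, t[ u g ->
  (\int[mu]_(x in `]s, t[) g x 0 i)%R = u t 0 i - u s 0 i.
Proof.
move=> st cu ig [_ _ ug].
have := weak_ibp st cu ig (fun psi hpsi => ug psi hpsi i)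
  (fun x => is_derive_cst (1:R) x (1:R)) _.
rewrite !mulr1 => <-; last by move=> x; exact: cvg_cst.
by apply: eq_Rintegral => x _; rewrite mulr0 mulr1 add0r.
Qed.

(** Integration by parts with the test function 1 shows that g and h have the same
    integral, the increment of u, over every interval with closure in O. Hence
    they agree almost everywhere on each rational interval with closure in O, and
    countably many of these cover O. *)
Lemma weak_derivative_unique O u v g h : open O ->
  {in O, continuous u} -> {in O, u =1 v} ->
  is_weak_derivative O u g -> is_weak_derivative O v h ->
  {ae mu, forall x, O x -> g x = h x}.
Proof.
move=> oO cu uv ug vh.
have uh : is_weak_derivative O u h.
  by apply: eq_is_weak_derivative vh => x xO; rewrite uv.
(* An enumeration of the pairs of rationals; the default pair gives an empty
   interval. *)
pose p (n : nat) : rat * rat := odflt (0, 0) (unpickle n).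
pose I (n : nat) := `](ratr (p n).1 : R), (ratr (p n).2 : R)[%classic.
suff H : {ae mu, forall x, forall n,
    `[(ratr (p n).1 : R), (ratr (p n).2 : R)] `<=` O -> I n x -> g x = h x}.
  apply: filterS H; first exact: (ae_filter_ringOfSetsType mu).
  move=> x H Ox.
  have [e /= e0 He] : \forall y \near x, O y by exact: open_nbhs_nbhs.
  have xe : x - e < x by rewrite ltrBlDr ltrDl.
  have [q1] := rat_in_itvoo xe.
  rewrite in_itv/= => /andP[q1l q1r].
  have xe' : x < x + e by rewrite ltrDl.
  have [q2] := rat_in_itvoo xe'.
  rewrite in_itv/= => /andP[q2l q2r].
  have pE : p (pickle (q1, q2)) = (q1, q2) by rewrite /p pickleK.
  apply: (H (pickle (q1, q2))); last by rewrite /I pE/= in_itv/= q1r q2l.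
  rewrite pE => y /=; rewrite in_itv/= => /andP[y1 y2]; apply: He => /=.
  by rewrite ltr_norml; apply/andP; split; lra.
apply: ae_foralln => n.
have [sO|nsO] := pselect (`[(ratr (p n).1 : R), (ratr (p n).2 : R)] `<=` O); last first.
  by apply: aeW => x /nsO.
have H i : {ae mu, forall x, ratr (p n).1 < x < (ratr (p n).2 : R) ->
    g x 0 i - h x 0 i = 0}.
  have [_ lg _] := ug; have [_ lh _] := uh.
  have ig := locally_integrable_itv sO (lg i).
  have ih := locally_integrable_itv sO (lh i).
  apply: ae_eq0_itv.
    exact: (integrableB _ ig ih).
  move=> x /andP[x1 x2].
  have sub : `]ratr (p n).1, x[ `<=` `](ratr (p n).1 : R), (ratr (p n).2 : R)[.
    by apply: subset_itvl; rewrite bnd_simp ltW.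
  have sub' : `](ratr (p n).1 : R), x[ `<=` O.
    by apply: subset_trans sO; apply: (subset_trans sub); exact: subset_itv_oo_cc.
  have ig' : mu.-integrable `]ratr (p n).1, x[ (EFin \o (fun t => g t 0 i)).
    by apply: integrableS ig.
  have ih' : mu.-integrable `]ratr (p n).1, x[ (EFin \o (fun t => h t 0 i)).
    by apply: integrableS ih.
  have cu' : {within `[ratr (p n).1, x], continuous (fun x => u x 0 i)}.
    apply: continuous_in_subspaceT => y /set_mem/= yI.
    have Oy : O y.
      by apply: sO; apply: subset_itvl yI; rewrite bnd_simp ltW.
    apply: (@continuous_comp _ _ _ u (fun z : 'rV[R]_d => z 0 i)).
      exact: (cu y (mem_set Oy)).
    exact: coord_continuous.
  rewrite RintegralB//.
  rewrite (weak_ftc x1 cu' ig')//; last first.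
    by apply: (is_weak_derivativeS _ sub'); [exact: interval_open|exact: ug].
  rewrite (weak_ftc x1 cu' ih')//; last first.
    by apply: (is_weak_derivativeS _ sub'); [exact: interval_open|exact: uh].
  by rewrite subrr.
have H' : {ae mu, forall x i, ratr (p n).1 < x < (ratr (p n).2 : R) -> g x 0 i - h x 0 i = 0}.
  exact: filter_forall.
apply: filterS H'; first exact: (ae_filter_ringOfSetsType mu).
move=> x H' _ xI.
apply/rowP => i; apply/eqP; rewrite -subr_eq0; apply/eqP; apply: H'.
by move: xI; rewrite /I/= in_itv.
Qed.
End weak_derivative_theory.

(** * Euclidean norm and powers *)

Section euclidean.
Context {R : realType} {d : nat}.
Implicit Types (x y : 'rV[R]_d) (r eta a : R).

Lemma coord_le_euclidean_norm x i : `|x 0 i| <= euclidean_norm x.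
Proof.
rewrite -ler_sqr ?nnegrE ?euclidean_norm_ge0// /euclidean_norm sqr_sqrtr.
  rewrite -normrX ger0_norm ?sqr_ge0// (bigD1 i)//= lerDl sumr_ge0// => j _.
  exact: sqr_ge0.
by rewrite sumr_ge0// => j _; exact: sqr_ge0.
Qed.

Lemma euclidean_norm_le_coord x (M : R) : 0 <= M -> (forall i, `|x 0 i| <= M) ->
  euclidean_norm x <= d%:R * M.
Proof.
move=> M0 xM; have dM : 0 <= d%:R * M by rewrite mulr_ge0.
rewrite -ler_sqr ?nnegrE ?euclidean_norm_ge0// /euclidean_norm sqr_sqrtr; last first.
  by rewrite sumr_ge0// => j _; exact: sqr_ge0.
rewrite (@le_trans _ _ (\sum_(i < d) M ^+ 2))//.
  apply: ler_sum => i _; rewrite -real_normK ?num_real//.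
  by rewrite ler_sqr ?nnegrE.
rewrite sumr_const card_ord -[leLHS]mulr_natl exprMn ler_wpM2r ?sqr_ge0//.
have [->|d0] := eqVneq d 0%N; first by rewrite expr0n.
by rewrite -natrX ler_nat expnS expn1 leq_pmulr// lt0n.
Qed.

Lemma euclidean_normN x : euclidean_norm (- x) = euclidean_norm x.
Proof. by rewrite -scaleN1r euclidean_normZ normrN1 mul1r. Qed.

Lemma euclidean_normD_powR x y r : 0 <= r ->
  euclidean_norm (x + y) `^ r <=
  2 `^ r * (euclidean_norm x `^ r + euclidean_norm y `^ r).
Proof.
move=> r0; apply: (@le_trans _ _
    ((2 * Num.max (euclidean_norm x) (euclidean_norm y)) `^ r)).
  apply: ge0_ler_powR => //; rewrite ?nnegrE ?euclidean_norm_ge0//.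
    by rewrite mulr_ge0// le_max euclidean_norm_ge0.
  exact: euclidean_normD_le.
rewrite powRM ?le_max ?euclidean_norm_ge0// ler_wpM2l ?powR_ge0//.
by rewrite maxEle; case: ifP => _; rewrite ?lerDl ?lerDr powR_ge0.
Qed.

(** A substitute for Young and Hoelder inequalities: either a <= eta, or
    (a / eta)^(r - 1) >= 1. *)
Lemma le_young r eta a : 1 < r -> 0 < eta -> 0 <= a ->
  a <= eta + eta `^ (1 - r) * a `^ r.
Proof.
move=> r1 e0 a0; have [ae|ea] := leP a eta.
  by rewrite (le_trans ae)// lerDl mulr_ge0 ?powR_ge0.
have a0' : 0 < a by exact: lt_trans ea.
apply: (@le_trans _ _ (eta `^ (1 - r) * a `^ r)); last by rewrite lerDr ltW.
rewrite -{1}(powRr1 a0) -{1}[1](subrK r) powRD; last first.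
  by rewrite (gt_eqF a0') implybT.
rewrite ler_wpM2r ?powR_ge0//.
rewrite -opprB !powRN lef_pV2 ?posrE ?powR_gt0//.
by apply: ge0_ler_powR; rewrite ?nnegrE ?subr_ge0 ltW.
Qed.

Lemma powR_inv_le r eta a : 0 < r -> 0 <= a -> 0 <= eta ->
  (a `^ r^-1 <= eta) = (a <= eta `^ r).
Proof.
move=> r0 a0 e0; have rn0 : r != 0 by rewrite gt_eqF.
have mono (s x y : R) : 0 < s -> 0 <= x -> 0 <= y -> x <= y -> x `^ s <= y `^ s.
  by move=> s0 x0 y0; apply: ge0_ler_powR; rewrite ?nnegrE// ltW.
apply/idP/idP => h.
  rewrite -(powRr1 a0) -(mulVf rn0) powRrM.
  by apply: mono => //; exact: powR_ge0.
rewrite -[leRHS](powRr1 e0) -(mulfV rn0) powRrM.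
by apply: mono => //; rewrite ?invr_gt0 ?powR_ge0.
Qed.

Lemma powR_le_inj (r x y : R) : 0 < r -> 0 <= x -> 0 <= y ->
  x `^ r <= y `^ r -> x <= y.
Proof.
move=> r0 x0 y0; rewrite !leNgt; apply: contra => yx.
by apply: gt0_ltr_powR; rewrite ?nnegrE.
Qed.

(** At the scale a = eta, the right-hand side of [le_young] is 2 eta: an L^r bound
    by eta turns into an L^1 bound that is linear in eta. *)
Lemma powR_young_scale r eta : 0 < eta -> eta `^ (1 - r) * eta `^ r = eta.
Proof.
move=> e0; rewrite -powRD; last by rewrite (gt_eqF e0) implybT.
by rewrite subrK powRr1// ltW.
Qed.
End euclidean.

(** * Weighted L^r integrals *)

Section Lr.
Context {R : realType} {d : nat}.
Local Notation mu := (@lebesgue_measure R).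
Implicit Types (O : set R) (u v g h : R -> 'rV[R]_d) (w : R -> R) (r eta a b : R).

Lemma measurable_pow_weight w r O g : measurable_fun O w ->
  (forall i, measurable_fun O (fun t => g t 0 i)) ->
  measurable_fun O (fun t => (euclidean_norm (g t) `^ r * w t)%:E).
Proof.
move=> mw mg; apply/measurable_EFinP/measurable_funM => //.
apply: (@measurableT_comp _ _ _ _ _ _ (@powR R ^~ _)) => //.
exact: measurable_euclidean_norm.
Qed.

Lemma pow_weight_ge0 w r g t : (forall t, 0 <= w t) ->
  (0 <= (euclidean_norm (g t) `^ r * w t)%:E)%E.
Proof. by move=> w0; rewrite lee_fin mulr_ge0 ?powR_ge0. Qed.

Lemma int_pow_ge0 w r O g : (forall t, 0 <= w t) -> 0 <= int_pow w r O g.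
Proof. by move=> w0; rewrite fine_ge0// integral_ge0// => t _; exact: pow_weight_ge0. Qed.

Lemma int_powE w r O g : (forall t, 0 <= w t) -> weighted_Lr w r O g ->
  (\int[mu]_(t in O) (euclidean_norm (g t) `^ r * w t)%:E = (int_pow w r O g)%:E)%E.
Proof.
move=> w0 [_ fin]; rewrite fineK// ge0_fin_numE// integral_ge0// => t _.
exact: pow_weight_ge0.
Qed.

Lemma weighted_Lr_le w w' r c O O' g : measurable O -> measurable O' -> O' `<=` O ->
  measurable_fun O w -> measurable_fun O' w' ->
  (forall t, 0 <= w t) -> (forall t, 0 <= w' t) -> 0 <= c ->
  (forall t, O' t -> w' t <= c * w t) ->
  weighted_Lr w r O g ->
  weighted_Lr w' r O' g /\ int_pow w' r O' g <= c * int_pow w r O g.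
Proof.
move=> mO mO' sO mw mw' w0 w'0 c0 wle Lg; have [mg fin] := Lg.
have mg' i : measurable_fun O' (fun t => g t 0 i) by exact: measurable_funS (mg i).
have mwO' : measurable_fun O' w by exact: measurable_funS mw.
have le : (\int[mu]_(t in O') (euclidean_norm (g t) `^ r * w' t)%:E <=
    c%:E * \int[mu]_(t in O) (euclidean_norm (g t) `^ r * w t)%:E)%E.
  apply: (@le_trans _ _
      (\int[mu]_(t in O') (c%:E * (euclidean_norm (g t) `^ r * w t)%:E))%E).
    apply: ge0_le_integral; first exact: mO'.
    - by move=> t _; exact: pow_weight_ge0.
    - exact: measurable_pow_weight.
    - by apply: measurable_funeM; exact: measurable_pow_weight.
    - move=> t O't; rewrite -EFinM lee_fin mulrCA ler_wpM2l ?powR_ge0//.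
      exact: wle.
  rewrite ge0_integralZl//.
  - apply: lee_wpmul2l; first by rewrite lee_fin.
    apply: ge0_subset_integral; [exact: mO'|exact: mO| | |exact: sO].
      exact: measurable_pow_weight.
    by move=> t _; exact: pow_weight_ge0.
  - exact: measurable_pow_weight.
  - by move=> t _; exact: pow_weight_ge0.
have Lg' : weighted_Lr w' r O' g.
  split => //; apply: (le_lt_trans le); rewrite lte_mul_pinfty ?lee_fin//.
split => //; rewrite -lee_fin EFinM -!int_powE//.
Qed.

Lemma weighted_LrS w r O O' g : measurable O -> measurable O' -> O' `<=` O ->
  measurable_fun O w -> (forall t, 0 <= w t) ->
  weighted_Lr w r O g ->
  weighted_Lr w r O' g /\ int_pow w r O' g <= int_pow w r O g.
Proof.
move=> mO mO' sO mw w0 Lg; rewrite -[X in _ /\ _ <= X]mul1r.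
apply: weighted_Lr_le => //.
- exact: measurable_funS mw.
- by move=> t _; rewrite mul1r.
Qed.

Lemma weighted_Lr_ae w r O g h : measurable O ->
  measurable_fun O w -> (forall t, 0 <= w t) ->
  (forall i, measurable_fun O (fun t => h t 0 i)) ->
  {ae mu, forall t, O t -> g t = h t} ->
  weighted_Lr w r O g -> weighted_Lr w r O h /\ int_pow w r O h = int_pow w r O g.
Proof.
move=> mO mw w0 mh gh [mg fin].
have E : (\int[mu]_(t in O) (euclidean_norm (h t) `^ r * w t)%:E =
          \int[mu]_(t in O) (euclidean_norm (g t) `^ r * w t)%:E)%E.
  apply: ge0_ae_eq_integral; first exact: mO.
  - exact: measurable_pow_weight.
  - exact: measurable_pow_weight.
  - by move=> t _; exact: pow_weight_ge0.
  - by move=> t _; exact: pow_weight_ge0.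
  apply: filterS gh; first exact: (ae_filter_ringOfSetsType mu).
  by move=> t gh Ot; rewrite gh.
have E' : int_pow w r O h = int_pow w r O g by exact: (congr1 fine E).
split; last exact: E'.
split; first exact: mh.
rewrite E.
exact: fin.
Qed.

(** The derivative chosen in [weak_derivative] inherits the integrability of any
    other one, by uniqueness. *)
Lemma weak_derivative_xget w r O u g : open O -> {in O, continuous u} ->
  measurable_fun O w -> (forall t, 0 <= w t) ->
  is_weak_derivative O u g -> weighted_Lr w r O g ->
  [/\ is_weak_derivative O u (weak_derivative O u),
      {ae mu, forall t, O t -> weak_derivative O u t = g t},
      weighted_Lr w r O (weak_derivative O u) &
      int_pow w r O (weak_derivative O u) = int_pow w r O g].
Proof.
move=> oO cu mw w0 ug Lg.
have uD : is_weak_derivative O u (weak_derivative O u).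
  by apply: (xgetPex 0); exists g.
have ae : {ae mu, forall t, O t -> g t = weak_derivative O u t}.
  by apply: (weak_derivative_unique oO cu _ ug uD).
have mD i : measurable_fun O (fun t => weak_derivative O u t 0 i).
  by have [_ /(_ i)[]] := uD.
have [LD ED] := weighted_Lr_ae (open_measurable oO) mw w0 mD ae Lg.
split; [exact: uD| |exact: LD|exact: ED].
apply: filterS ae; first exact: (ae_filter_ringOfSetsType mu).
by move=> t + Ot => ->.
Qed.

Lemma measurable_norm_is_Lr r O g : is_Lr r O g ->
  measurable_fun O (fun t => (euclidean_norm (g t))%:E).
Proof. by move=> [mg _]; apply/measurable_EFinP; exact: measurable_euclidean_norm. Qed.

Lemma is_Lr_norm_le r a b g eta : 1 < r -> a <= b -> 0 < eta ->
  is_Lr r `]a, b[ g ->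
  (\int[mu]_(t in `]a, b[) (euclidean_norm (g t))%:E <=
   (eta * (b - a) + eta `^ (1 - r) * int_pow (cst 1) r `]a, b[ g)%:E)%E.
Proof.
move=> r1 ab e0 Lg; have [mg fin] := Lg.
have m1 : measurable_fun `]a, b[ (cst 1 : R -> R) by exact: measurable_cst.
apply: (@le_trans _ _ (\int[mu]_(t in `]a, b[) (eta%:E +
  (eta `^ (1 - r))%:E * (euclidean_norm (g t) `^ r * cst 1 t)%:E))%E).
  apply: ge0_le_integral => //.
  - by move=> t _; rewrite lee_fin euclidean_norm_ge0.
  - exact: measurable_norm_is_Lr Lg.
  - apply: emeasurable_funD; first exact: measurable_cst.
    by apply: measurable_funeM; exact: measurable_pow_weight.
  move=> t _; rewrite -EFinM -EFinD lee_fin mulr1.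
  by apply: le_young => //; exact: euclidean_norm_ge0.
rewrite ge0_integralD//; last 3 first.
- by move=> t _; rewrite lee_fin ltW.
- move=> t _; rewrite mule_ge0// ?lee_fin ?powR_ge0//.
  by rewrite mulr_ge0 ?powR_ge0.
- by apply: measurable_funeM; exact: measurable_pow_weight.
rewrite integral_cst//= lebesgue_measure_itv/= lte_fin.
rewrite ge0_integralZl//; last 3 first.
- exact: measurable_pow_weight.
- by move=> t _; rewrite lee_fin mulr_ge0 ?powR_ge0.
- by rewrite lee_fin powR_ge0.
rewrite int_powE// EFinD EFinM EFinM leeD//.
by case: ifPn => [_|]; rewrite ?EFinB// mule0 mule_ge0// lee_fin ?subr_ge0// ltW.
Qed.

Lemma is_Lr_integrable_norm r a b g : 1 < r -> a <= b -> is_Lr r `]a, b[ g ->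
  mu.-integrable `]a, b[ (EFin \o (fun t => euclidean_norm (g t))).
Proof.
move=> r1 ab Lg; apply/integrableP; split; first exact: measurable_norm_is_Lr Lg.
apply: (@le_lt_trans _ _ _ _ _ _ (ltry _)).
under eq_integral => t _ do rewrite /= ger0_norm ?euclidean_norm_ge0//.
exact: (is_Lr_norm_le r1 ab ltr01 Lg).
Qed.

Lemma is_Lr_integrable_coord r a b g i : 1 < r -> a <= b -> is_Lr r `]a, b[ g ->
  mu.-integrable `]a, b[ (EFin \o (fun t => g t 0 i)).
Proof.
move=> r1 ab Lg; apply: (le_integrable _ _ _ (is_Lr_integrable_norm r1 ab Lg)) => //.
  by have [mg _] := Lg; apply/measurable_EFinP; exact: mg.
move=> t _ /=; rewrite lee_fin (ger0_norm (euclidean_norm_ge0 _)).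
exact: coord_le_euclidean_norm.
Qed.

(** Comparison of the L^1 and L^r norms on a bounded interval, with the constant of
    [le_young] instead of the optimal one. *)
Lemma is_Lr_Rintegral_norm_le r a b g eta : 1 < r -> a <= b -> 0 < eta ->
  is_Lr r `]a, b[ g -> int_pow (cst 1) r `]a, b[ g <= eta `^ r ->
  (\int[mu]_(t in `]a, b[) euclidean_norm (g t))%R <= (b - a + 1) * eta.
Proof.
move=> r1 ab e0 Lg le; have := is_Lr_norm_le r1 ab e0 Lg.
have iL := is_Lr_integrable_norm r1 ab Lg.
rewrite -[X in (X <= _)%E]fineK; last first.
  by apply: (@integrable_fin_num _ _ R mu `]a, b[ _ _ iL).
rewrite lee_fin => /le_trans; apply.
rewrite mulrDl mul1r [eta * _]mulrC lerD2l.
by rewrite -[leRHS](powR_young_scale r e0) ler_wpM2l ?powR_ge0.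
Qed.

Lemma continuous_is_Lr r (s t : R) u : 0 <= r -> continuous u -> is_Lr r `]s, t[ u.
Proof.
move=> r0 cu; have cui i : continuous (fun x => u x 0 i) by exact: continuous_coord.
have mu_ i : measurable_fun `]s, t[ (fun x => u x 0 i).
  by apply: measurable_funTS; exact: continuous_measurable_fun.
have cS : continuous (fun x => \sum_i `|u x 0 i|).
  apply: continuous_big => [|i _ x]; first exact: add_continuous.
  by apply: cvg_norm; exact: cui.
have [M M0 MM] := bounded_continuous_oo
  (continuous_subspaceT cS : {within `[s, t], continuous _}).
split; first exact: mu_.
apply: (@le_lt_trans _ _ (\int[mu]_(x in `]s, t[) ((d%:R * M) `^ r)%:E)%E).
  apply: ge0_le_integral => //.
  - by move=> x _; apply: pow_weight_ge0 => ?; exact: ler01.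
  - by apply: measurable_pow_weight => //; exact: measurable_cst.
  move=> x /=; rewrite in_itv/= => /andP[sx xt]; rewrite lee_fin mulr1.
  apply: ge0_ler_powR; rewrite ?nnegrE ?euclidean_norm_ge0 ?mulr_ge0//.
  apply: euclidean_norm_le_coord => // i.
  apply: le_trans (le_trans (ler_norm _) (MM x _)); last by rewrite !ltW.
  by rewrite (bigD1 i)//= lerDl sumr_ge0.
rewrite integral_cst//= lebesgue_measure_itv/=.
by case: ifP => _; rewrite ?mule0 ?ltry// -EFinB -EFinM ltry.
Qed.

Lemma weak_increment_le r u g i (a b s t : R) : 1 < r -> a < b ->
  {within `[a, b], continuous u} -> is_weak_derivative `]a, b[ u g ->
  is_Lr r `]a, b[ g -> a <= s -> s <= t -> t <= b ->
  `|u t 0 i - u s 0 i| <= (\int[mu]_(x in `]a, b[) euclidean_norm (g x))%R.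
Proof.
move=> r1 ab cu ug Lg as_ st tb.
have iN := is_Lr_integrable_norm r1 (ltW ab) Lg.
move: st; rewrite le_eqVlt => /predU1P[->|st].
  rewrite subrr normr0; apply: Rintegral_ge0 => x _; exact: euclidean_norm_ge0.
have sub : `]s, t[ `<=` `]a, b[ by apply: subset_itv; rewrite bnd_simp.
have ig : mu.-integrable `]s, t[ (EFin \o (fun x => g x 0 i)).
  by apply: integrableS (is_Lr_integrable_coord i r1 (ltW ab) Lg).
have iN' : mu.-integrable `]s, t[ (EFin \o (fun t => euclidean_norm (g t))).
  by apply: integrableS iN.
have cu' : {within `[s, t], continuous (fun x => u x 0 i)}.
  have : {within `[s, t], continuous u}.
    by apply: continuous_subspaceW cu; apply: subset_itv; rewrite bnd_simp.
  exact: (@continuous_coord _ _ (subspace `[s, t])).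
have ug' : is_weak_derivative `]s, t[ u g.
  by apply: is_weak_derivativeS ug => //; exact: interval_open.
rewrite -(weak_ftc st cu' ig ug').
apply: (le_trans (le_normr_Rintegral _ ig)) => //.
apply: (@le_trans _ _ (\int[mu]_(x in `]s, t[) euclidean_norm (g x))%R).
  apply: le_Rintegral => //.
  - exact: (integrable_norm ig).
  - by move=> x _; exact: coord_le_euclidean_norm.
apply: fine_le.
- by apply: (@integrable_fin_num _ _ R mu `]s, t[ _ _ iN').
- by apply: (@integrable_fin_num _ _ R mu `]a, b[ _ _ iN).
apply: ge0_subset_integral => //.
- exact: measurable_norm_is_Lr Lg.
- by move=> x _; rewrite lee_fin euclidean_norm_ge0.
Qed.
End Lr.

(** * Elements of the Sobolev spaces *)

Section W1r_facts.
Context {R : realType} {d : nat}.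
Local Notation mu := (@lebesgue_measure R).
Implicit Types (O : set R) (u v g h : R -> 'rV[R]_d) (w : R -> R) (r eta a b lambda : R).

Lemma within_continuous_in a b u : {within `[a, b], continuous u} ->
  {in `]a, b[%classic, continuous u}.
Proof.
move=> cu x /set_mem xab.
have := @continuous_subspaceW _ _ _ _ u (@subset_itv_oo_cc _ R a b) cu.
rewrite continuous_open_subspace; last exact: interval_open.
by apply; exact/mem_set.
Qed.

Lemma discount_ge0 lambda t : 0 <= discount lambda t.
Proof. exact: expR_ge0. Qed.

Lemma W1r_weak_derivative r a b u : W1r r a b u ->
  is_weak_derivative `]a, b[ u (weak_derivative `]a, b[ u) /\
  is_Lr r `]a, b[ (weak_derivative `]a, b[ u).
Proof.
move=> [cu Lu [g ug Lg]].
have oI : open `]a, b[%classic by exact: interval_open.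
have [h1 _ h2 _] := weak_derivative_xget oI (within_continuous_in cu)
  (@measurable_cst _ _ _ _ `]a, b[%classic (1 : R)) (fun=> ler01) ug Lg.
split; [exact: h1|exact: h2].
Qed.

Lemma W1r_discounted_continuous r lambda u : W1r_discounted r lambda u ->
  {in `]0, +oo[%classic, continuous u}.
Proof.
move=> [Wu _] x; rewrite inE/= in_itv/= andbT => x0.
have x1 : 0 < x + 1 by rewrite addr_gt0.
have [cu _ _] := Wu _ x1.
by apply: (within_continuous_in cu); rewrite inE/= in_itv/= x0 ltrDl ltr01.
Qed.

Lemma W1r_discounted_weak_derivative r lambda u : W1r_discounted r lambda u ->
  is_weak_derivative `]0, +oo[ u (weak_derivative `]0, +oo[ u) /\
  weighted_Lr (discount lambda) r `]0, +oo[ (weak_derivative `]0, +oo[ u).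
Proof.
move=> Wu; have [_ [g ug Lg]] := Wu.
have oI : open `](0 : R), +oo[%classic by exact: interval_open.
have [h1 _ h2 _] := weak_derivative_xget oI (W1r_discounted_continuous Wu)
  (@measurable_discount _ lambda _) (discount_ge0 lambda) ug Lg.
split; [exact: h1|exact: h2].
Qed.

Lemma W1r_discounted_weak_derivative_ae r lambda u g O :
  W1r_discounted r lambda u -> open O -> O `<=` `]0, +oo[ ->
  is_weak_derivative O u g ->
  {ae mu, forall t, O t -> weak_derivative `]0, +oo[ u t = g t}.
Proof.
move=> Wu oO sO ug; have [uD _] := W1r_discounted_weak_derivative Wu.
apply: (weak_derivative_unique oO _ _ (is_weak_derivativeS oO sO uD) ug) => // x.
by move=> /set_mem /sO xO; apply: (W1r_discounted_continuous Wu); exact: mem_set.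
Qed.

Lemma W1rS r a b a' b' u v : a' <= a -> b <= b' -> {in `[a, b], u =1 v} ->
  W1r r a' b' u -> W1r r a b v.
Proof.
move=> aa bb uv [cu Lu [g ug Lg]].
have sub : `]a, b[ `<=` `]a', b'[ by apply: subset_itv; rewrite bnd_simp.
have m1 (A : set R) : measurable_fun A (cst 1 : R -> R) by exact: measurable_cst.
have uv' t : `]a, b[%classic t -> u t = v t.
  by move=> /subset_itv_oo_cc tab; rewrite uv.
split.
- apply: (@subspace_eq_continuous _ _ _ u); first by move=> x /set_mem; exact: uv.
  by apply: continuous_subspaceW cu; apply: subset_itv; rewrite bnd_simp.
- have [Lu' _] := @weighted_LrS _ _ (cst 1) r _ _ u (measurable_itv `]a', b'[)
      (measurable_itv `]a, b[) sub (m1 _) (fun=> ler01) Lu.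
  have mv i : measurable_fun `]a, b[ (fun t => v t 0 i).
    have [mu_ _] := Lu'; apply: eq_measurable_fun (mu_ i) => t /set_mem tab.
    by rewrite uv'.
  have ae : {ae mu, forall t, `]a, b[%classic t -> u t = v t} by exact: aeW.
  have [h _] := weighted_Lr_ae (measurable_itv _) (m1 _) (fun=> ler01) mv ae Lu'.
  exact: h.
- have [Lg' _] := @weighted_LrS _ _ (cst 1) r _ _ g (measurable_itv `]a', b'[)
      (measurable_itv `]a, b[) sub (m1 _) (fun=> ler01) Lg.
  exists g; last exact: Lg'.
  have ug' : is_weak_derivative `]a, b[ u g.
    by apply: is_weak_derivativeS ug => //; exact: interval_open.
  by apply: eq_is_weak_derivative ug' => t /set_mem; exact: uv'.
Qed.

Section sob.
Variables (r : R) (r1 : 1 < r).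

Lemma sobolevP a b (u : sobolev d a b r1) : W1r r a b u.
Proof. by case: u => u /= /[!inE] -[]. Qed.

Lemma sobolev_eq0 a b (u : sobolev d a b r1) t : t \notin `[a, b] -> u t = 0.
Proof. by case: u => u /= /[!inE] -[_ u0] /u0. Qed.

Lemma sobolev_discountedP lambda (u : sobolev_discounted d lambda r1) :
  W1r_discounted r lambda u.
Proof. by case: u => u /= /[!inE] -[]. Qed.

Let r0 : 0 < r. Proof. exact: lt_trans r1. Qed.

Lemma sobolev_norm_le a b (u : sobolev d a b r1) eta : 0 <= eta ->
  sobolev_norm u <= eta <->
  int_pow (cst 1) r `]a, b[ u +
   int_pow (cst 1) r `]a, b[ (weak_derivative `]a, b[ u) <= eta `^ r.
Proof.
move=> e0; rewrite /sobolev_norm powR_inv_le// addr_ge0// int_pow_ge0// => t; exact: ler01.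
Qed.

Lemma sobolev_discounted_norm_le lambda (u : sobolev_discounted d lambda r1) eta :
  0 <= eta ->
  sobolev_discounted_norm u <= eta <->
  euclidean_norm (u 0) `^ r +
   int_pow (discount lambda) r `]0, +oo[ (weak_derivative `]0, +oo[ u) <= eta `^ r.
Proof.
move=> e0; rewrite /sobolev_discounted_norm powR_inv_le// addr_ge0 ?powR_ge0//.
by rewrite int_pow_ge0// => t; exact: discount_ge0.
Qed.
End sob.
End W1r_facts.

(** * Continuation by constants *)

Section clamp.
Context {R : realType}.
Local Notation mu := (@lebesgue_measure R).
Local Notation half_line := (`]0, +oo[%classic : set R).
Implicit Types (a b c t : R).

Lemma Rintegral_oo_split (f : R -> R) a c b : a <= c -> c <= b ->
  mu.-integrable `]a, b[ (EFin \o f) ->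
  (\int[mu]_(x in `]a, b[) f x)%R =
  (\int[mu]_(x in `]a, c[) f x)%R + (\int[mu]_(x in `]c, b[) f x)%R.
Proof.
move=> ac; rewrite le_eqVlt => /predU1P[->|cb] fi.
  by rewrite [in X in _ + X]set_itv_ge ?bnd_simp// Rintegral_set0 addr0.
rewrite -(Rintegral_itvB (x := c) fi) ?bnd_simp//.
rewrite [X in _ = X + _]Rintegral_itv_bndo_bndc; first by rewrite addrC subrK.
by apply: integrableS fi => //; apply: subset_itvl; rewrite bnd_simp ltW.
Qed.

Lemma Rintegral_is_derive_le (F f : R -> R) a b : a <= b ->
  (forall x : R, is_derive x 1 F (f x)) -> continuous f ->
  (\int[mu]_(x in `]a, b[) f x)%R = F b - F a.
Proof.
rewrite le_eqVlt => /predU1P[->|ab] dF cf; last exact: Rintegral_is_derive.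
by rewrite set_itv_ge ?bnd_simp// Rintegral_set0 subrr.
Qed.

Definition clamp a b t := Num.max a (Num.min t b).

Lemma clamp_itv a b t : a <= b -> a <= clamp a b t <= b.
Proof. by move=> ab; rewrite le_max lexx/= ge_max ab/= ge_min lexx orbT. Qed.

Lemma clamp_id a b t : a <= t <= b -> clamp a b t = t.
Proof. by move=> /andP[at_ tb]; rewrite /clamp (min_l tb) max_r. Qed.

Lemma clamp_le a b t : a <= b -> t <= a -> clamp a b t = a.
Proof. by move=> ab ta; rewrite /clamp min_l ?max_l// (le_trans ta). Qed.

Lemma clamp_ge a b t : a <= b -> b <= t -> clamp a b t = b.
Proof. by move=> ab bt; rewrite /clamp min_r ?max_r. Qed.

Lemma continuous_clamp a b : continuous (clamp a b).
Proof.
move=> x; rewrite /clamp.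
apply: (@continuous_max _ _ (cst a) (fun t => Num.min t b)); first exact: cvg_cst.
by apply: (@continuous_min _ _ id (cst b)); [exact: cvg_id|exact: cvg_cst].
Qed.

Lemma continuous_comp_clamp (T : topologicalType) (v : R -> T) a b : a <= b ->
  {within `[a, b], continuous v} -> continuous (fun t => v (clamp a b t)).
Proof.
move=> ab cv x.
have [/(_ cv) + _] := @subspace_continuousP _ `[a, b]%classic _ v.
move=> /(_ (clamp a b x)) H.
have cI t : `[a, b]%classic (clamp a b t) by rewrite /= in_itv/=; exact: clamp_itv.
apply: (@cvg_comp _ _ _ (clamp a b) v _ _ _ _ (H (cI x))) => P; rewrite /within/= => nP.
have nx := @continuous_clamp a b x _ nP.
apply: (@filterS _ (nbhs x) _ (fun t => `[a, b]%classic (clamp a b t) -> P (clamp a b t))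
  (fun t => P (clamp a b t))) => [t|]; first by apply; exact: cI.
exact: nx.
Qed.

(** The constant continuation of f outside [a, b] has no jump, hence its weak
    derivative is that of f continued by zero. The boundary terms of [weak_ibp] on
    ]a, b[ cancel those of the fundamental theorem of calculus applied to phi on
    either side. *)
Lemma clamp_weak_derivative (f g phi : R -> R) a b : 0 <= a -> a < b ->
  {within `[a, b], continuous f} -> mu.-integrable `]a, b[ (EFin \o g) ->
  (forall psi, C1c `]a, b[ psi ->
    (\int[mu]_(t in `]a, b[) (f t * (psi^`())%classic t)%:E =
     - \int[mu]_(t in `]a, b[) (g t * psi t)%:E)%E) ->
  C1c `]0, +oo[ phi ->
  (\int[mu]_(t in half_line) (f (clamp a b t) * (phi^`())%classic t)%:E =
   - \int[mu]_(t in half_line) ((if t \in `]a, b[ then g t else 0) * phi t)%:E)%E.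
Proof.
move=> a0 ab cf ig weak [dphi cdphi [K [cK K0 phi0]]].
have dp (x : R) : is_derive x 1 phi ((phi^`())%classic x).
  by rewrite derive1E; apply: DeriveDef.
have cphi := is_derive_continuous dp.
(* Beyond M the test function vanishes: everything happens on ]0, M[. *)
have [M [bM KM]] : exists M, b < M /\ K `<=` `]0, M[.
  have [B [Br HB]] := compact_bounded cK.
  exists (Num.max (b + 1) (`|B| + 2)); split.
    by rewrite lt_max ltrDl ltr01.
  move=> x Kx; have := K0 _ Kx; rewrite /= !in_itv/= andbT => ->/=.
  rewrite lt_max; apply/orP; right.
  have : `|x| <= `|B| + 1
    by apply: (HB (`|B| + 1)) => //; rewrite (le_lt_trans (ler_norm _))// ltrDl.
  by move=> h; rewrite (le_lt_trans (ler_norm _))// (le_lt_trans h)// ltrD2l ltr1n.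
have M0 : 0 < M by rewrite (le_lt_trans a0)// (lt_trans ab).
have E : (\int[mu]_(t in half_line) (f (clamp a b t) * (phi^`())%classic t)%:E =
    \int[mu]_(t in `]0%R, M[) (f (clamp a b t) * (phi^`())%classic t)%:E)%E.
  have sM : `](0:R), M[ `<=` `]0, +oo[ by apply: subset_itvl; rewrite bnd_simp.
  rewrite -[in RHS](setIidr sM) integral_mkcondr.
  apply: eq_integral => t _; rewrite patchE; case: ifPn => // /negP tM.
  rewrite (C1c_deriv0 cK phi0) ?mulr0// => Kt.
  by apply: tM; apply/mem_set/KM.
have E' : (\int[mu]_(t in half_line) ((if t \in `]a, b[ then g t else 0) * phi t)%:E =
    \int[mu]_(t in `]a, b[) (g t * phi t)%:E)%E.
  have sab : `]a, b[ `<=` `](0:R), +oo[ by apply: subset_itv; rewrite bnd_simp.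
  rewrite -[in RHS](setIidr sab) integral_mkcondr.
  apply: eq_integral => t _; rewrite patchE mem_setE.
  by case: ifPn => // _; rewrite mul0r.
rewrite {}E {}E'.
have cV : continuous (fun t => f (clamp a b t)) := continuous_comp_clamp (ltW ab) cf.
have cVp : continuous (fun t => f (clamp a b t) * (phi^`())%classic t).
  by move=> x; apply: cvgM; [exact: cV|exact: cdphi].
have iV s t : mu.-integrable `]s, t[ (EFin \o (fun t => f (clamp a b t) * (phi^`())%classic t)).
  by apply: integrable_continuous_oo; exact: continuous_subspaceT.
have igp : mu.-integrable `]a, b[ (fun t => (g t * phi t)%:E).
  by apply: integrableM_continuous => //; exact: continuous_subspaceT.
have ifp : mu.-integrable `]a, b[ (fun t => (f t * (phi^`())%classic t)%:E).
  apply: integrable_continuous_oo => x; apply: cvgM; first exact: cf.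
  exact: (continuous_subspaceT cdphi).
have fV := @integrable_fin_num _ _ R mu `]0, M[ (measurable_itv _) _ (iV _ _).
have fgp := @integrable_fin_num _ _ R mu `]a, b[ (measurable_itv _) _ igp.
rewrite -[LHS](fineK fV) -[X in (- X)%E](fineK fgp) -EFinN; congr (_%:E).
rewrite -[LHS]/(\int[mu]_(t in `]0, M[) (f (clamp a b t) * (phi^`())%classic t))%R.
rewrite -[in RHS]/(\int[mu]_(t in `]a, b[) (g t * phi t))%R.
rewrite (Rintegral_oo_split a0 (ltW (lt_trans ab bM)) (iV _ _)).
rewrite (Rintegral_oo_split (ltW ab) (ltW bM) (iV _ _)).
have i0 s t : mu.-integrable `]s, t[ (EFin \o (phi^`())%classic).
  by apply: integrable_continuous_oo; exact: continuous_subspaceT.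
have -> : (\int[mu]_(t in `]0, a[) (f (clamp a b t) * (phi^`())%classic t))%R =
    f a * (phi a - phi 0).
  rewrite -(Rintegral_is_derive_le a0 dp cdphi) -RintegralZl//.
  apply: eq_Rintegral => t /set_mem/=; rewrite in_itv/= => /andP[_ ta].
  by rewrite clamp_le// ltW.
have -> : (\int[mu]_(t in `]b, M[) (f (clamp a b t) * (phi^`())%classic t))%R =
    f b * (phi M - phi b).
  rewrite -(Rintegral_is_derive_le (ltW bM) dp cdphi) -RintegralZl//.
  apply: eq_Rintegral => t /set_mem/=; rewrite in_itv/= => /andP[bt _].
  by rewrite clamp_ge// ltW.
have -> : (\int[mu]_(t in `]a, b[) (f (clamp a b t) * (phi^`())%classic t))%R =
    (\int[mu]_(t in `]a, b[) (f t * (phi^`())%classic t))%R.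
  apply: eq_Rintegral => t /set_mem/=; rewrite in_itv/= => /andP[at_ tb].
  by rewrite clamp_id// !ltW.
have := weak_ibp ab cf ig weak dp cdphi.
rewrite RintegralD//.
rewrite (phi0 0) ?(phi0 M); last 2 first.
- by move=> /KM/=; rewrite in_itv/= ltxx ?andbF.
- by move=> /KM/=; rewrite in_itv/= ltxx ?andbF.
have aux (p q I1 I2 x y : R) : I1 + I2 = q * y - p * x ->
    p * (x - 0) + (I1 + q * (0 - y)) = - I2 by move=> h; lra.
exact: aux.
Qed.
End clamp.

(** * Restriction to an interval and extension to the half line *)

Section restrict.
Context {R : realType} {d : nat}.
Local Notation mu := (@lebesgue_measure R).
Local Notation half_line := (`]0, +oo[%classic : set R).
Variables (r lambda : R) (r1 : 1 < r) (a b : R) (a0 : 0 <= a) (ab : a < b).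

Definition restrict_fun (u : R -> 'rV[R]_d) t := if t \in `[a, b] then u t else 0.

Lemma restrict_fun_pred (u : sobolev_discounted d lambda r1) :
  restrict_fun u \in sobolev_pred a b r1.
Proof.
rewrite inE; split; last by move=> t /negbTE tab; rewrite /restrict_fun tab.
have [Wu _] := sobolev_discountedP u.
have b0 : 0 < b by exact: le_lt_trans ab.
apply: (W1rS a0 (lexx b) _ (Wu b b0)) => t tab.
by rewrite /restrict_fun tab.
Qed.

Definition sobolev_restrict (u : sobolev_discounted d lambda r1) : sobolev d a b r1 :=
  Sobolev (restrict_fun_pred u).

Lemma sobolev_restrict_linear : linear sobolev_restrict.
Proof.
move=> k u v; apply/val_inj/funext => t /=; rewrite /restrict_fun.
rewrite -[RHS]/(k *: (if t \in `[a, b] then u t else 0) + (if t \in `[a, b] then v t else 0)).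
by case: ifPn => // _; rewrite scaler0 addr0.
Qed.

HB.instance Definition _ := GRing.isLinear.Build R
  (sobolev_discounted d lambda r1) (sobolev d a b r1) *:%R sobolev_restrict
  sobolev_restrict_linear.

Lemma sobolev_restrictE u t : a <= t <= b -> sobolev_restrict u t = u t.
Proof. by move=> tab; rewrite /= /restrict_fun in_itv/= tab. Qed.

(** Continuation by the endpoint values, which makes the extension linear on the
    whole space and not only on functions vanishing at the endpoints. Elements of
    the space on the half line are 0 at negative times by convention. *)
Definition extend_fun (v : R -> 'rV[R]_d) t := if t < 0 then 0 else v (clamp a b t).

Definition extend_deriv (v : R -> 'rV[R]_d) t :=
  if t \in `]a, b[ then weak_derivative `]a, b[ v t else 0.

Lemma extend_weak_derivative (v : R -> 'rV[R]_d) : W1r r a b v ->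
  is_weak_derivative half_line (fun t => v (clamp a b t)) (extend_deriv v).
Proof.
move=> Wv; have [cv _ _] := Wv; have [vD LD] := W1r_weak_derivative Wv.
have oH : open half_line by exact: interval_open.
have cV := continuous_comp_clamp (ltW ab) cv.
have gE i : (fun t => extend_deriv v t 0 i) =
    (fun t => weak_derivative `]a, b[ v t 0 i) \_ `]a, b[.
  by apply/funext => t; rewrite patchE mem_setE /extend_deriv; case: ifP => //; rewrite mxE.
split.
- exact: (L1loc_continuous oH cV).
- move=> i; rewrite gE.
  have ig := is_Lr_integrable_coord i r1 (ltW ab) LD.
  apply: (@locally_integrableS _ setT) => //.
  apply: open_integrable_locally; first exact: openT.
  rewrite -restrict_EFin.
  have mI : measurable (`]a, b[%classic : set (measurableTypeR R)) by [].
  by rewrite -(integrable_mkcond _ mI).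
move=> phi phiO i.
have cvi : {within `[a, b], continuous (fun t => v t 0 i)}.
  exact: (@continuous_coord _ _ (subspace `[a, b])).
have [_ _ ug] := vD.
rewrite (clamp_weak_derivative a0 ab cvi (is_Lr_integrable_coord i r1 (ltW ab) LD)
  (fun psi hpsi => ug psi hpsi i) phiO).
congr (- _)%E; apply: eq_integral => t _.
by rewrite /extend_deriv; case: ifP => // _; rewrite mxE.
Qed.

(** Stated for any weight at most 1 because it serves both for the discount factor
    and for the weight 1 of the bounded intervals ]0, t0[. *)
Lemma extend_deriv_Lr (w : R -> R) (v : R -> 'rV[R]_d) (O : set R) :
  measurable O -> O `<=` half_line ->
  measurable_fun O w -> (forall t, 0 <= w t) -> (forall t, 0 <= t -> w t <= 1) ->
  W1r r a b v ->
  weighted_Lr w r O (extend_deriv v) /\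
  int_pow w r O (extend_deriv v) <= int_pow (cst 1) r `]a, b[ (weak_derivative `]a, b[ v).
Proof.
move=> mO OH mw w0 w1 Wv; have [vD LD] := W1r_weak_derivative Wv.
have [_ lg _] := extend_weak_derivative Wv.
have mg i : measurable_fun O (fun t => extend_deriv v t 0 i).
  have [m _ _] := lg i; apply: measurable_funS m => //.
have r0 : r != 0 by rewrite gt_eqF// (lt_trans ltr01).
have c0 t : 0 <= (cst 1 : R -> R) t by exact: ler01.
have [mD finD] := LD.
have mDab : measurable_fun `]a, b[
    (fun t => (euclidean_norm (weak_derivative `]a, b[ v t) `^ r * cst 1 t)%:E).
  by apply: measurable_pow_weight => //; exact: measurable_cst.
have le : (\int[mu]_(t in O) (euclidean_norm (extend_deriv v t) `^ r * w t)%:E <=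
    \int[mu]_(t in `]a, b[) (euclidean_norm (weak_derivative `]a, b[ v t) `^ r * cst 1 t)%:E)%E.
  apply: (@le_trans _ _ (\int[mu]_(t in O `&` `]a, b[)
      (euclidean_norm (weak_derivative `]a, b[ v t) `^ r * cst 1 t)%:E)%E); last first.
    apply: ge0_subset_integral => //; first exact: measurableI.
    by move=> t _; exact: pow_weight_ge0.
  rewrite integral_mkcondr; apply: ge0_le_integral.
  - exact: mO.
  - by move=> t _; exact: pow_weight_ge0.
  - exact: measurable_pow_weight.
  - apply/(measurable_restrict _ _ _).1 => //.
    by apply: measurable_funS mDab => //; exact: subIsetr.
  move=> t Ot; rewrite patchE mem_setE /extend_deriv; case: ifP => _.
    rewrite lee_fin ler_wpM2l ?powR_ge0//; apply: w1.
    by have := OH _ Ot; rewrite /= in_itv/= andbT => /ltW.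
  by rewrite euclidean_norm0 powR0// mul0r.
have L : weighted_Lr w r O (extend_deriv v).
  split; first exact: mg.
  exact: le_lt_trans le finD.
split; first exact: L.
by rewrite -lee_fin -!int_powE.
Qed.

Hypothesis lambda0 : 0 < lambda.

Lemma discount_le1 t : 0 <= t -> discount lambda t <= 1.
Proof. by move=> t0; rewrite -expR0 ler_expR oppr_le0 mulr_ge0// ltW. Qed.

Lemma extend_fun_pred (v : sobolev d a b r1) :
  extend_fun v \in sobolev_discounted_pred lambda r1.
Proof.
have Wv := sobolevP v; have [cv _ _] := Wv.
have cV := continuous_comp_clamp (ltW ab) cv.
have vE := extend_weak_derivative Wv.
have eqV t : 0 <= t -> v (clamp a b t) = extend_fun v t.
  by rewrite leNgt /extend_fun => /negbTE ->.
rewrite inE; split; last by move=> t t0; rewrite /extend_fun t0.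
have oH : open half_line by exact: interval_open.
split; last first.
  exists (extend_deriv v).
    apply: eq_is_weak_derivative vE => t /set_mem/=; rewrite in_itv/= andbT => t0.
    by rewrite eqV// ltW.
  have [h _] := @extend_deriv_Lr (discount lambda) v half_line
    (measurable_itv _) (fun=> id) (@measurable_discount _ lambda _) (discount_ge0 lambda)
    discount_le1 Wv.
  exact: h.
move=> t0 t0_gt0.
apply: (W1rS (lexx 0) (lexx t0) (u := fun t => v (clamp a b t))).
  by move=> t; rewrite in_itv/= => /andP[/eqV].
have sub : `]0, t0[ `<=` half_line by apply: subset_itvl; rewrite bnd_simp.
have m1 (A : set R) : measurable_fun A (cst 1 : R -> R) by exact: measurable_cst.
split.
- exact: continuous_subspaceT.
- by apply: continuous_is_Lr => //; rewrite ltW// (lt_trans ltr01).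
- exists (extend_deriv v).
    by apply: is_weak_derivativeS vE => //; exact: interval_open.
  have [h _] := @extend_deriv_Lr (cst 1) v `]0, t0[ (measurable_itv _) sub
    (m1 _) (fun=> ler01) (fun _ _ => lexx _) Wv.
  exact: h.
Qed.

Definition sobolev_extend (v : sobolev d a b r1) : sobolev_discounted d lambda r1 :=
  SobolevDiscounted (extend_fun_pred v).

Lemma sobolev_extend_linear : linear sobolev_extend.
Proof.
move=> k u v; apply/val_inj/funext => t /=.
rewrite -[RHS]/(k *: extend_fun u t + extend_fun v t) /extend_fun.
by case: ifPn => // _; rewrite scaler0 addr0.
Qed.

HB.instance Definition _ := GRing.isLinear.Build R
  (sobolev d a b r1) (sobolev_discounted d lambda r1) *:%R sobolev_extend
  sobolev_extend_linear.

Lemma sobolev_extendE v t : 0 <= t -> sobolev_extend v t = v (clamp a b t).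
Proof. by rewrite /= /extend_fun ltNge => ->. Qed.

End restrict.

(** * Weak continuity of restriction and extension *)

Section bounds.
Context {R : realType} {d : nat}.
Local Notation mu := (@lebesgue_measure R).
Local Notation half_line := (`]0, +oo[%classic : set R).
Variables (r lambda : R) (r1 : 1 < r).

Let r0 : 0 < r. Proof. exact: lt_trans r1. Qed.

(** Allows a bound between norms to be proved at a level eta above the norm N:
    [le_young] is then used with parameter eta, which unlike N is positive. *)
Lemma le_homogeneous (M N K : R) : 0 <= N -> 0 <= K ->
  (forall eta, 0 < eta -> N <= eta -> M <= K * eta) -> M <= K * N.
Proof.
move=> N0 K0 H; apply/ler_addgt0Pr => e e0.
have K1 : 0 < K + 1 by rewrite ltr_wpDl.
have del0 : 0 < e / (K + 1) by rewrite divr_gt0.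
apply: (le_trans (H (N + e / (K + 1)) _ _)).
- by rewrite ltr_wpDl.
- by rewrite lerDl ltW.
rewrite mulrDr lerD2l mulrA ler_pdivrMr// [e * _]mulrC ler_wpM2r// ?ltW//.
by rewrite ltrDl.
Qed.

Lemma int_pow_le_bound (u : R -> 'rV[R]_d) (a b B : R) : a <= b -> 0 <= B ->
  is_Lr r `]a, b[ u -> (forall t, a < t < b -> euclidean_norm (u t) <= B) ->
  int_pow (cst 1) r `]a, b[ u <= (b - a) * B `^ r.
Proof.
move=> ab B0 Lu uB; have c0 t : 0 <= (cst 1 : R -> R) t by exact: ler01.
rewrite -lee_fin -(int_powE c0 Lu).
apply: (@le_trans _ _ (\int[mu]_(t in `]a, b[) (B `^ r)%:E)%E).
  apply: ge0_le_integral => //.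
  - by move=> t _; exact: pow_weight_ge0.
  - apply: measurable_pow_weight; first exact: measurable_cst.
    by have [mg _] := Lu; exact: mg.
  move=> t /=; rewrite in_itv/= => tab; rewrite lee_fin mulr1.
  apply: ge0_ler_powR; rewrite ?nnegrE ?euclidean_norm_ge0//; first exact: ltW.
  exact: uB.
rewrite integral_cst//= lebesgue_measure_itv/= lte_fin.
case: ifP => [_|_]; first by rewrite -EFinB -EFinM lee_fin mulrC.
by rewrite mule0 lee_fin mulr_ge0 ?powR_ge0// subr_ge0.
Qed.

Lemma weak_derivative_restrict (a b : R) (a0 : 0 <= a) (ab : a < b)
    (u : sobolev_discounted d lambda r1) :
  {ae mu, forall t, `]a, b[%classic t ->
    weak_derivative `]a, b[ (sobolev_restrict a0 ab u) t = weak_derivative half_line u t}.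
Proof.
have Wu := sobolev_discountedP u.
have [vD _] := W1r_weak_derivative (sobolevP (sobolev_restrict a0 ab u)).
have oI : open `]a, b[%classic by exact: interval_open.
have sub : `]a, b[ `<=` half_line by apply: subset_itv; rewrite bnd_simp.
have uD : is_weak_derivative `]a, b[ u (weak_derivative `]a, b[ (sobolev_restrict a0 ab u)).
  apply: eq_is_weak_derivative vD => t /set_mem/subset_itv_oo_cc/= tab.
  by rewrite /restrict_fun tab.
have := W1r_discounted_weak_derivative_ae Wu oI sub uD.
apply: filterS; first exact: (ae_filter_ringOfSetsType mu).
by move=> t H tab; rewrite H.
Qed.

Lemma discounted_Lr_itv (u : R -> 'rV[R]_d) (b : R) : 0 < lambda ->
  weighted_Lr (discount lambda) r half_line u ->
  is_Lr r `]0, b[ u /\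
  int_pow (cst 1) r `]0, b[ u <= expR (lambda * b) * int_pow (discount lambda) r half_line u.
Proof.
move=> l0 Lu.
have sub : `]0, b[ `<=` half_line by apply: subset_itvl; rewrite bnd_simp.
apply: (@weighted_Lr_le _ _ (discount lambda) (cst 1) r (expR (lambda * b)) half_line `]0, b[ u
   (measurable_itv _) (measurable_itv _) sub (@measurable_discount _ lambda _) (measurable_cst _)
   (discount_ge0 lambda) (fun=> ler01) (expR_ge0 _) _ Lu).
move=> t /=; rewrite in_itv/= => /andP[_ tb].
by rewrite /discount -expRD -expR0 ler_expR subr_ge0 ler_wpM2l// ltW.
Qed.

(** On ]0, b[ the weight is at least exp (- lambda b). This bounds the derivative, and
    then the values, by |u(0)| plus the integral of |u'|. *)
Lemma sobolev_restrict_bounded (a b : R) (a0 : 0 <= a) (ab : a < b) : 0 < lambda ->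
  exists K, forall u : sobolev_discounted d lambda r1,
    sobolev_norm (sobolev_restrict a0 ab u) <= K * sobolev_discounted_norm u.
Proof.
move=> l0; have b0 : 0 < b by exact: le_lt_trans ab.
(* The L^r norm of u' on ]0, b[ is at most kap times the discounted norm of u, and
   by is_Lr_Rintegral_norm_le each coordinate of u is then at most K1 times
   the latter. *)
pose kap := expR (lambda * b) `^ r^-1.
have kap0 : 0 < kap by rewrite powR_gt0 ?expR_gt0.
have kapr : kap `^ r = expR (lambda * b).
  by rewrite /kap -powRrM mulVf ?gt_eqF// powRr1 ?expR_ge0.
pose K1 := 1 + (b + 1) * kap.
have K10 : 0 <= K1 by rewrite addr_ge0// mulr_ge0 ?addr_ge0// ltW.
pose Kr := (b - a) * (d%:R * K1) `^ r + expR (lambda * b).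
have Kr0 : 0 <= Kr.
  by rewrite addr_ge0 ?expR_ge0// mulr_ge0 ?powR_ge0// subr_ge0 ltW.
exists (Kr `^ r^-1) => u.
apply: le_homogeneous; [exact: powR_ge0|exact: powR_ge0|] => eta e0.
pose P := int_pow (discount lambda) r half_line (weak_derivative half_line u).
move=> /(sobolev_discounted_norm_le u (ltW e0)); rewrite -/P => uP.
apply/(sobolev_norm_le _ (mulr_ge0 (powR_ge0 _ _) (ltW e0))).
rewrite (powRM _ (powR_ge0 _ _) (ltW e0)) -powRrM mulVf ?gt_eqF// (powRr1 Kr0).
have P0 : 0 <= P by apply: int_pow_ge0; exact: discount_ge0.
have [uD LD] := W1r_discounted_weak_derivative (sobolev_discountedP u).
have [Lb Pb] := discounted_Lr_itv b l0 LD.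
have [Wu _] := sobolev_discountedP u; have [cu _ _] := Wu b b0.
have u0 : euclidean_norm (u 0) <= eta.
  have : euclidean_norm (u 0) `^ r <= eta `^ r by rewrite (le_trans _ uP)// lerDl.
  by apply: powR_le_inj; rewrite ?euclidean_norm_ge0// ltW.
have Pe : int_pow (cst 1) r `]0, b[ (weak_derivative half_line u) <= (kap * eta) `^ r.
  rewrite (powRM _ (ltW kap0) (ltW e0)) kapr (le_trans Pb)// ler_wpM2l ?expR_ge0//.
  by rewrite (le_trans _ uP)// lerDr powR_ge0.
have ke0 : 0 < kap * eta by rewrite mulr_gt0.
have I1 := is_Lr_Rintegral_norm_le r1 (ltW b0) ke0 Lb Pe.
have sub0 : `]0, b[ `<=` half_line by apply: subset_itvl; rewrite bnd_simp.
have uDb : is_weak_derivative `]0, b[ u (weak_derivative half_line u).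
  by apply: is_weak_derivativeS uD => //; exact: interval_open.
have ub t : 0 <= t <= b -> euclidean_norm (u t) <= d%:R * K1 * eta.
  move=> /andP[t0 tb]; rewrite -mulrA; apply: euclidean_norm_le_coord.
    by rewrite mulr_ge0// ltW.
  move=> i; have := weak_increment_le i r1 b0 cu uDb Lb (lexx 0) t0 tb.
  move=> /le_trans/(_ I1); rewrite subr0 => inc.
  have ui0 := le_trans (coord_le_euclidean_norm (u 0) i) u0.
  have -> : u t 0 i = (u t 0 i - u 0 0 i) + u 0 0 i by rewrite subrK.
  rewrite (le_trans (ler_normD _ _))// /K1 mulrDl mul1r [leRHS]addrC lerD//.
  by rewrite -mulrA.
set ru := sobolev_restrict a0 ab u.
have [_ Lru _] := sobolevP ru.
have Rb : int_pow (cst 1) r `]a, b[ ru <= (b - a) * (d%:R * K1 * eta) `^ r.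
  apply: int_pow_le_bound => //; first exact: ltW.
    by rewrite !mulr_ge0// ltW.
  move=> t /andP[at_ tb]; have tab : a <= t <= b by rewrite !ltW.
  by rewrite sobolev_restrictE//; apply: ub; rewrite (le_trans a0) ltW.
have m1 (A : set R) : measurable_fun A (cst 1 : R -> R) by exact: measurable_cst.
have subab : `]a, b[ `<=` `]0, b[ by apply: subset_itvr; rewrite bnd_simp.
have [Lab Pab] := @weighted_LrS _ _ (cst 1) r _ _ (weak_derivative half_line u)
  (measurable_itv `]0, b[) (measurable_itv `]a, b[) subab (m1 _) (fun=> ler01) Lb.
have [vD LvD] := W1r_weak_derivative (sobolevP ru).
have mD i : measurable_fun `]a, b[ (fun t => weak_derivative half_line u t 0 i).
  by have [mg _] := Lab; exact: mg.
have [_ PE] := weighted_Lr_ae (measurable_itv _) (m1 _) (fun=> ler01) mD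
   (weak_derivative_restrict a0 ab u) LvD.
have R2 : int_pow (cst 1) r `]a, b[ (weak_derivative `]a, b[ ru) <=
    expR (lambda * b) * eta `^ r.
  rewrite -[X in X <= _]PE; apply: (le_trans Pab (le_trans Pb _)).
  apply: ler_wpM2l; first exact: expR_ge0.
  by apply: le_trans uP; rewrite lerDr powR_ge0.
have dK : 0 <= d%:R * K1 by rewrite mulr_ge0.
apply: (le_trans (lerD Rb R2)).
by rewrite (powRM _ dK (ltW e0)) mulrA -mulrDl.
Qed.

Lemma sobolev_restrict_weak_continuous (a b : R) (a0 : 0 <= a) (ab : a < b) :
  0 < lambda ->
  continuous (sobolev_restrict a0 ab :
    weak_sobolev_discounted d lambda r1 -> weak_sobolev d a b r1).
Proof.
move=> l0; have [K HK] := sobolev_restrict_bounded a0 ab l0.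
apply: (@bounded_linear_weak_continuous _ _ _ _ _ (sobolev_restrict a0 ab) K) => //.
by move=> w; exact: powR_ge0.
Qed.
End bounds.

Section extend_bounds.
Context {R : realType} {d : nat}.
Local Notation mu := (@lebesgue_measure R).
Local Notation half_line := (`]0, +oo[%classic : set R).
Variables (r lambda : R) (r1 : 1 < r) (a b : R) (a0 : 0 <= a) (ab : a < b).
Hypothesis lambda0 : 0 < lambda.

Let r0 : 0 < r. Proof. exact: lt_trans r1. Qed.

Lemma weak_derivative_extend (v : sobolev d a b r1) :
  {ae mu, forall t, half_line t ->
    weak_derivative half_line (sobolev_extend a0 ab lambda0 v) t = extend_deriv a b v t} /\
  int_pow (discount lambda) r half_line
    (weak_derivative half_line (sobolev_extend a0 ab lambda0 v)) =
  int_pow (discount lambda) r half_line (extend_deriv a b v).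
Proof.
have Wv := sobolevP v.
have vE := extend_weak_derivative r1 a0 ab Wv.
have oH : open half_line by exact: interval_open.
have vE' : is_weak_derivative half_line (sobolev_extend a0 ab lambda0 v) (extend_deriv a b v).
  apply: eq_is_weak_derivative vE => t /set_mem/=; rewrite in_itv/= andbT => t0.
  by rewrite /extend_fun ltNge (ltW t0).
have [LE _] := @extend_deriv_Lr _ _ r r1 a b a0 ab (discount lambda) v half_line
    (measurable_itv _) (fun=> id) (@measurable_discount _ lambda _) (discount_ge0 lambda)
    (discount_le1 lambda0) Wv.
have cE := W1r_discounted_continuous (sobolev_discountedP (sobolev_extend a0 ab lambda0 v)).
have [_ h1 _ h2] := weak_derivative_xget oH cE (@measurable_discount _ lambda _)
  (discount_ge0 lambda) vE' LE.
split; [exact: h1|exact: h2].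
Qed.

(** The derivative of the extension is that of v continued by 0, so only |v(a)| needs
    an argument: averaging over t in ]a, b[ the inequality |v(a)| <= |v(t)| + |v(t) - v(a)|
    controls it by the norms of v and v'. *)
Lemma sobolev_extend_bounded : exists K, forall v : sobolev d a b r1,
    sobolev_discounted_norm (sobolev_extend a0 ab lambda0 v) <= K * sobolev_norm v.
Proof.
(* Integrating over an interval of length l, the first term is at most (l + 1) eta
   and the increment at most (l + 1) eta pointwise. *)
pose l := b - a; have l0 : 0 < l by rewrite subr_gt0.
have l0' := ltW l0; pose K2 := (l + 1 + l * (l + 1)) / l.
have K20 : 0 <= K2.
  have l1 : 0 <= l + 1 by exact: addr_ge0.
  by rewrite divr_ge0// addr_ge0// mulr_ge0.
have dK20 : 0 <= d%:R * K2 by rewrite mulr_ge0.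
pose Kr := (d%:R * K2) `^ r + 1.
have Kr0 : 0 <= Kr by rewrite addr_ge0// powR_ge0.
exists (Kr `^ r^-1) => v.
apply: le_homogeneous; [exact: powR_ge0|exact: powR_ge0|] => eta e0.
pose P := int_pow (cst 1) r `]a, b[ (weak_derivative `]a, b[ v).
pose Q := int_pow (cst 1) r `]a, b[ v.
move=> /(sobolev_norm_le v (ltW e0)); rewrite -/P -/Q => vP.
apply/(sobolev_discounted_norm_le _ (mulr_ge0 (powR_ge0 _ _) (ltW e0))).
rewrite (powRM _ (powR_ge0 _ _) (ltW e0)) -powRrM mulVf ?gt_eqF// (powRr1 Kr0).
have c0 (t : R) : 0 <= (cst 1 : R -> R) t by exact: ler01.
have P0 : 0 <= P by exact: int_pow_ge0.
have Q0 : 0 <= Q by exact: int_pow_ge0.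
have Wv := sobolevP v; have [cv Lv _] := Wv; have [vD LD] := W1r_weak_derivative Wv.
have Pe : P <= eta `^ r by apply: (le_trans _ vP); rewrite lerDr; exact: Q0.
have Qe : Q <= eta `^ r by apply: (le_trans _ vP); rewrite lerDl; exact: P0.
have ID := is_Lr_Rintegral_norm_le r1 (ltW ab) e0 LD Pe.
have IV := is_Lr_Rintegral_norm_le r1 (ltW ab) e0 Lv Qe.
have iv := is_Lr_integrable_norm r1 (ltW ab) Lv.
have va i : `|v a 0 i| <= K2 * eta.
  have pt t : a < t < b -> `|v a 0 i| <= euclidean_norm (v t) + (l + 1) * eta.
    move=> /andP[at_ tb].
    have inc := weak_increment_le i r1 ab cv vD LD (lexx a) (ltW at_) (ltW tb).
    have -> : v a 0 i = v t 0 i - (v t 0 i - v a 0 i) by rewrite opprB addrC subrK.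
    apply: (le_trans (ler_normB _ _)); apply: lerD; first exact: coord_le_euclidean_norm.
    exact: le_trans inc ID.
  have ic (c : R) : mu.-integrable `]a, b[ (EFin \o cst c).
    by apply: integrable_continuous_oo; exact: continuous_subspaceT (fun x => cvg_cst _).
  have mI : measurable (`]a, b[%classic : set (measurableTypeR R)) by [].
  have ivc : mu.-integrable `]a, b[ (EFin \o (fun t => euclidean_norm (v t) + (l + 1) * eta)).
    have H := integrableD mI iv (ic ((l + 1) * eta)); exact: H.
  have : (\int[mu]_(t in `]a, b[) `|v a 0 i|)%R <=
      (\int[mu]_(t in `]a, b[) (euclidean_norm (v t) + (l + 1) * eta))%R.
    apply: (le_Rintegral mI (ic `|v a 0 i|) ivc) => t tab.
    by apply: pt; move: tab; rewrite /= in_itv.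
  rewrite RintegralD//; last exact: (ic ((l + 1) * eta)).
  rewrite !Rintegral_cst//= lebesgue_measure_itv/= lte_fin ab -EFinB/= -/l => H.
  rewrite /K2 mulrAC ler_pdivlMr//; apply: (le_trans H).
  rewrite -lerBrDr; apply: (le_trans IV); rewrite -/l le_eqVlt; apply/orP; left; apply/eqP.
  ring.
have Ea : sobolev_extend a0 ab lambda0 v 0 = v a.
  by rewrite sobolev_extendE// clamp_le// ltW.
rewrite Ea /Kr mulrDl mul1r; apply: lerD.
  rewrite -(powRM _ dK20 (ltW e0)); apply: ge0_ler_powR.
  - exact: ltW.
  - by rewrite nnegrE euclidean_norm_ge0.
  - by rewrite nnegrE mulr_ge0// ltW.
  rewrite -mulrA; apply: euclidean_norm_le_coord => //.
  by rewrite mulr_ge0// ltW.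
have [_ E] := weak_derivative_extend v.
rewrite [X in X <= _]E.
have [_ h] := @extend_deriv_Lr _ _ r r1 a b a0 ab (discount lambda) v half_line
    (measurable_itv _) (fun=> id) (@measurable_discount _ lambda _) (discount_ge0 lambda)
    (discount_le1 lambda0) Wv.
exact: (le_trans h Pe).
Qed.

Lemma sobolev_extend_weak_continuous :
  continuous (sobolev_extend a0 ab lambda0 :
    weak_sobolev d a b r1 -> weak_sobolev_discounted d lambda r1).
Proof.
have [K HK] := sobolev_extend_bounded.
apply: (@bounded_linear_weak_continuous _ _ _ _ _ (sobolev_extend a0 ab lambda0) K) => //.
by move=> w; exact: powR_ge0.
Qed.
End extend_bounds.

(** * Measurability of integrands along curves *)

Section measurability.
Context {R : realType} {d : nat}.
Local Notation mu := (@lebesgue_measure R).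
Local Notation half_line := (`]0, +oo[%classic : set R).
Local Notation Rdd := (R * 'rV[R]_d * 'rV[R]_d)%type.
Implicit Types (u g : R -> 'rV[R]_d).

(** A countable base of the topology of R x R^d x R^d. Measurability of t |-> (t, u t, g t)
    for the Borel sigma-algebra, generated by all open sets, is thus reduced to
    boxes, which are intersections of conditions on single coordinates. *)
Definition rat_box (c : rat * 'rV[rat]_d * 'rV[rat]_d * nat) : set Rdd :=
  [set p : Rdd | [/\ `|p.1.1 - ratr c.1.1.1| < c.2.+1%:R^-1,
    forall i, `|p.1.2 0 i - ratr (c.1.1.2 0 i)| < c.2.+1%:R^-1 &
    forall i, `|p.2 0 i - ratr (c.1.2 0 i)| < c.2.+1%:R^-1]].

Lemma rat_approx (x e : R) : 0 < e -> exists q : rat, `|x - ratr q| < e.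
Proof.
move=> e0; have xe : x - e < x + e by rewrite ltrBlDr -addrA ltrDl addr_gt0.
have [q] := rat_in_itvoo xe; rewrite in_itv/= => /andP[q1 q2].
by exists q; rewrite ltr_norml; apply/andP; split; lra.
Qed.

Lemma rat_approx_row (x : 'rV[R]_d) (e : R) : 0 < e ->
  exists q : 'rV[rat]_d, forall i, `|x 0 i - ratr (q 0 i)| < e.
Proof.
move=> e0; have [q Hq] := choice (fun i => rat_approx (x 0 i) e0).
by exists (\row_i q i) => i; rewrite mxE.
Qed.

Lemma open_rat_box (U : set Rdd) (p : Rdd) : open U -> U p ->
  exists2 c, rat_box c `<=` U & rat_box c p.
Proof.
move=> oU Up.
have /nbhs_ballP[e /= e0 He] : nbhs p U by exact: open_nbhs_nbhs.
have [n nP] : exists n : nat, n.+1%:R^-1 < e / 2.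
  have e2 : 0 < e / 2 by rewrite divr_gt0.
  near \oo => n; exists n; near: n; exact: (near_infty_natSinv_lt (PosNum e2)).
have n0 : 0 < (n.+1%:R^-1 : R) by rewrite invr_gt0.
have [q1 H1] := rat_approx p.1.1 n0.
have [q2 H2] := rat_approx_row p.1.2 n0.
have [q3 H3] := rat_approx_row p.2 n0.
exists (q1, q2, q3, n); last by [].
have tri (x y z : R) : `|x - z| < n.+1%:R^-1 -> `|y - z| < n.+1%:R^-1 -> `|x - y| < e.
  move=> xz yz; have -> : x - y = (x - z) - (y - z) by ring.
  rewrite (le_lt_trans (ler_normB _ _))//.
  by rewrite [ltRHS]splitr ltrD// (lt_trans _ nP).
move=> y [/= y1 y2 y3]; apply: He; split; [split|].
- exact: tri y1.
- by split => // i j; rewrite ord1; exact: tri (y2 j).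
- by split => // i j; rewrite ord1; exact: tri (y3 j).
Unshelve. all: by end_near. Qed.

Lemma measurable_graph (O : set R) u g : measurable O ->
  (forall i, measurable_fun O (fun t => u t 0 i)) ->
  (forall i, measurable_fun O (fun t => g t 0 i)) ->
  @measurable_fun _ _ R (g_sigma_algebraType (@open Rdd)) O (fun t => (t, u t, g t)).
Proof.
move=> mO mu_ mg; apply: (@measurability _ _ R (g_sigma_algebraType (@open Rdd)) O
  (fun t => (t, u t, g t)) (@open Rdd)) => [//|_ [U oU <-]].
pose B c := O `&` (fun t => (t, u t, g t)) @^-1` rat_box c.
have -> : O `&` (fun t => (t, u t, g t)) @^-1` U =
    \bigcup_c (if `[< rat_box c `<=` U >] then B c else set0).
  apply/seteqP; split=> [t [Ot /(open_rat_box oU)[c cU cp]]|t [c _]].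
    by exists c => //; case: asboolP => // _; split.
  by case: asboolP => // cU [Ot /cU].
apply: countable_bigcupT_measurable => // c.
case: ifP => // _.
have mball (h : R -> R) (q e : R) : measurable_fun O h ->
    measurable (O `&` [set t | `|h t - q| < e]).
  move=> mh; have := mh mO (ball q e) (measurable_ball _ _).
  by congr measurable; apply/seteqP; split=> t [Ot] /=; rewrite /ball/= distrC.
have -> : B c = (O `&` [set t | `|t - ratr c.1.1.1| < c.2.+1%:R^-1]) `&`
    ((O `&` \bigcap_(i in [set: 'I_d])
        (O `&` [set t | `|u t 0 i - ratr (c.1.1.2 0 i)| < c.2.+1%:R^-1])) `&`
     (O `&` \bigcap_(i in [set: 'I_d])
        (O `&` [set t | `|g t 0 i - ratr (c.1.2 0 i)| < c.2.+1%:R^-1]))).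
  apply/seteqP; split=> [t [Ot [/= h1 h2 h3]]|t [[Ot h1] [[_ h2] [_ h3]]]].
    by split => //; split; split => // i _; split => //; [exact: h2|exact: h3].
  by split => //; split => //= i; [have [] := h2 i I|have [] := h3 i I].
apply: measurableI; first exact: mball.
by apply: measurableI; apply: measurableI => //;
  apply: fin_bigcap_measurable => // i _; exact: mball.
Qed.

Lemma measurable_integrand (L : R -> 'rV[R]_d -> 'rV[R]_d -> R) (O : set R) u g :
  borel_integrand L -> measurable O -> O `<=` half_line ->
  (forall i, measurable_fun O (fun t => u t 0 i)) ->
  (forall i, measurable_fun O (fun t => g t 0 i)) ->
  measurable_fun O (fun t => L t (u t) (g t)).
Proof.
move=> bL mO OH mu_ mg.
apply: (@measurable_comp _ _ _ R (g_sigma_algebraType (@open Rdd)) R [set p : Rdd | 0 < p.1.1]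
   (fun p : Rdd => L p.1.1 p.1.2 p.2) O (fun t => (t, u t, g t))).
- apply: sub_sigma_algebra.
  have -> : [set p : Rdd | 0 < p.1.1] = (fun p : Rdd => p.1.1) @^-1` [set x : R | 0 < x] by [].
  apply: open_comp; last exact: open_gt.
  by move=> p _; apply: cvg_comp; exact: cvg_fst.
- by move=> _ [t /OH/= + <-] /=; rewrite in_itv/= andbT.
- exact: bL.
- exact: measurable_graph.
Qed.
End measurability.

(** * Energies on intervals *)

Section density.
Context {R : realType} {d : nat}.
Local Notation mu := (@lebesgue_measure R).
Local Notation half_line := (`]0, +oo[%classic : set R).
Local Notation ray a := (`]a, +oo[%classic : set R).
Implicit Types (L : R -> 'rV[R]_d -> 'rV[R]_d -> R) (u v : R -> 'rV[R]_d).

(** One representative of the derivative, the one on the whole half line, is used on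
    every interval, so that integrals over a partition can be added. *)
Definition density L u (t : R) : R := L t (u t) (weak_derivative half_line u t).

Lemma sub_half_line (a b : R) : 0 <= a -> `]a, b[ `<=` half_line.
Proof. by move=> a0; apply: subset_itv; rewrite bnd_simp. Qed.

Lemma sub_half_line_ray (a : R) : 0 <= a -> `]a, +oo[ `<=` half_line.
Proof. by move=> a0; apply: subset_itvr; rewrite bnd_simp. Qed.

Section additivity.
Variable F : R -> R.
Hypothesis mF : measurable_fun half_line F.
Hypothesis F0 : forall t : R, 0 < t -> 0 <= F t.

Let half_gt0 (t : R) : half_line t -> 0 < t.
Proof. by rewrite /= in_itv/= andbT. Qed.

Lemma integral_oo_split (a b : R) : 0 <= a -> a <= b ->
  (\int[mu]_(t in `]0%R, b[) (F t)%:E =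
   \int[mu]_(t in `]0%R, a[) (F t)%:E + \int[mu]_(t in `]a, b[) (F t)%:E)%E.
Proof.
move=> a0; rewrite le_eqVlt => /predU1P[->|ab].
  by rewrite [in X in (_ + X)%E]set_itv_ge ?bnd_simp// integral_set0 adde0.
have mF' (A : set R) : measurable A -> A `<=` half_line -> measurable_fun A (EFin \o F).
  by move=> mA sA; apply/measurable_EFinP; apply: measurable_funS mF.
have -> : `]0, b[%classic = `]0, a]%classic `|` `]a, b[%classic :> set R.
  rewrite -(@itv_bndbnd_setU _ _ (BRight 0) (BRight a) (BLeft b))// bnd_simp//.
have sa : `]0, a] `<=` half_line by apply: subset_itvl; rewrite bnd_simp.
rewrite ge0_integral_setU//.
- rewrite [in X in _ = (X + _)%E]integral_itv_bndo_bndc//; apply/measurable_EFinP.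
  by apply: measurable_funS mF => //; exact: (sub_half_line (lexx 0)).
- apply: mF'; first exact: measurableU.
  by move=> t [/sa//|/(sub_half_line a0)].
- by move=> t [/sa|/(sub_half_line a0)] /half_gt0 /F0; rewrite lee_fin.
- apply/disj_setPS => y [/=]; rewrite 2!in_itv/= => /andP[_ yx] /andP[].
  by rewrite ltNge yx.
Qed.

Lemma integral_ray_split (a : R) : 0 <= a ->
  (\int[mu]_(t in half_line) (F t)%:E =
   \int[mu]_(t in `]0%R, a[) (F t)%:E + \int[mu]_(t in ray a) (F t)%:E)%E.
Proof.
move=> a0.
have mF' (A : set R) : measurable A -> A `<=` half_line -> measurable_fun A (EFin \o F).
  by move=> mA sA; apply/measurable_EFinP; apply: measurable_funS mF.
have -> : half_line = `]0, a]%classic `|` `]a, +oo[%classic :> set R.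
  rewrite -(@itv_bndbnd_setU _ _ (BRight 0) (BRight a) +oo%O)// bnd_simp//.
have sa : `]0, a] `<=` half_line by apply: subset_itvl; rewrite bnd_simp.
rewrite ge0_integral_setU//.
- rewrite [in X in _ = (X + _)%E]integral_itv_bndo_bndc//; apply/measurable_EFinP.
  by apply: measurable_funS mF => //; exact: (sub_half_line (lexx 0)).
- apply: mF'; first exact: measurableU.
  by move=> t [/sa//|/(sub_half_line_ray a0)].
- by move=> t [/sa|/(sub_half_line_ray a0)] /half_gt0 /F0; rewrite lee_fin.
- apply/disj_setPS => y [/=]; rewrite 2!in_itv/= => /andP[_ yx] /andP[].
  by rewrite ltNge yx.
Qed.

Lemma integral_itv_half_line_cvg :
  (\int[mu]_(t in `]0%R, n%:R[) (F t)%:E)%E @[n --> \oo] -->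
  (\int[mu]_(t in half_line) (F t)%:E)%E.
Proof.
have -> : half_line = \bigcup_n `]0, n%:R[%classic.
  apply/seteqP; split=> [t|t [n _]]; last exact: (sub_half_line (lexx 0)).
  rewrite /= in_itv/= andbT => t0.
  have [n nt] : exists n : nat, t < n%:R.
    by exists (Num.truncn t).+1; exact: truncnS_gt.
  by exists n => //; rewrite /= in_itv/= t0 nt.
apply: ge0_nondecreasing_set_cvg_integral.
- move=> m n mn; rewrite subsetEset; apply: subset_itvl.
  by rewrite bnd_simp ler_nat.
- by move=> n.
- move=> n; apply/measurable_EFinP; apply: measurable_funS mF => //.
  exact: (sub_half_line (lexx 0)).
- by move=> n t /(sub_half_line (lexx 0))/half_gt0/F0; rewrite lee_fin.
Qed.

End additivity.

Lemma measurable_density r lambda L u (Wu : W1r_discounted r lambda u) :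
  borel_integrand L -> measurable_fun half_line (density L u).
Proof.
move=> bL; have [[lu lD _] _] := W1r_discounted_weak_derivative Wu.
apply: measurable_integrand => //.
- by move=> i; have [] := lu i.
- by move=> i; have [] := lD i.
Qed.

Lemma measurable_discounted_density r lambda L u (Wu : W1r_discounted r lambda u) :
  borel_integrand L ->
  measurable_fun half_line (fun t => density L u t * discount lambda t).
Proof.
move=> bL; apply: measurable_funM; first exact: (measurable_density Wu).
exact: measurable_discount.
Qed.

Lemma density_eq_ae r lambda L u v (O : set R) :
  W1r_discounted r lambda u -> W1r_discounted r lambda v ->
  open O -> O `<=` half_line -> {in O, u =1 v} ->
  {ae mu, forall t, O t -> density L u t = density L v t}.
Proof.
move=> Wu Wv oO sO uv.
have [vD _] := W1r_discounted_weak_derivative Wv.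
have uD : is_weak_derivative O u (weak_derivative half_line v).
  apply: eq_is_weak_derivative (is_weak_derivativeS oO sO vD) => t tO.
  by rewrite uv.
have := W1r_discounted_weak_derivative_ae Wu oO sO uD.
apply: filterS; first exact: (ae_filter_ringOfSetsType mu).
by move=> t H Ot; rewrite /density H// uv//; exact: mem_set.
Qed.

Lemma integral_density_eq r lambda L u v (O : set R) :
  borel_integrand L ->
  W1r_discounted r lambda u -> W1r_discounted r lambda v ->
  open O -> O `<=` half_line -> {in O, u =1 v} ->
  (\int[mu]_(t in O) (density L u t * discount lambda t)%:E =
   \int[mu]_(t in O) (density L v t * discount lambda t)%:E)%E.
Proof.
move=> bL Wu Wv oO sO uv; have mO := open_measurable oO.
apply: ae_eq_integral.
- exact: mO.
- apply/measurable_EFinP; apply: measurable_funS (measurable_discounted_density Wu bL) => //.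
- apply/measurable_EFinP; apply: measurable_funS (measurable_discounted_density Wv bL) => //.
apply: filterS (density_eq_ae L Wu Wv oO sO uv); first exact: (ae_filter_ringOfSetsType mu).
by move=> t H Ot; rewrite H.
Qed.

Section energy.
Variables (r lambda : R) (r1 : 1 < r) (L : R -> 'rV[R]_d -> 'rV[R]_d -> R).
Hypotheses (lambda0 : 0 < lambda) (bL : borel_integrand L)
  (L0 : forall (t : R) x xi, 0 < t -> 0 <= L t x xi).
Implicit Types (w : sobolev_discounted d lambda r1).

Lemma density_ge0 u (t : R) : 0 < t -> 0 <= density L u t * discount lambda t.
Proof. by move=> t0; rewrite mulr_ge0 ?L0// discount_ge0. Qed.

(** The energy on ]a, b[ of a restriction involves the derivative chosen on ]a, b[,
    which agrees almost everywhere with the global one. *)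
Lemma energy_restrict (a b : R) (a0 : 0 <= a) (ab : a < b) w :
  energy `]a, b[ L (sobolev_restrict a0 ab w) = (\int[mu]_(t in `]a, b[) (density L w t)%:E)%E.
Proof.
have Wv := sobolevP (sobolev_restrict a0 ab w).
have [[lv lD _] _] := W1r_weak_derivative Wv.
apply: ae_eq_integral.
- exact: measurable_itv.
- apply/measurable_EFinP; apply: measurable_integrand => //.
  + exact: sub_half_line.
  + by move=> i; have [] := lv i.
  + by move=> i; have [] := lD i.
- apply/measurable_EFinP; apply: measurable_funS
    (measurable_density (sobolev_discountedP w) bL) => //.
  exact: sub_half_line.
apply: filterS (weak_derivative_restrict a0 ab w); first exact: (ae_filter_ringOfSetsType mu).
move=> t H tab; rewrite /density H//=; congr (_%:E); congr L.
by rewrite /restrict_fun; move/subset_itv_oo_cc : tab => /= ->.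
Qed.

Lemma discounted_ge (a b : R) (a0 : 0 <= a) (ab : a < b) w :
  ((expR (- (lambda * b)))%:E * energy `]a, b[ L (sobolev_restrict a0 ab w) <=
   \int[mu]_(t in `]a, b[) (density L w t * discount lambda t)%:E)%E.
Proof.
rewrite energy_restrict.
have md : measurable_fun `]a, b[ (density L w).
  apply: measurable_funS (measurable_density (sobolev_discountedP w) bL) => //.
  exact: sub_half_line.
have t0 t : `]a, b[%classic t -> 0 < t.
  by move=> /(sub_half_line a0); rewrite /= in_itv/= andbT.
rewrite -ge0_integralZl//; last 2 first.
- exact/measurable_EFinP.
- by move=> t /t0 t0'; rewrite lee_fin L0.
apply: ge0_le_integral => //.
- by move=> t /t0 t0'; rewrite mule_ge0// lee_fin ?expR_ge0// L0.
- by apply: measurable_funeM; exact/measurable_EFinP.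
- apply/measurable_EFinP; apply: measurable_funM => //; exact: measurable_discount.
move=> t tab; rewrite -EFinM lee_fin mulrC ler_wpM2l ?L0 ?t0//.
rewrite ler_expR lerN2 ler_wpM2l ?ltW//.
by move: tab; rewrite /= in_itv/= => /andP[].
Qed.

Lemma discounted_le (a b : R) (a0 : 0 <= a) (ab : a < b) w :
  (\int[mu]_(t in `]a, b[) (density L w t * discount lambda t)%:E <=
   (expR (- (lambda * a)))%:E * energy `]a, b[ L (sobolev_restrict a0 ab w))%E.
Proof.
rewrite energy_restrict.
have md : measurable_fun `]a, b[ (density L w).
  apply: measurable_funS (measurable_density (sobolev_discountedP w) bL) => //.
  exact: sub_half_line.
have t0 t : `]a, b[%classic t -> 0 < t.
  by move=> /(sub_half_line a0); rewrite /= in_itv/= andbT.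
rewrite -ge0_integralZl//; last 2 first.
- exact/measurable_EFinP.
- by move=> t /t0 t0'; rewrite lee_fin L0.
apply: ge0_le_integral => //.
- by move=> t /t0 t0'; rewrite lee_fin density_ge0.
- apply/measurable_EFinP; apply: measurable_funM => //; exact: measurable_discount.
- by apply: measurable_funeM; exact/measurable_EFinP.
move=> t tab; rewrite -EFinM lee_fin [leRHS]mulrC ler_wpM2l ?L0 ?t0//.
rewrite ler_expR lerN2 ler_wpM2l ?ltW//.
by move: tab; rewrite /= in_itv/= => /andP[].
Qed.
End energy.
End density.

(** * Finiteness of the limit energy *)

Section finite_energy.
Context {R : realType} {d : nat}.
Local Notation mu := (@lebesgue_measure R).
Local Notation half_line := (`]0, +oo[%classic : set R).

Lemma integral_discount (lambda : R) : 0 < lambda ->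
  (\int[mu]_(t in half_line) (discount lambda t)%:E <= (lambda^-1)%:E)%E.
Proof.
move=> l0.
have cv := @integral_itv_half_line_cvg R (discount lambda) (@measurable_discount _ lambda _)
  (fun t _ => discount_ge0 lambda t).
rewrite -(cvg_lim _ cv)//; apply: lime_le; first by apply/cvg_ex; eexists; exact: cv.
apply: nearW => n.
pose F x := - lambda^-1 * expR (- lambda * x).
have dF (x : R) : is_derive x 1 F (discount lambda x).
  have h1 := is_derive_affine (- lambda) 0 0 x.
  have -> : F = (fun y => - lambda^-1 * (expR \o (fun y => - lambda * (y - 0) + 0)) y).
    by apply/funext => y; rewrite /F/= subr0 addr0.
  have h2 : is_derive x 1 (expR \o (fun y => - lambda * (y - 0) + 0))
     (expR (- lambda * (x - 0) + 0) * - lambda).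
    by apply: is_derive1_comp.
  have h3 := is_deriveM (is_derive_cst (- lambda^-1) x 1) h2.
  apply: (is_derive_eq h3).
  rewrite scaler0 addr0 /GRing.scale/= subr0 addr0 /discount [- lambda * x]mulNr.
  by rewrite mulrCA mulrNN mulVf ?mulr1// gt_eqF.
have cd : continuous (discount lambda).
  move=> x; apply: (@continuous_comp _ _ _ (fun t => - (lambda * t)) expR);
    last exact: continuous_expR.
  by apply: cvgN; apply: cvgM; [exact: cvg_cst|exact: cvg_id].
have [n0|n0] := eqVneq n 0%N.
  by rewrite n0 set_itv_ge ?bnd_simp// integral_set0 lee_fin invr_ge0 ltW.
have n0' : 0 < n%:R :> R by rewrite ltr0n lt0n.
have := Rintegral_is_derive n0' dF cd.
have id : mu.-integrable `]0, n%:R[ (EFin \o discount lambda).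
  by apply: integrable_continuous_oo; exact: continuous_subspaceT.
have fd := @integrable_fin_num _ _ R mu `]0, n%:R[ (measurable_itv _) _ id.
move=> E; rewrite -(fineK fd) lee_fin.
rewrite -[leLHS]/(\int[mu]_(x in `]0, n%:R[) discount lambda x)%R E /F mulr0 expR0 mulr1.
by rewrite opprK gerDr mulNr oppr_le0 mulr_ge0 ?invr_ge0 ?expR_ge0// ltW.
Qed.

Section growth.
Variables (r lambda : R) (lambda0 : 0 < lambda).
Variables (L0 : R -> 'rV[R]_d -> 'rV[R]_d -> R) (C : R).
Hypotheses (L0_borel : borel_integrand L0)
  (L0_ge0 : forall (t : R) x xi, 0 < t -> 0 <= L0 t x xi)
  (C_gt0 : 0 < C)
  (L0_growth : forall (t : R) x xi, 0 < t ->
    L0 t x xi <= C * (1 + euclidean_norm xi `^ r)).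

(** The growth condition bounds the integrand by C (1 + |u'|^r), and both terms are
    integrable against the discount factor. *)
Lemma discounted_energy_lty (u : R -> 'rV[R]_d) : W1r_discounted r lambda u ->
  (\int[mu]_(t in half_line) (density L0 u t * discount lambda t)%:E < +oo)%E.
Proof.
move=> Wu; have [[_ lD _] [mD finD]] := W1r_discounted_weak_derivative Wu.
have pos (t : R) : half_line t -> 0 < t by rewrite /= in_itv/= andbT.
have mpow : measurable_fun half_line (fun t =>
   (euclidean_norm (weak_derivative half_line u t) `^ r * discount lambda t)%:E).
  by apply: measurable_pow_weight => //; exact: measurable_discount.
have md : measurable_fun half_line (fun t => (discount lambda t)%:E).
  by apply/measurable_EFinP; exact: measurable_discount.
apply: (@le_lt_trans _ _ (\int[mu]_(t in half_line) (C%:E * (discount lambda t)%:E + C%:E *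
  (euclidean_norm (weak_derivative half_line u t) `^ r * discount lambda t)%:E))%E).
  apply: ge0_le_integral.
  - exact: measurable_itv.
  - by move=> t /pos t0; rewrite lee_fin mulr_ge0 ?L0_ge0// discount_ge0.
  - by apply/measurable_EFinP; exact: (measurable_discounted_density Wu).
  - by apply: emeasurable_funD; apply: measurable_funeM.
  move=> t /pos t0; rewrite -!EFinM -EFinD lee_fin mulrA -mulrDl.
  by rewrite ler_wpM2r ?discount_ge0// -[X in X + _]mulr1 -mulrDr; exact: L0_growth.
have C0 : (0 <= C%:E)%E by rewrite lee_fin ltW.
rewrite ge0_integralD//; last 4 first.
- by move=> t _; rewrite mule_ge0// lee_fin discount_ge0.
- by apply: measurable_funeM.
- by move=> t _; rewrite mule_ge0// lee_fin mulr_ge0 ?powR_ge0 ?discount_ge0.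
- by apply: measurable_funeM.
rewrite ge0_integralZl//; last by move=> t _; rewrite lee_fin discount_ge0.
rewrite ge0_integralZl//; last by move=> t _; rewrite lee_fin mulr_ge0 ?powR_ge0 ?discount_ge0.
apply: lte_add_pinfty; apply: lte_mul_pinfty => //.
exact: le_lt_trans (integral_discount lambda0) (ltry _).
Qed.
End growth.
End finite_energy.

(** * The liminf inequality *)

Section liminf.
Context {R : realType} {d : nat}.
Local Notation mu := (@lebesgue_measure R).
Local Notation half_line := (`]0, +oo[%classic : set R).
Variables (r lambda : R) (r_gt1 : 1 < r) (lambda_gt0 : 0 < lambda).
Variable L : R -> R -> 'rV[R]_d -> 'rV[R]_d -> R.
Hypotheses (L_borel : forall e : R, 0 < e -> borel_integrand (L e))
  (L_ge0 : forall e : R, 0 < e -> forall (t : R) x xi, 0 < t -> 0 <= L e t x xi).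
Variable L0 : R -> 'rV[R]_d -> 'rV[R]_d -> R.
Hypotheses (L0_borel : borel_integrand L0)
  (L0_ge0 : forall (t : R) x xi, 0 < t -> 0 <= L0 t x xi).
Hypothesis gamma_intervals : forall a b : R, 0 <= a -> a < b ->
    gamma_cvg (X := weak_sobolev d a b r_gt1)
      (fun e (u : sobolev d a b r_gt1) => energy `]a, b[ (L e) u)
      (fun u : sobolev d a b r_gt1 => energy `]a, b[ L0 u).

Variable u : sobolev_discounted d lambda r_gt1.
Hypothesis u_fin : (\int[mu]_(t in half_line) (density L0 u t * discount lambda t)%:E < +oo)%E.

(** Real-valued, so that energies of intervals are differences; it is used for
    functions of finite energy only. *)
Definition partial_energy (w : R -> 'rV[R]_d) (T : R) : R :=
  fine (\int[mu]_(t in `]0%R, T[) (density L0 w t * discount lambda t)%:E).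

Lemma partial_energyE (w : sobolev_discounted d lambda r_gt1) T : 0 <= T ->
  (\int[mu]_(t in half_line) (density L0 w t * discount lambda t)%:E < +oo)%E ->
  (\int[mu]_(t in `]0%R, T[) (density L0 w t * discount lambda t)%:E =
   (partial_energy w T)%:E)%E.
Proof.
move=> T0 fin; rewrite fineK// ge0_fin_numE; last first.
  apply: integral_ge0 => t; rewrite /= in_itv/= => /andP[t0 _].
  by rewrite lee_fin density_ge0.
apply: le_lt_trans fin; apply: ge0_subset_integral => //.
- by apply/measurable_EFinP; exact: (measurable_discounted_density (sobolev_discountedP w)).
- by move=> t; rewrite /= in_itv/= andbT => t0; rewrite lee_fin density_ge0.
- exact: (sub_half_line (lexx 0)).
Qed.

(** The undiscounted energy j on ]a, b[ is compared with the discounted one, the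
    weight being between its values at the endpoints; j is finite because the
    weight at b is positive. *)
Lemma interval_energy (w : sobolev_discounted d lambda r_gt1) (a b : R)
  (a0 : 0 <= a) (ab : a < b) :
  (\int[mu]_(t in half_line) (density L0 w t * discount lambda t)%:E < +oo)%E ->
  exists j : R, [/\ energy `]a, b[ L0 (sobolev_restrict a0 ab w) = j%:E, 0 <= j,
    expR (- (lambda * b)) * j <= partial_energy w b - partial_energy w a &
    partial_energy w b - partial_energy w a <= expR (- (lambda * a)) * j].
Proof.
move=> fin; have b0 : 0 <= b by rewrite (le_trans a0)// ltW.
have m := measurable_discounted_density (sobolev_discountedP w) L0_borel.
have := integral_oo_split m (@density_ge0 _ _ lambda _ L0_ge0 w) a0 (ltW ab).
rewrite !partial_energyE// => E.
have Eab : (\int[mu]_(t in `]a, b[) (density L0 w t * discount lambda t)%:E =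
    (partial_energy w b - partial_energy w a)%:E)%E.
  by rewrite EFinB E addeAC subee// add0e.
have h1 := discounted_ge lambda_gt0 L0_borel L0_ge0 a0 ab w.
have h2 := discounted_le lambda_gt0 L0_borel L0_ge0 a0 ab w.
rewrite Eab in h1 h2.
have j0 : (0 <= energy `]a, b[ L0 (sobolev_restrict a0 ab w))%E.
  apply: integral_ge0 => t; rewrite /= in_itv/= => /andP[at_ _].
  by rewrite lee_fin L0_ge0// (le_lt_trans a0).
have jfin : (energy `]a, b[ L0 (sobolev_restrict a0 ab w) \is a fin_num).
  rewrite ge0_fin_numE// ltNge leye_eq; apply/negP => /eqP jE.
  by move: h1; rewrite jE gt0_muley ?lte_fin ?expR_gt0.
exists (fine (energy `]a, b[ L0 (sobolev_restrict a0 ab w))).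
split.
- by rewrite fineK.
- exact: fine_ge0.
- by rewrite -lee_fin EFinM fineK.
- by rewrite -lee_fin EFinM fineK.
Qed.

Lemma partial_energy0 w : partial_energy w 0 = 0.
Proof. by rewrite /partial_energy set_itv_ge ?bnd_simp// integral_set0. Qed.

(** Each step adds one interval to the partition, on which the liminf inequality is
    pulled back by the weakly continuous restriction. The ratio of the weights at
    its endpoints a and b = a + del is exp (lambda del), so one factor
    exp (- lambda del) serves for all intervals. *)
Lemma liminf_partition (del : R) (k : nat) : 0 < del ->
  forall eta : R, 0 < eta -> exists2 U : set (weak_sobolev_discounted d lambda r_gt1),
  open_nbhs (u : weak_sobolev_discounted d lambda r_gt1) U &
  \forall e \near 0^'+, forall v : sobolev_discounted d lambda r_gt1, U v ->
  ((expR (- (lambda * del)) * partial_energy u (k%:R * del) - eta)%:E <=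
   \int[mu]_(t in `]0%R, (k%:R * del)%R[) (density (L e) v t * discount lambda t)%:E)%E.
Proof.
move=> del0; elim: k => [|k IH] eta eta0.
  exists setT; first by split => //; exact: openT.
  apply: nearW => e v _; rewrite mul0r partial_energy0 mulr0 sub0r.
  by rewrite set_itv_ge ?bnd_simp// integral_set0 lee_fin oppr_le0 ltW.
have eta2 : 0 < eta / 2 by rewrite divr_gt0.
have [U1 uU1 HU1] := IH _ eta2.
pose a := k%:R * del; pose b := k.+1%:R * del.
have a0 : 0 <= a by rewrite mulr_ge0// ltW.
have ab : a < b by rewrite ltr_pM2r// ltr_nat.
have bE : b = a + del by rewrite /a /b -natr1 mulrDl mul1r.
have [j [jE j0 j1 j2]] := interval_energy a0 ab u_fin.
have [gE _] := gamma_intervals a0 ab (sobolev_restrict a0 ab u).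
have [] := @lt_gamma_liminf R (weak_sobolev d a b r_gt1)
   (fun e (w : sobolev d a b r_gt1) => energy `]a, b[ (L e) w)
   (sobolev_restrict a0 ab u) (j - eta / 2)%:E.
  by rewrite -gE jE lte_fin ltrBlDr ltrDl.
move=> V [oV Vu] HV.
have cr := @sobolev_restrict_weak_continuous R d r lambda r_gt1 a b a0 ab lambda_gt0.
exists (U1 `&` (sobolev_restrict a0 ab) @^-1` V).
  case: uU1 => oU1 U1u; split; last by split.
  have cV := (continuousP (sobolev_restrict a0 ab :
    weak_sobolev_discounted d lambda r_gt1 -> weak_sobolev d a b r_gt1)).1 cr V oV.
  exact: (openI oU1 cV).
near=> e => v [U1v Vv].
have e0 : 0 < e by [].
have m := measurable_discounted_density (sobolev_discountedP v) (L_borel e0).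
rewrite -/a -/b.
rewrite (integral_oo_split m (@density_ge0 _ _ lambda _ (L_ge0 e0) v) a0 (ltW ab)).
have H1 : ((expR (- (lambda * del)) * partial_energy u a - eta / 2)%:E <=
   \int[mu]_(t in `]0%R, a[) (density (L e) v t * discount lambda t)%:E)%E.
  by move: v U1v {Vv m}; near: e.
have H2 : ((j - eta / 2)%:E <= energy `]a, b[ (L e) (sobolev_restrict a0 ab v))%E.
  have : forall w, V w -> ((j - eta / 2)%:E <= energy `]a, b[ (L e) w)%E by near: e.
  exact.
have H3 := discounted_ge lambda_gt0 (L_borel e0) (L_ge0 e0) a0 ab v.
apply: le_trans (leeD H1 H3).
apply: (@le_trans _ _ ((expR (- (lambda * del)) * partial_energy u a - eta / 2)%:E +
   (expR (- (lambda * b)))%:E * (j - eta / 2)%:E)%E); last first.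
  by apply: leeD2l; apply: lee_wpmul2l => //; rewrite lee_fin expR_ge0.
rewrite -EFinM -EFinD lee_fin.
have E : expR (- (lambda * b)) = expR (- (lambda * del)) * expR (- (lambda * a)).
  by rewrite -expRD bE; congr expR; ring.
have c0 : 0 < expR (- (lambda * del)) by exact: expR_gt0.
have cb : expR (- (lambda * b)) <= 1.
  by rewrite -expR0 ler_expR oppr_le0 mulr_ge0// ltW// (le_lt_trans a0).
have K1 : expR (- (lambda * del)) * (partial_energy u b - partial_energy u a) <=
    expR (- (lambda * b)) * j.
  by rewrite E -mulrA ler_pM2l.
have K2 : expR (- (lambda * b)) * (eta / 2) <= eta / 2 by rewrite ler_piMl// ltW.
move: K1 K2; rewrite !mulrBr; lra.
Unshelve. all: by end_near. Qed.

Lemma partial_energy_cvg : partial_energy u n%:R @[n --> \oo] -->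
  fine (\int[mu]_(t in half_line) (density L0 u t * discount lambda t)%:E).
Proof.
have m := measurable_discounted_density (sobolev_discountedP u) L0_borel.
apply: fine_cvg; rewrite fineK; last first.
  rewrite ge0_fin_numE//; apply: integral_ge0 => t; rewrite /= in_itv/= andbT => t0.
  by rewrite lee_fin density_ge0.
apply: integral_itv_half_line_cvg m _ => t t0; exact: density_ge0.
Qed.

Lemma discounted_liminf :
  (discounted_energy lambda L0 u <=
   gamma_liminf (X := weak_sobolev_discounted d lambda r_gt1)
    (fun e (u : sobolev_discounted d lambda r_gt1) =>
       discounted_energy lambda (L e) u) u)%E.
Proof.
pose Phi := fine (\int[mu]_(t in half_line) (density L0 u t * discount lambda t)%:E).
have PhiE : discounted_energy lambda L0 u = Phi%:E.
  rewrite /Phi fineK// ge0_fin_numE//; apply: integral_ge0 => t.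
  rewrite /= in_itv/= andbT => t0.
  by rewrite lee_fin density_ge0.
rewrite PhiE; apply/lee_subgt0Pr => eta eta0.
have eta3 : 0 < eta / 3 by rewrite divr_gt0.
have /cvgrPdist_le/(_ _ eta3) := partial_energy_cvg.
rewrite -/Phi => -[n0 _ /(_ n0 (leqnn n0))/= Hn].
pose J := partial_energy u n0%:R.
have J0 : 0 <= J.
  apply: fine_ge0; apply: integral_ge0 => t; rewrite /= in_itv/= => /andP[t0 _].
  by rewrite lee_fin density_ge0.
(* The mesh is 1/m, so that the integer n0 is a point of the partition; m is such that
   replacing exp (- lambda / m) by 1 costs at most eta / 3. *)
pose m := (Num.truncn (lambda * J / (eta / 3))).+1.
have m0 : 0 < m%:R :> R by rewrite ltr0n.
have mP : lambda * m%:R^-1 * J <= eta / 3.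
  have H := ltW (truncnS_gt (lambda * J / (eta / 3))); rewrite ler_pdivrMr// in H.
  by rewrite mulrAC ler_pdivrMr// [leRHS]mulrC.
have del0 : 0 < m%:R^-1 :> R by rewrite invr_gt0.
have [U uU HU] := @liminf_partition m%:R^-1 (n0 * m) del0 _ eta3.
apply: (le_gamma_liminf uU); near=> e => v Uv.
have e0 : 0 < e by [].
have md := measurable_discounted_density (sobolev_discountedP v) (L_borel e0).
have H1 : ((expR (- (lambda * m%:R^-1)) * partial_energy u ((n0 * m)%:R * m%:R^-1) - eta / 3)%:E <=
   \int[mu]_(t in `]0%R, ((n0 * m)%:R * m%:R^-1)%R[) (density (L e) v t * discount lambda t)%:E)%E.
  by move: v Uv {md}; near: e.
have TE : (n0 * m)%:R * m%:R^-1 = n0%:R :> R by rewrite natrM mulfK// gt_eqF.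
rewrite TE -/J in H1.
apply: (@le_trans _ _ (\int[mu]_(t in `]0%R, n0%:R%R[)
    (density (L e) v t * discount lambda t)%:E)%E); last first.
  apply: ge0_subset_integral => //; first exact/measurable_EFinP.
  - by move=> t; rewrite /= in_itv/= andbT => t0; rewrite lee_fin density_ge0//; exact: L_ge0.
  - exact: (sub_half_line (lexx 0)).
apply: le_trans H1; rewrite -EFinB lee_fin.
have c1 : 1 - lambda * m%:R^-1 <= expR (- (lambda * m%:R^-1)) by exact: expR_ge1Dx.
have c2 : (1 - lambda * m%:R^-1) * J <= expR (- (lambda * m%:R^-1)) * J by rewrite ler_wpM2r.
have h : Phi - J <= eta / 3 by rewrite (le_trans (ler_norm _)).
move: c2; rewrite mulrBl mul1r; lra.
Unshelve. all: by end_near. Qed.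
End liminf.

(** * Gluing recovery sequences *)

(** Error bookkeeping for one interval: ca and cb are the weights at its endpoints,
    c their ratio, pa and pb the partial energies there, and j its undiscounted
    energy. *)
Lemma recovery_arith {R : realFieldType} (c ca cb j pa pb eta : R) :
  0 < c -> ca = c * cb -> ca <= 1 -> 0 < eta -> cb * j <= pb - pa ->
  c * pa + eta / 2 + ca * (j + eta / 2) <= c * pb + eta.
Proof.
move=> c0 E ca1 eta0 h.
have K1 : ca * j <= c * (pb - pa) by rewrite E -mulrA ler_pM2l.
have K2 : ca * (eta / 2) <= eta / 2 by rewrite ler_piMl// divr_ge0// ltW.
move: K1 K2; rewrite mulrBr mulrDr; lra.
Qed.

Section recovery.
Context {R : realType} {d : nat}.
Local Notation mu := (@lebesgue_measure R).
Local Notation half_line := (`]0, +oo[%classic : set R).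
Variables (r lambda : R) (r_gt1 : 1 < r) (lambda_gt0 : 0 < lambda).
Variable L : R -> R -> 'rV[R]_d -> 'rV[R]_d -> R.
Hypotheses (L_borel : forall e : R, 0 < e -> borel_integrand (L e))
  (L_ge0 : forall e : R, 0 < e -> forall (t : R) x xi, 0 < t -> 0 <= L e t x xi).
Variable L0 : R -> 'rV[R]_d -> 'rV[R]_d -> R.
Hypotheses (L0_borel : borel_integrand L0)
  (L0_ge0 : forall (t : R) x xi, 0 < t -> 0 <= L0 t x xi).
Hypothesis recovery : forall a b : R, 0 <= a -> a < b ->
    forall u : sobolev d a b r_gt1,
    exists u_ : R -> sobolev d a b r_gt1,
      [/\ (u_ : R -> weak_sobolev d a b r_gt1) @ (0 : R)^'+
            --> (u : weak_sobolev d a b r_gt1),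
          forall e : R, 0 < e -> u_ e a = u a /\ u_ e b = u b &
          energy `]a, b[ (L e) (u_ e) @[e --> (0 : R)^'+]
            --> energy `]a, b[ L0 u].

Variable w : sobolev_discounted d lambda r_gt1.
Hypothesis w_fin : (\int[mu]_(t in half_line) (density L0 w t * discount lambda t)%:E < +oo)%E.

Lemma sobolev_discountedD (u v : sobolev_discounted d lambda r_gt1) t :
  (u + v) t = u t + v t.
Proof. by []. Qed.

Lemma sobolevB (a b : R) (u v : sobolev d a b r_gt1) t : (u - v) t = u t - v t.
Proof. by []. Qed.

(** On a new interval ]a, b[ with recovery sequence w_e, the correction is increased by the
    extension of w_e - w. This is 0 outside ]a, b[ because w_e = w at the
    endpoints, so it does not disturb the energies of the previous intervals, and
    it converges weakly to 0 because the extension is weakly continuous. *)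
Lemma recovery_partition (del : R) (k : nat) : 0 < del ->
  exists z : R -> sobolev_discounted d lambda r_gt1,
  [/\ forall l : {linear sobolev_discounted d lambda r_gt1 -> R^o},
        top_dual (@sobolev_discounted_norm R d r lambda r_gt1) l ->
        l (z e) @[e --> 0^'+] --> (0 : R^o),
      forall e, 0 < e -> forall t, k%:R * del <= t -> z e t = 0 &
      forall eta : R, 0 < eta -> \forall e \near 0^'+,
       (\int[mu]_(t in `]0%R, (k%:R * del)%R[)
          (density (L e) (w + z e)%R t * discount lambda t)%:E <=
        (expR (lambda * del) * partial_energy lambda L0 w (k%:R * del) + eta)%:E)%E].
Proof.
move=> del0; elim: k => [|k [z [z_cvg z0 zE]]].
  exists (fun=> 0); split.
  - by move=> l _; rewrite linear0; exact: cvg_cst.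
  - by [].
  move=> eta eta0; apply: nearW => e; rewrite mul0r.
  by rewrite set_itv_ge ?bnd_simp// integral_set0 partial_energy0 mulr0 add0r lee_fin ltW.
pose a := k%:R * del; pose b := k.+1%:R * del.
have a0 : 0 <= a by rewrite mulr_ge0// ltW.
have ab : a < b by rewrite ltr_pM2r// ltr_nat.
have bE : b = a + del by rewrite /a /b -natr1 mulrDl mul1r.
have [j [jE j0 j1 j2]] := interval_energy lambda_gt0 L0_borel L0_ge0 a0 ab w_fin.
have [w_ [w_cvg w_bd wE]] := recovery a0 ab (sobolev_restrict a0 ab w).
pose ext := @sobolev_extend R d r lambda r_gt1 a b a0 ab lambda_gt0.
pose y e := ext (w_ e - sobolev_restrict a0 ab w).
have y0 e t : 0 < e -> 0 <= t -> t <= a \/ b <= t -> y e t = 0.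
  move=> e0 t0 h; rewrite /y /ext sobolev_extendE// sobolevB.
  have [wa wb] := w_bd e e0.
  case: h => h; first by rewrite (clamp_le (ltW ab) h) wa subrr.
  by rewrite (clamp_ge (ltW ab) h) wb subrr.
exists (fun e => z e + y e); split.
- move=> l Nl; under eq_fun do rewrite linearD.
  suff yl : l (y e) @[e --> 0^'+] --> (0 : R^o).
    have := cvgD (z_cvg l Nl) yl; rewrite addr0; exact.
  have FF : Filter ((0 : R)^'+) by exact: at_right_proper_filter.
  have := cvg_comp _ _ w_cvg
    (@sobolev_extend_weak_continuous R d r lambda r_gt1 a b a0 ab lambda_gt0 _).
  move=> /(weak_cvgP _ _ _ FF)/(_ l Nl) H.
  have -> : (fun e => l (y e)) = (fun e => l (ext (w_ e)) - l (ext (sobolev_restrict a0 ab w))).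
    by apply/funext => e; rewrite /y /ext !linearB.
  have := cvgB H (cvg_cst (l (ext (sobolev_restrict a0 ab w)))); rewrite subrr; exact.
- move=> e e0 t bt; rewrite sobolev_discountedD z0//; last first.
    by rewrite (le_trans _ bt)// ltW.
  rewrite add0r y0//; last by right.
  by rewrite (le_trans _ bt)// ltW// (le_lt_trans a0).
move=> eta eta0; have eta2 : 0 < eta / 2 by rewrite divr_gt0.
have Hj : \forall e \near 0^'+, (energy `]a, b[ (L e) (w_ e) < (j + eta / 2)%:E)%E.
  rewrite jE in wE.
  have jlt : (j%:E < (j + eta / 2)%:E)%E by rewrite lte_fin ltrDl.
  exact: (wE _ (open_ereal_lt' jlt)).
near=> e.
have e0 : 0 < e by [].
pose v := (w + (z e + y e)).
have vD t : v t = w t + (z e t + y e t) by [].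
(* On the new interval the glued function is the recovery sequence itself. *)
have vR : sobolev_restrict a0 ab v = w_ e.
  apply/val_inj/funext => t; have [tab|tab] := boolP (t \in `[a, b]); last first.
    by transitivity (0 : 'rV[R]_d); [|apply/esym]; exact: sobolev_eq0.
  have tab' : a <= t <= b by move: tab; rewrite in_itv.
  have /andP[at_ tb] := tab'.
  transitivity (v t); first exact: sobolev_restrictE.
  transitivity (w_ e t); last by [].
  rewrite vD z0// add0r /y /ext sobolev_extendE ?(le_trans a0)//.
  rewrite clamp_id// sobolevB sobolev_restrictE//.
  by rewrite addrC subrK.
have m := measurable_discounted_density (sobolev_discountedP v) (L_borel e0).
rewrite -/a -/b -/v.
rewrite (integral_oo_split m (@density_ge0 _ _ lambda _ (L_ge0 e0) v) a0 (ltW ab)).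
have oI : open `]0, a[%classic by exact: interval_open.
have E1 := @integral_density_eq R d r lambda (L e) v (w + z e) `]0, a[ (L_borel e0)
  (sobolev_discountedP v) (sobolev_discountedP (w + z e)) oI (sub_half_line (lexx 0)).
rewrite E1; last first.
  move=> t /set_mem tI; have /andP[t0 ta] : 0 < t < a by move: tI; rewrite /= in_itv.
  transitivity (w t + z e t); last by [].
  rewrite vD (y0 _ _ e0 (ltW t0) (or_introl (ltW ta))) addr0; reflexivity.
have H1 : (\int[mu]_(t in `]0%R, a[)
          (density (L e) (w + z e)%R t * discount lambda t)%:E <=
        (expR (lambda * del) * partial_energy lambda L0 w a + eta / 2)%:E)%E.
  by near: e; exact: zE.
have H2 := discounted_le lambda_gt0 (L_borel e0) (L_ge0 e0) a0 ab v.
rewrite vR in H2.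
have H3 : (energy `]a, b[ (L e) (w_ e) <= (j + eta / 2)%:E)%E.
  by apply: ltW; near: e.
apply: le_trans (leeD H1 H2) _.
apply: (@le_trans _ _ ((expR (lambda * del) * partial_energy lambda L0 w a + eta / 2)%:E +
   (expR (- (lambda * a)))%:E * (j + eta / 2)%:E)%E).
  by apply: leeD2l; apply: lee_wpmul2l => //; rewrite lee_fin expR_ge0.
rewrite -EFinM -EFinD lee_fin.
have E : expR (- (lambda * a)) = expR (lambda * del) * expR (- (lambda * b)).
  by rewrite -expRD bE; congr expR; ring.
have c0 : 0 < expR (lambda * del) by exact: expR_gt0.
have ca : expR (- (lambda * a)) <= 1.
  by rewrite -expR0 ler_expR oppr_le0; exact: (mulr_ge0 (ltW lambda_gt0) a0).
exact: (recovery_arith c0 E ca eta0 j1).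
Unshelve. all: by end_near. Qed.
End recovery.

(** * Decay at infinity *)

Section decay.
Context {R : realType} {d : nat}.
Local Notation mu := (@lebesgue_measure R).
Local Notation half_line := (`]0, +oo[%classic : set R).
Local Notation ray a := (`]a, +oo[%classic : set R).

Lemma tail_small (F : R -> R) : measurable_fun half_line F ->
  (forall t : R, 0 < t -> 0 <= F t) ->
  (\int[mu]_(t in half_line) (F t)%:E < +oo)%E ->
  forall eta : R, 0 < eta ->
  \forall n \near \oo, (\int[mu]_(t in ray n%:R) (F t)%:E <= eta%:E)%E.
Proof.
move=> mF F0 fin eta eta0.
have pos (A : set R) : A `<=` half_line -> (0 <= \int[mu]_(t in A) (F t)%:E)%E.
  by move=> sA; apply: integral_ge0 => t /sA/=; rewrite in_itv/= andbT => /F0; rewrite lee_fin.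
have cv := integral_itv_half_line_cvg mF F0.
have finT : (\int[mu]_(t in half_line) (F t)%:E \is a fin_num)%E.
  by rewrite ge0_fin_numE// pos.
have lt : (((fine (\int[mu]_(t in half_line) (F t)%:E)) - eta)%:E <
    \int[mu]_(t in half_line) (F t)%:E)%E.
  by rewrite -[ltRHS](fineK finT) lte_fin ltrBlDr ltrDl.
have ne := cv _ (open_ereal_gt' lt).
apply: (@filterS _ (\oo : set_system nat) _ _ _ _ ne) => n Hn.
have S := integral_ray_split mF F0 (ler0n R n).
have pI := pos _ (@sub_half_line R 0 n%:R (lexx 0)).
have pR := pos _ (@sub_half_line_ray R n%:R (ler0n R n)).
have finR : (\int[mu]_(t in ray n%:R) (F t)%:E \is a fin_num)%E.
  rewrite ge0_fin_numE; last exact: pR.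
  by apply: le_lt_trans fin; rewrite S; exact: leeDr.
have finI : (\int[mu]_(t in `]0%R, n%:R%R[) (F t)%:E \is a fin_num)%E.
  rewrite ge0_fin_numE; last exact: pI.
  by apply: le_lt_trans fin; rewrite S; exact: leeDl.
move: finR finI finT Hn S; rewrite /=.
move: (\int[mu]_(t in ray n%:R) (F t)%:E)%E (\int[mu]_(t in `]0%R, n%:R%R[) (F t)%:E)%E
  (\int[mu]_(t in half_line) (F t)%:E)%E => X Y Z.
case: X => // x _; case: Y => // y _; case: Z => // z _ /=.
by rewrite lte_fin lee_fin -EFinD => yz [zE]; move: yz; rewrite zE; lra.
Qed.

Variables (r lambda : R) (r1 : 1 < r) (lambda0 : 0 < lambda) (u : R -> 'rV[R]_d).
Hypothesis Wu : W1r_discounted r lambda u.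

Let r0 : 0 < r. Proof. exact: lt_trans r1. Qed.

Definition deriv_power (t : R) : R :=
  euclidean_norm (weak_derivative half_line u t) `^ r * discount lambda t.

Lemma measurable_deriv_power : measurable_fun half_line deriv_power.
Proof.
have [_ [mD _]] := W1r_discounted_weak_derivative Wu.
by apply/measurable_EFinP; apply: measurable_pow_weight => //; exact: measurable_discount.
Qed.

Lemma deriv_power_ge0 t : 0 <= deriv_power t.
Proof. by rewrite mulr_ge0 ?powR_ge0 ?discount_ge0. Qed.

Lemma deriv_power_lty : (\int[mu]_(t in half_line) (deriv_power t)%:E < +oo)%E.
Proof. by have [_ [_ fin]] := W1r_discounted_weak_derivative Wu. Qed.

Lemma expR_powR (x y : R) : expR x `^ y = expR (x * y).
Proof. by rewrite /powR gt_eqF ?expR_gt0// expRK mulrC. Qed.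

(** The parameter of [le_young] is taken proportional to exp (lambda t / r), the
    maximal growth rate of u, for which the powers of the exponential combine with
    the weight of |u'|^r. *)
Lemma young_weighted (eta t n : R) : 0 < eta -> 0 < t -> t <= n ->
  euclidean_norm (weak_derivative half_line u t) <=
  eta * expR (lambda / r * t) + eta `^ (1 - r) * expR (lambda / r * n) * deriv_power t.
Proof.
move=> eta0 t0 tn; set g := euclidean_norm _.
have g0 : 0 <= g by exact: euclidean_norm_ge0.
have ee : 0 < eta * expR (lambda / r * t) by rewrite mulr_gt0// expR_gt0.
apply: (le_trans (le_young r1 ee g0)); rewrite lerD2l.
rewrite (powRM _ (ltW eta0) (expR_ge0 _)) -[leLHS]mulrA -[leRHS]mulrA.
apply: ler_wpM2l; first exact: powR_ge0.
rewrite expR_powR /deriv_power -/g [leRHS]mulrCA [leLHS]mulrC.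
apply: ler_wpM2l; first exact: powR_ge0.
rewrite /discount -expRD ler_expR.
have -> : lambda / r * t * (1 - r) = lambda / r * t - lambda * t.
  by field; rewrite gt_eqF.
by rewrite lerD2r ler_wpM2l// divr_ge0 ?ltW.
Qed.

Lemma increment_discounted (eta : R) (m n : nat) : 0 < eta -> (m < n)%N ->
  (\int[mu]_(t in `]m%:R, n%:R[) euclidean_norm (weak_derivative half_line u t))%R <=
  expR (lambda / r * n%:R) * (eta * (r / lambda) +
    eta `^ (1 - r) * fine (\int[mu]_(t in ray m%:R) (deriv_power t)%:E)).
Proof.
move=> eta0 mn; have lr0 : 0 < lambda / r by rewrite divr_gt0.
have mn' : m%:R < n%:R :> R by rewrite ltr_nat.
have n0 : 0 < n%:R :> R by rewrite (le_lt_trans _ mn').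
have [uD LD] := W1r_discounted_weak_derivative Wu.
have [Lb _] := discounted_Lr_itv n%:R lambda0 LD.
have iN := is_Lr_integrable_norm r1 (ltW n0) Lb.
have sub : `]m%:R, n%:R[ `<=` `](0:R), n%:R[ by apply: subset_itvr; rewrite bnd_simp.
have subH : `]m%:R, n%:R[ `<=` half_line by exact: sub_half_line.
have iN' : mu.-integrable `]m%:R, n%:R[
    (EFin \o (fun t => euclidean_norm (weak_derivative half_line u t))).
  by apply: integrableS iN.
pose E t := expR (lambda / r * t).
have cE : continuous E.
  move=> x; apply: (@continuous_comp _ _ _ (fun t => lambda / r * t) expR);
    last exact: continuous_expR.
  by apply: cvgM; [exact: cvg_cst|exact: cvg_id].
have iE : mu.-integrable `]m%:R, n%:R[ (EFin \o E).
  by apply: integrable_continuous_oo; exact: continuous_subspaceT.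
have iP : mu.-integrable `]m%:R, n%:R[ (EFin \o deriv_power).
  apply/integrableP; split.
    by apply/measurable_EFinP; apply: measurable_funS measurable_deriv_power.
  apply: le_lt_trans deriv_power_lty.
  under eq_integral => t _ do rewrite /= ger0_norm ?deriv_power_ge0//.
  apply: ge0_subset_integral => //.
    by apply/measurable_EFinP; exact: measurable_deriv_power.
  by move=> t _; rewrite lee_fin deriv_power_ge0.
have mI : measurable (`]m%:R, n%:R[%classic : set (measurableTypeR R)) by [].
pose k := eta `^ (1 - r) * E n%:R.
have ieE : mu.-integrable `]m%:R, n%:R[ (EFin \o (fun t => eta * E t)).
  have H := integrableZl mI eta iE; exact: H.
have ikP : mu.-integrable `]m%:R, n%:R[ (EFin \o (fun t => k * deriv_power t)).
  have H := integrableZl mI k iP; exact: H.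
have iS : mu.-integrable `]m%:R, n%:R[ (EFin \o (fun t => eta * E t + k * deriv_power t)).
  have H := integrableD mI ieE ikP; exact: H.
apply: (@le_trans _ _ (\int[mu]_(t in `]m%:R, n%:R[) (eta * E t + k * deriv_power t))%R).
  apply: (le_Rintegral mI iN' iS) => t tmn.
  have /andP[mt tn] : m%:R < t < n%:R by move: tmn; rewrite /= in_itv.
  by apply: young_weighted => //; [rewrite (le_lt_trans _ mt)|exact: ltW].
rewrite (RintegralD mI ieE ikP) (RintegralZl _ mI iE) (RintegralZl _ mI iP).
have -> : (\int[mu]_(t in `]m%:R, n%:R[) E t)%R = r / lambda * E n%:R - r / lambda * E m%:R.
  apply: (@Rintegral_is_derive R (fun t => r / lambda * E t)) => // x.
  have h1 := is_derive_affine (lambda / r) 0 0 x.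
  have -> : (fun t => r / lambda * E t) =
      (fun t => r / lambda * (expR \o (fun y => lambda / r * (y - 0) + 0)) t).
    by apply/funext => y; rewrite /E/= subr0 addr0.
  have h2 : is_derive x 1 (expR \o (fun y => lambda / r * (y - 0) + 0))
     (expR (lambda / r * (x - 0) + 0) * (lambda / r)).
    by apply: is_derive1_comp.
  have h3 := is_deriveM (is_derive_cst (r / lambda) x 1) h2.
  apply: (is_derive_eq h3).
  rewrite scaler0 addr0 /GRing.scale/= subr0 addr0 /E.
  by field; rewrite !gt_eqF.
have P1 : (\int[mu]_(t in `]m%:R, n%:R[) deriv_power t)%R <=
    fine (\int[mu]_(t in ray m%:R) (deriv_power t)%:E).
  have sr : ray m%:R `<=` half_line by exact: sub_half_line_ray.
  apply: fine_le.
  - by apply: (@integrable_fin_num _ _ R mu `]m%:R, n%:R[ _ _ iP).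
  - rewrite ge0_fin_numE; last by apply: integral_ge0 => t _; rewrite lee_fin deriv_power_ge0.
    apply: le_lt_trans deriv_power_lty; apply: ge0_subset_integral => //.
      by apply/measurable_EFinP; exact: measurable_deriv_power.
    by move=> t _; rewrite lee_fin deriv_power_ge0.
  apply: ge0_subset_integral => //.
  - by apply/measurable_EFinP; apply: measurable_funS measurable_deriv_power.
  - by move=> t _; rewrite lee_fin deriv_power_ge0.
  - by apply: subset_itvl; rewrite bnd_simp.
have k0 : 0 <= k by rewrite mulr_ge0 ?powR_ge0 ?expR_ge0.
have K1 := ler_wpM2l k0 P1.
have K2 : eta * (r / lambda * E n%:R - r / lambda * E m%:R) <= E n%:R * (eta * (r / lambda)).
  have e0 : 0 <= eta * (r / lambda) * E m%:R.
    by rewrite !mulr_ge0 ?expR_ge0 ?invr_ge0// ltW.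
  have -> : eta * (r / lambda * E n%:R - r / lambda * E m%:R) =
     E n%:R * (eta * (r / lambda)) - eta * (r / lambda) * E m%:R by ring.
  by rewrite gerBl.
apply: (le_trans (lerD K2 K1)); rewrite -/(E n%:R) mulrDr lerD2l /k.
by rewrite mulrA [E _ * _]mulrC.
Qed.

(** Between m and n, u grows by at most exp (lambda n / r) times a factor that is
    small once the tail beyond m is small. For n much larger than m, u(m) is also
    negligible against exp (lambda n / r). *)
Lemma value_decay (eps : R) : 0 < eps ->
  \forall n \near \oo, euclidean_norm (u n%:R) `^ r * discount lambda n%:R <= eps.
Proof.
move=> eps0.
pose q := eps `^ r^-1; have q0 : 0 < q by rewrite powR_gt0.
have qr : q `^ r = eps by rewrite /q -powRrM mulVf ?gt_eqF// powRr1// ltW.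
have lr0 : 0 < lambda / r by rewrite divr_gt0.
have rl0 : 0 < r / lambda by rewrite divr_gt0.
(* The aim is |u(n)| <= q exp (lambda n / r): one third of q is spent on u(m), and
   one third on each of the two terms of increment_discounted. The factor D absorbs
   the passage from coordinates to norms and the 2 of euclidean_normD_le. *)
pose D := 2 * (d%:R + 1) : R.
have D0 : 0 < D by rewrite mulr_gt0// ltr_wpDl// ler0n.
pose eta := q / (3 * D * (r / lambda)).
have eta0 : 0 < eta by rewrite divr_gt0// mulr_gt0// mulr_gt0.
have ep0 : 0 < eta `^ (1 - r) by rewrite powR_gt0.
pose tau := q / (3 * D * eta `^ (1 - r)).
have tau0 : 0 < tau by rewrite divr_gt0// mulr_gt0// mulr_gt0.
have [m _ /(_ m (leqnn m)) Hm] := tail_small measurable_deriv_power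
   (fun t _ => deriv_power_ge0 t) deriv_power_lty tau0.
pose A := euclidean_norm (u m%:R).
have A0 : 0 <= A by exact: euclidean_norm_ge0.
near=> n.
have mn : (m < n)%N by near: n; exact: nbhs_infty_gt.
have mn' : m%:R < n%:R :> R by rewrite ltr_nat.
have n0 : 0 < n%:R :> R by rewrite (le_lt_trans _ mn').
have An : 2 * A <= q / 3 * (lambda / r * n%:R).
  have K0 : 0 < q / 3 * (lambda / r) by apply: mulr_gt0 => //; exact: divr_gt0.
  have H : 2 * A / (q / 3 * (lambda / r)) <= n%:R by near: n; exact: nbhs_infty_ger.
  by rewrite (ler_pdivrMr _ _ K0) in H; rewrite mulrA [leRHS]mulrC.
have tailm : fine (\int[mu]_(t in ray m%:R) (deriv_power t)%:E) <= tau.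
  rewrite -lee_fin fineK//; rewrite ge0_fin_numE; last first.
    by apply: integral_ge0 => t _; rewrite lee_fin deriv_power_ge0.
  exact: le_lt_trans Hm (ltry _).
have inc := increment_discounted eta0 mn.
pose E := expR (lambda / r * n%:R).
have E0 : 0 < E by exact: expR_gt0.
pose X := eta * (r / lambda) + eta `^ (1 - r) * tau.
have XE : X = 2 * q / (3 * D).
  rewrite /X /tau {1}/eta; field.
  by rewrite !gt_eqF//.
have inc2 :
    (\int[mu]_(t in `]m%:R, n%:R[) euclidean_norm (weak_derivative half_line u t))%R <= E * X.
  apply: (le_trans inc); rewrite ler_pM2l// /X lerD2l ler_pM2l//.
have [uD LD] := W1r_discounted_weak_derivative Wu.
have [Wn _] := Wu; have [cu _ _] := Wn n%:R n0.
have [Lb _] := discounted_Lr_itv n%:R lambda0 LD.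
have m1 (B : set R) : measurable_fun B (cst 1 : R -> R) by exact: measurable_cst.
have sub : `]m%:R, n%:R[ `<=` `](0:R), n%:R[ by apply: subset_itvr; rewrite bnd_simp.
have [Lmn _] := @weighted_LrS _ _ (cst 1) r _ _ (weak_derivative half_line u)
  (measurable_itv `](0:R), n%:R[) (measurable_itv `]m%:R, n%:R[) sub (m1 _) (fun=> ler01) Lb.
have cu' : {within `[m%:R, n%:R], continuous u}.
  by apply: continuous_subspaceW cu; apply: subset_itvr; rewrite bnd_simp.
have uDmn : is_weak_derivative `]m%:R, n%:R[ u (weak_derivative half_line u).
  by apply: is_weak_derivativeS uD; [exact: interval_open|exact: sub_half_line].
have diff : euclidean_norm (u n%:R - u m%:R) <= d%:R * (E * X).
  apply: euclidean_norm_le_coord.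
    by rewrite mulr_ge0 ?ltW// XE divr_gt0 ?mulr_gt0.
  move=> i; rewrite !mxE.
  have := weak_increment_le i r1 mn' cu' uDmn Lmn (lexx _) (ltW mn') (lexx _).
  by move=> /le_trans; apply.
have un : euclidean_norm (u n%:R) <= 2 * (A + d%:R * (E * X)).
  have -> : u n%:R = u m%:R + (u n%:R - u m%:R) by rewrite addrC subrK.
  apply: (le_trans (euclidean_normD_le _ _)); rewrite ler_pM2l//.
  rewrite ge_max; apply/andP; split; first by rewrite lerDl (le_trans _ diff)// euclidean_norm_ge0.
  by rewrite (le_trans diff)// lerDr.
have unq : euclidean_norm (u n%:R) <= q * E.
  apply: (le_trans un); rewrite mulrDr.
  have K1 : 2 * A <= q / 3 * E.
    apply: (le_trans An); apply: ler_wpM2l; first by rewrite divr_ge0// ltW.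
    by apply: le_trans (expR_ge1Dx _); rewrite lerDr.
  have K2 : 2 * (d%:R * (E * X)) <= 2 / 3 * q * E.
    have -> : 2 * (d%:R * (E * X)) = (2 * d%:R * X) * E by ring.
    rewrite ler_wpM2r ?(ltW E0)// XE.
    have -> : 2 * d%:R * (2 * q / (3 * D)) = 2 / 3 * q * (2 * d%:R / D).
      by field; rewrite gt_eqF.
    have q23 : 0 <= 2 / 3 * q by rewrite mulr_ge0// ltW.
    apply: ler_piMr; first exact: q23.
    by rewrite ler_pdivrMr// mul1r /D mulrDr lerDl mulr1.
  apply: (le_trans (lerD K1 K2)).
  rewrite le_eqVlt; apply/orP; left; apply/eqP; by field.
apply: (@le_trans _ _ ((q * E) `^ r * discount lambda n%:R)).
  rewrite ler_wpM2r ?discount_ge0//; apply: ge0_ler_powR => //; first exact: ltW.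
    by rewrite nnegrE euclidean_norm_ge0.
  by rewrite nnegrE mulr_ge0// ltW.
rewrite (powRM _ (ltW q0) (ltW E0)) qr /E expR_powR /discount -mulrA -expRD.
have -> : lambda / r * n%:R * r - lambda * n%:R = 0 by field; rewrite gt_eqF.
by rewrite expR0 mulr1.
Unshelve. all: by end_near. Qed.
End decay.

(** * Cutting off after a given time *)

Section affine.
Context {R : realType} {d : nat}.
Local Notation mu := (@lebesgue_measure R).
Variables (r : R) (r1 : 1 < r) (a b : R) (ab : a < b) (x : 'rV[R]_d).

Definition ramp (s t : R) : 'rV[R]_d := (t - s) *: x.

Lemma continuous_ramp (s : R) : continuous (ramp s).
Proof.
move=> t; apply: cvgZr_tmp; apply: cvgB; [exact: cvg_id|exact: cvg_cst].
Qed.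

Lemma ramp_weak_derivative (s : R) : is_weak_derivative `]a, b[ (ramp s) (cst x).
Proof.
have oI : open `]a, b[%classic by exact: interval_open.
split; first exact: (L1loc_continuous oI (@continuous_ramp s)).
  by apply: (L1loc_continuous oI) => t; exact: cvg_cst.
move=> phi [dphi cdphi [K [cK KO phi0]]] i.
have dp (t : R) : is_derive t 1 phi ((phi^`())%classic t).
  by rewrite derive1E; apply: DeriveDef.
have cphi := is_derive_continuous dp.
have phia : phi a = 0 by apply: phi0 => /KO/=; rewrite in_itv/= ltxx.
have phib : phi b = 0 by apply: phi0 => /KO/=; rewrite in_itv/= ltxx andbF.
pose F t := (t - s) * phi t.
have dF (t : R) : is_derive t 1 F (phi t + (t - s) * (phi^`())%classic t).
  have h1 : is_derive t 1 (fun y : R => y - s) 1.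
    have h := is_derive_affine 1 s 0 t.
    have -> // : (fun y : R => y - s) = (fun y => 1 * (y - s) + 0).
      by apply/funext => y; rewrite mul1r addr0.
  have h2 := is_deriveM h1 (dp t).
  by apply: (is_derive_eq h2); rewrite /GRing.scale/= mulr1 addrC.
have caff : continuous (fun t : R => t - s).
  by move=> t; apply: cvgB; [exact: cvg_id|exact: cvg_cst].
have c1 : continuous (fun t => (t - s) * (phi^`())%classic t).
  by move=> t; apply: cvgM; [exact: caff|exact: cdphi].
have cF : continuous (fun t => phi t + (t - s) * (phi^`())%classic t).
  by move=> t; apply: cvgD; [exact: cphi|exact: c1].
have := Rintegral_is_derive ab dF cF.
rewrite /F phia phib !mulr0 subrr.
have mI : measurable (`]a, b[%classic : set (measurableTypeR R)) by [].
have ip : mu.-integrable `]a, b[ (EFin \o phi).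
  by apply: integrable_continuous_oo; exact: continuous_subspaceT.
have i1 : mu.-integrable `]a, b[ (EFin \o (fun t => (t - s) * (phi^`())%classic t)).
  by apply: integrable_continuous_oo; exact: continuous_subspaceT.
rewrite (RintegralD mI ip i1) => E.
have E1 : (\int[mu]_(t in `]a, b[) (x 0 i * phi t))%R =
    x 0 i * (\int[mu]_(t in `]a, b[) phi t)%R by rewrite (RintegralZl _ mI ip).
have E2 : (\int[mu]_(t in `]a, b[) (x 0 i * ((t - s) * (phi^`())%classic t)))%R =
    x 0 i * (\int[mu]_(t in `]a, b[) ((t - s) * (phi^`())%classic t))%R.
  by rewrite (RintegralZl _ mI i1).
have iL : mu.-integrable `]a, b[ (fun t => (x 0 i * ((t - s) * (phi^`())%classic t))%:E).
  have H := integrableZl mI (x 0 i) i1; exact: H.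
have iR : mu.-integrable `]a, b[ (fun t => (x 0 i * phi t)%:E).
  have H := integrableZl mI (x 0 i) ip; exact: H.
have fL := @integrable_fin_num _ _ R mu _ mI _ iL.
have fR := @integrable_fin_num _ _ R mu _ mI _ iR.
transitivity (\int[mu]_(t in `]a, b[) (x 0 i * ((t - s) * (phi^`())%classic t))%:E)%E.
  by apply: eq_integral => t _; rewrite mxE; congr (_%:E); ring.
rewrite /cst -(fineK fL) -(fineK fR) -EFinN; congr (_%:E).
rewrite -[LHS]/(\int[mu]_(t in `]a, b[) (x 0 i * ((t - s) * (phi^`())%classic t)))%R E2.
rewrite -[X in _ = - X]/(\int[mu]_(t in `]a, b[) (x 0 i * phi t))%R E1.
by rewrite -mulrN; congr (_ * _); apply/eqP; rewrite -addr_eq0 addrC E.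
Qed.

Definition ramp_fun (t : R) : 'rV[R]_d := if t \in `[a, b] then ramp a t else 0.

Lemma ramp_fun_pred : ramp_fun \in sobolev_pred a b r1.
Proof.
have r0 : 0 <= r by rewrite ltW// (lt_trans ltr01).
rewrite inE; split; last by move=> t /negbTE tab; rewrite /ramp_fun tab.
apply: (W1rS (lexx a) (lexx b) (u := ramp a)).
  by move=> t tab; rewrite /ramp_fun tab.
split.
- by apply: continuous_subspaceT; exact: continuous_ramp.
- exact: (continuous_is_Lr _ _ r0 (@continuous_ramp a)).
- exists (cst x); first exact: ramp_weak_derivative.
  by apply: (continuous_is_Lr _ _ r0) => t; exact: cvg_cst.
Qed.

Definition sobolev_ramp : sobolev d a b r1 := Sobolev ramp_fun_pred.

Lemma sobolev_rampE t : a <= t <= b -> sobolev_ramp t = (t - a) *: x.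
Proof. by move=> tab; rewrite /= /ramp_fun in_itv/= tab. Qed.
End affine.

(** Assembles the estimates of w - u on [T, T + 1] (z2) and beyond (z3) against the
    value term x and the tail s of the derivative. *)
Lemma sum_le_scaled (R : realType) (k : R) (x x' i z2 z3 s : \bar R) :
  1 <= k -> (0 <= x)%E -> (0 <= i)%E -> (0 <= z3)%E ->
  (z2 <= k%:E * (x' + i))%E -> (x' <= x)%E -> s = (i + z3)%E ->
  (z2 + z3 <= k%:E * (x + s))%E.
Proof.
move=> k1 x0 i0 z30 z2k xx ->.
have k0 : (0 <= k%:E)%E by rewrite lee_fin (le_trans ler01).
rewrite addeA ge0_muleDr//; last exact: adde_ge0.
apply: leeD.
  by apply: (le_trans z2k); apply: lee_wpmul2l => //; exact: leeD2r.
by rewrite -[leLHS]mul1e; apply: lee_wpmul2r.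
Qed.

Section cutoff.
Context {R : realType} {d : nat}.
Local Notation mu := (@lebesgue_measure R).
Local Notation half_line := (`]0, +oo[%classic : set R).
Local Notation ray a := (`]a, +oo[%classic : set R).
Variables (r lambda : R) (r1 : 1 < r) (lambda0 : 0 < lambda).

Let r0 : 0 < r. Proof. exact: lt_trans r1. Qed.

Lemma integral_deriv_power (z g : R -> 'rV[R]_d) (O : set R) :
  W1r_discounted r lambda z -> open O -> O `<=` half_line -> is_weak_derivative O z g ->
  (\int[mu]_(t in O) (deriv_power r lambda z t)%:E =
   \int[mu]_(t in O) (euclidean_norm (g t) `^ r * discount lambda t)%:E)%E.
Proof.
move=> Wz oO sO zg; apply: ge0_ae_eq_integral.
- exact: open_measurable.
- apply/measurable_EFinP; apply: measurable_funS (measurable_deriv_power Wz) => //.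
- apply: measurable_pow_weight; first exact: measurable_discount.
  by have [_ lg _] := zg; move=> i; have [] := lg i.
- by move=> t _; rewrite lee_fin deriv_power_ge0.
- by move=> t _; apply: pow_weight_ge0; exact: discount_ge0.
apply: filterS (W1r_discounted_weak_derivative_ae Wz oO sO zg).
  exact: (ae_filter_ringOfSetsType mu).
by move=> t H Ot; rewrite /deriv_power H.
Qed.

Variables (u : sobolev_discounted d lambda r1) (T : R) (T0 : 0 < T).

Let TT1 : T < T + 1. Proof. by rewrite ltrDl. Qed.
Let T0' : 0 <= T. Proof. exact: ltW. Qed.

(** u on [0, T], affine from u(T) to 0 on [T, T + 1], and 0 afterwards: from u frozen
    at time T is subtracted a ramp reaching u(T) at time T + 1. As a combination of
    extensions it belongs to the space without further proof. *)
Definition cutoff_after : sobolev_discounted d lambda r1 :=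
  sobolev_extend (lexx 0) T0 lambda0 (sobolev_restrict (lexx 0) T0 u) -
  sobolev_extend T0' TT1 lambda0 (sobolev_ramp r1 TT1 (u T)).

Lemma cutoff_afterE t : cutoff_after t =
  sobolev_extend (lexx 0) T0 lambda0 (sobolev_restrict (lexx 0) T0 u) t -
  sobolev_extend T0' TT1 lambda0 (sobolev_ramp r1 TT1 (u T)) t.
Proof. by []. Qed.

Lemma cutoff_after_le t : 0 <= t <= T -> cutoff_after t = u t.
Proof.
move=> /andP[t0 tT]; rewrite cutoff_afterE !sobolev_extendE//.
rewrite clamp_id ?t0// sobolev_restrictE ?t0// (clamp_le (ltW TT1) tT).
by rewrite sobolev_rampE ?lexx ?(ltW TT1)// subrr scale0r subr0.
Qed.

Lemma cutoff_after_mid t : T <= t <= T + 1 -> cutoff_after t = - (t - (T + 1)) *: u T.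
Proof.
move=> tT; have /andP[Tt tT1] := tT; have t0 : 0 <= t by exact: le_trans Tt.
rewrite cutoff_afterE !sobolev_extendE//.
rewrite (clamp_ge T0' Tt) sobolev_restrictE ?lexx ?T0'// (clamp_id tT).
rewrite sobolev_rampE// -[X in X - _]scale1r -scalerBl; congr (_ *: _); ring.
Qed.

Lemma cutoff_after_ge t : T + 1 <= t -> cutoff_after t = 0.
Proof.
move=> tT; have Tt : T <= t by rewrite (le_trans _ tT)// ltW.
have t0 : 0 <= t by exact: le_trans Tt.
rewrite cutoff_afterE !sobolev_extendE//.
rewrite (clamp_ge T0' Tt) sobolev_restrictE ?lexx ?T0'// (clamp_ge (ltW TT1) tT).
rewrite sobolev_rampE ?lexx ?(ltW TT1)//.
by rewrite -[X in X - _]scale1r -scalerBl addrAC subrr add0r subrr scale0r.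
Qed.

Let Wu := sobolev_discountedP u.

Definition cutoff_error : R :=
  2 `^ r * (euclidean_norm (u T) `^ r * discount lambda T +
            fine (\int[mu]_(t in ray T) (deriv_power r lambda u t)%:E)).

Lemma int_ramp_le :
  (\int[mu]_(t in `]T, (T + 1)%R[) (euclidean_norm (u T) `^ r * discount lambda t)%:E <=
   (euclidean_norm (u T) `^ r * discount lambda T)%:E)%E.
Proof.
apply: (@le_trans _ _ (\int[mu]_(t in `]T, (T + 1)%R[)
   (euclidean_norm (u T) `^ r * discount lambda T)%:E)%E).
  apply: ge0_le_integral => //.
  - by move=> t _; rewrite lee_fin mulr_ge0 ?powR_ge0 ?discount_ge0.
  - by apply/measurable_EFinP; apply: measurable_funM => //; exact: measurable_discount.
  move=> t; rewrite /= in_itv/= => /andP[Tt _]; rewrite lee_fin ler_wpM2l ?powR_ge0//.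
  by rewrite ler_expR lerN2 ler_wpM2l// ltW.
rewrite integral_cst//= lebesgue_measure_itv/= lte_fin TT1 -EFinB addrAC subrr add0r.
by rewrite mule1.
Qed.

(** The difference vanishes on [0, T], has derivative - u(T) - u' on ]T, T + 1[, and - u'
    afterwards. *)
Lemma cutoff_after_norm (eta : R) : 0 < eta -> cutoff_error <= eta `^ r ->
  sobolev_discounted_norm (cutoff_after - u) <= eta.
Proof.
move=> eta0 err; apply/(sobolev_discounted_norm_le _ (ltW eta0)).
set z := cutoff_after - u.
have zE t : z t = cutoff_after t - u t by [].
have Wz := sobolev_discountedP z.
have [uD LD] := W1r_discounted_weak_derivative Wu.
have T10 : 0 <= T + 1 by rewrite addr_ge0.
have z00 : z 0 = 0 by rewrite zE cutoff_after_le ?lexx ?T0'// subrr.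
rewrite z00 euclidean_norm0 powR0 ?gt_eqF// add0r.
apply: le_trans err.
have mz := measurable_deriv_power Wz.
have pz (t : R) : 0 < t -> 0 <= deriv_power r lambda z t by move=> _; exact: deriv_power_ge0.
have finz := deriv_power_lty Wz.
suff H : (\int[mu]_(t in half_line) (deriv_power r lambda z t)%:E <= cutoff_error%:E)%E.
  rewrite -lee_fin -(int_powE (discount_ge0 lambda)); first exact: H.
  by have [_ L] := W1r_discounted_weak_derivative Wz; exact: L.
rewrite (integral_ray_split mz pz T10) (integral_oo_split mz pz T0' (ltW TT1)).
have oI1 : open `]0, T[%classic by exact: interval_open.
have oI2 : open `]T, T + 1[%classic by exact: interval_open.
have oI3 : open (ray (T + 1)) by exact: interval_open.
have s1 : `]0, T[ `<=` half_line by exact: (sub_half_line (lexx 0)).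
have s2 : `]T, T + 1[ `<=` half_line by exact: sub_half_line.
have s3 : ray (T + 1) `<=` half_line by exact: sub_half_line_ray.
have I1 : (\int[mu]_(t in `]0%R, T[) (deriv_power r lambda z t)%:E = 0)%E.
  have g1 : is_weak_derivative `]0, T[ z 0.
    apply: eq_is_weak_derivative (is_weak_derivative0 oI1) => t /set_mem tI.
    have /andP[t0 tT] : 0 < t < T by move: tI; rewrite /= in_itv.
    by rewrite zE cutoff_after_le ?(ltW t0) ?(ltW tT)// subrr.
  rewrite (integral_deriv_power Wz oI1 s1 g1).
  under eq_integral do rewrite euclidean_norm0 powR0 ?gt_eqF// mul0r.
  by rewrite integral0.
have mN : measurable_fun half_line (fun t => (deriv_power r lambda u t)%:E).
  by apply/measurable_EFinP; exact: measurable_deriv_power Wu.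
have I2 : (\int[mu]_(t in `]T, (T + 1)%R[) (deriv_power r lambda z t)%:E <=
   (2 `^ r)%:E * (\int[mu]_(t in `]T, (T + 1)%R[) (euclidean_norm (u T) `^ r * discount lambda t)%:E
     + \int[mu]_(t in `]T, (T + 1)%R[) (deriv_power r lambda u t)%:E))%E.
  have g2 : is_weak_derivative `]T, T + 1[ z
     ((-1) *: cst (u T) + ((-1) *: weak_derivative half_line u + 0)).
    apply: (@eq_is_weak_derivative _ _ _
      ((-1) *: ramp (u T) (T + 1) + ((-1) *: (u : R -> 'rV[R]_d) + 0))).
      move=> t /set_mem tI.
      have /andP[Tt tT] : T < t < T + 1 by move: tI; rewrite /= in_itv.
      rewrite zE cutoff_after_mid ?(ltW Tt) ?(ltW tT)//
        -[LHS]/(-1 *: ((t - (T + 1)) *: u T) + (-1 *: u t + 0)).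
      by rewrite addr0 !scaleN1r scaleNr.
    apply: is_weak_derivativeP; first exact: ramp_weak_derivative.
    apply: is_weak_derivativeP; last exact: is_weak_derivative0.
    exact: is_weak_derivativeS uD.
  have E2 := integral_deriv_power Wz oI2 s2 g2; rewrite [X in (X <= _)%E]E2 {E2}.
  have mU : measurable_fun `]T, T + 1[ (fun t => (euclidean_norm (u T) `^ r * discount lambda t)%:E).
    by apply/measurable_EFinP; apply: measurable_funM => //; exact: measurable_discount.
  have mD2 : measurable_fun `]T, T + 1[ (fun t => (deriv_power r lambda u t)%:E).
    exact: measurable_funS mN.
  rewrite -ge0_integralD; [|exact: measurable_itv| |exact: mU| |exact: mD2]; last 2 first.
  - by move=> t _; rewrite lee_fin mulr_ge0 ?powR_ge0 ?discount_ge0.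
  - by move=> t _; rewrite lee_fin deriv_power_ge0.
  rewrite -ge0_integralZl//; last 2 first.
  - exact: (emeasurable_funD mU mD2).
  - by move=> t _; rewrite -EFinD lee_fin addr_ge0 ?deriv_power_ge0//
      mulr_ge0 ?powR_ge0 ?discount_ge0.
  apply: ge0_le_integral; first exact: measurable_itv.
  - by move=> t _; apply: pow_weight_ge0; exact: discount_ge0.
  - apply: measurable_pow_weight; first exact: measurable_discount.
    by have [_ lg _] := g2; move=> i; have [] := lg i.
  - exact: (measurable_funeM _ (emeasurable_funD mU mD2)).
  move=> t _; rewrite -EFinD -EFinM lee_fin /deriv_power -mulrDl mulrA.
  apply: ler_wpM2r; first exact: discount_ge0.
  rewrite -[X in euclidean_norm X]/(-1 *: u T + (-1 *: weak_derivative half_line u t + 0)).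
  rewrite addr0 !scaleN1r; apply: (le_trans (euclidean_normD_powR _ _ (ltW r0))).
  by rewrite !euclidean_normN.
have I3 : (\int[mu]_(t in ray (T + 1)%R) (deriv_power r lambda z t)%:E =
    \int[mu]_(t in ray (T + 1)%R) (deriv_power r lambda u t)%:E)%E.
  have g3 : is_weak_derivative (ray (T + 1)) z ((-1) *: weak_derivative half_line u + 0).
    apply: (@eq_is_weak_derivative _ _ _ ((-1) *: (u : R -> 'rV[R]_d) + 0)).
      move=> t /set_mem tI.
      have tT : T + 1 < t by move: tI; rewrite /= in_itv/= andbT.
      rewrite zE (cutoff_after_ge (ltW tT)) -[LHS]/(-1 *: u t + 0).
      by rewrite addr0 scaleN1r sub0r.
    apply: is_weak_derivativeP; last exact: is_weak_derivative0.
    exact: is_weak_derivativeS uD.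
  have E3 := integral_deriv_power Wz oI3 s3 g3; rewrite [LHS]E3 {E3}.
  apply: eq_integral => t _.
  rewrite -[X in euclidean_norm X]/(-1 *: weak_derivative half_line u t + 0).
  by rewrite addr0 scaleN1r euclidean_normN.
rewrite I1 I3 add0e.
have finray : (\int[mu]_(t in ray T) (deriv_power r lambda u t)%:E \is a fin_num)%E.
  rewrite ge0_fin_numE; last by apply: integral_ge0 => t _; rewrite lee_fin deriv_power_ge0.
  apply: le_lt_trans (deriv_power_lty Wu); apply: ge0_subset_integral.
  - exact: measurable_itv.
  - exact: measurable_itv.
  - exact: mN.
  - by move=> t _; rewrite lee_fin deriv_power_ge0.
  - exact: sub_half_line_ray.
have two1 : 1 <= 2 `^ r :> R.
  have h2 : 1 <= 2 :> R by rewrite ler1n.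
  by have := ler_powR h2 (ltW r0); rewrite powRr0.
have Sray : (\int[mu]_(t in ray T) (deriv_power r lambda u t)%:E =
   \int[mu]_(t in `]T, (T + 1)%R[) (deriv_power r lambda u t)%:E +
   \int[mu]_(t in ray (T + 1)%R) (deriv_power r lambda u t)%:E)%E.
  have m := measurable_deriv_power Wu.
  have p (t : R) : 0 < t -> 0 <= deriv_power r lambda u t by move=> _; exact: deriv_power_ge0.
  have A1 := integral_ray_split m p T0'.
  have A2 := integral_ray_split m p T10.
  rewrite (integral_oo_split m p T0' (ltW TT1)) in A2.
  have f1 : (\int[mu]_(t in `]0%R, T[) (deriv_power r lambda u t)%:E \is a fin_num)%E.
    rewrite ge0_fin_numE; last by apply: integral_ge0 => t _; rewrite lee_fin deriv_power_ge0.
    apply: le_lt_trans (deriv_power_lty Wu); apply: ge0_subset_integral.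
    - exact: measurable_itv.
    - exact: measurable_itv.
    - exact: mN.
    - by move=> t _; rewrite lee_fin deriv_power_ge0.
    - exact: s1.
  have A3 := etrans (esym A1) A2; rewrite -addeA in A3.
  move: A3; rewrite [X in X = _]addeC [X in _ = X]addeC.
  move=> /(congr1 (fun y => y - \int[mu]_(t in `]0%R, T[) (deriv_power r lambda u t)%:E)%E).
  by rewrite !addeK.
have errE : cutoff_error%:E = ((2 `^ r)%:E * ((euclidean_norm (u T) `^ r * discount lambda T)%:E +
   \int[mu]_(t in ray T) (deriv_power r lambda u t)%:E))%E.
  by rewrite -[X in (_ = _ * (_ + X))%E](fineK finray) -EFinD -EFinM.
rewrite errE; apply: (sum_le_scaled two1 _ _ _ I2 int_ramp_le Sray).
- by rewrite lee_fin mulr_ge0 ?powR_ge0 ?discount_ge0.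
- by apply: integral_ge0 => t _; rewrite lee_fin deriv_power_ge0.
- by apply: integral_ge0 => t _; rewrite lee_fin deriv_power_ge0.
Qed.
End cutoff.

Section cutoff_energy.
Context {R : realType} {d : nat}.
Local Notation mu := (@lebesgue_measure R).
Local Notation half_line := (`]0, +oo[%classic : set R).
Local Notation ray a := (`]a, +oo[%classic : set R).
Variables (r lambda : R) (r1 : 1 < r) (lambda0 : 0 < lambda).

Lemma exp_scale_le (J eta : R) : 0 <= J -> 0 < eta ->
  exists2 m : nat, (0 < m)%N & expR (lambda * m%:R^-1) * J <= J + eta.
Proof.
move=> J0 eta0; have Je : 0 < J + eta by rewrite ltr_wpDl.
pose m := (Num.truncn (lambda * (J + eta) / eta)).+1.
exists m => //; have m0 : 0 < m%:R :> R by rewrite ltr0n.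
have H := ltW (truncnS_gt (lambda * (J + eta) / eta)); rewrite ler_pdivrMr// -/m in H.
have xe : lambda * m%:R^-1 * (J + eta) <= eta.
  by rewrite mulrAC ler_pdivrMr// [leRHS]mulrC.
have K : J <= expR (- (lambda * m%:R^-1)) * (J + eta).
  apply: (@le_trans _ _ ((1 - lambda * m%:R^-1) * (J + eta))).
    by rewrite mulrBl mul1r; lra.
  by rewrite ler_wpM2r ?(ltW Je)//; exact: expR_ge1Dx.
have := ler_wpM2l (expR_ge0 (lambda * m%:R^-1)) K.
by rewrite mulrA -expRD subrr expR0 mul1r.
Qed.

Lemma discount_small (eps : R) : 0 < eps ->
  \forall n \near \oo, discount lambda n%:R <= eps.
Proof.
move=> eps0; near=> n.
have H : (eps * lambda)^-1 <= n%:R by near: n; exact: nbhs_infty_ger.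
rewrite /discount expRN -[leRHS]invrK lef_pV2 ?posrE ?expR_gt0 ?invr_gt0//.
apply: le_trans (expR_ge1Dx _); rewrite (@le_trans _ _ (lambda * n%:R))//; last by rewrite lerDr.
by move: H; rewrite invfM mulrC ler_pdivrMl.
Unshelve. all: by end_near. Qed.

Variables (L0 : R -> 'rV[R]_d -> 'rV[R]_d -> R) (C : R).
Hypotheses (L0_borel : borel_integrand L0)
  (L0_ge0 : forall (t : R) x xi, 0 < t -> 0 <= L0 t x xi)
  (C_gt0 : 0 < C)
  (L0_growth : forall (t : R) x xi, 0 < t ->
    L0 t x xi <= C * (1 + euclidean_norm xi `^ r)).
Variables (u : sobolev_discounted d lambda r1) (T : R) (T0 : 0 < T).

(** On ]T, T + 1[ the derivative is - u(T), so the growth condition bounds the integrand. *)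
Lemma cutoff_after_energy :
  partial_energy lambda L0 (cutoff_after lambda0 u T0) (T + 1) <=
  fine (\int[mu]_(t in half_line) (density L0 u t * discount lambda t)%:E) +
  C * (1 + euclidean_norm (u T) `^ r) * discount lambda T.
Proof.
set w := cutoff_after lambda0 u T0.
have Wu := sobolev_discountedP u; have Ww := sobolev_discountedP w.
have finu := discounted_energy_lty lambda0 L0_borel L0_ge0 C_gt0 L0_growth Wu.
have finw := discounted_energy_lty lambda0 L0_borel L0_ge0 C_gt0 L0_growth Ww.
have T10 : 0 <= T + 1 by rewrite addr_ge0// ltW.
have TT1 : T < T + 1 by rewrite ltrDl.
have mw := measurable_discounted_density Ww L0_borel.
have mu_ := measurable_discounted_density Wu L0_borel.
have pw := @density_ge0 _ _ lambda _ L0_ge0 w.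
have pu := @density_ge0 _ _ lambda _ L0_ge0 u.
have finu' : (\int[mu]_(t in half_line) (density L0 u t * discount lambda t)%:E \is a fin_num)%E.
  rewrite ge0_fin_numE; [exact: finu|apply: integral_ge0 => t].
  by rewrite /= in_itv/= andbT => t0; rewrite lee_fin; exact: pu.
rewrite -lee_fin -(partial_energyE L0_borel L0_ge0 T10 finw).
rewrite (integral_oo_split mw pw (ltW T0) (ltW TT1)) EFinD (fineK finu').
apply: leeD.
  have oI : open `]0, T[%classic by exact: interval_open.
  have E := @integral_density_eq R d r lambda L0 w u `]0, T[ L0_borel Ww Wu
    oI (sub_half_line (lexx 0)).
  rewrite E; last first.
    move=> t /set_mem tI; have /andP[t0 tT] : 0 < t < T by move: tI; rewrite /= in_itv.
    by apply: cutoff_after_le; rewrite (ltW t0) (ltW tT).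
  apply: ge0_subset_integral.
  - exact: measurable_itv.
  - exact: measurable_itv.
  - exact/measurable_EFinP.
  - by move=> t; rewrite /= in_itv/= andbT => t0; rewrite lee_fin; exact: pu.
  - exact: (sub_half_line (lexx 0)).
have oI2 : open `]T, T + 1[%classic by exact: interval_open.
have s2 : `]T, T + 1[ `<=` half_line by apply: sub_half_line; exact: ltW.
have g2 : is_weak_derivative `]T, T + 1[ w ((-1) *: cst (u T) + 0).
  apply: (@eq_is_weak_derivative _ _ _ ((-1) *: ramp (u T) (T + 1) + 0)).
    move=> t /set_mem tI.
    have /andP[Tt tT] : T < t < T + 1 by move: tI; rewrite /= in_itv.
    rewrite cutoff_after_mid ?(ltW Tt) ?(ltW tT)// -[LHS]/(-1 *: ((t - (T + 1)) *: u T) + 0).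
    by rewrite addr0 !scaleN1r scaleNr.
  apply: is_weak_derivativeP; first exact: ramp_weak_derivative.
  exact: is_weak_derivative0.
apply: (@le_trans _ _ (\int[mu]_(t in `]T, (T + 1)%R[)
    (C * (1 + euclidean_norm (u T) `^ r) * discount lambda T)%:E)%E).
  apply: ae_ge0_le_integral.
  - exact: measurable_itv.
  - by move=> t /s2/=; rewrite in_itv/= andbT => t0; rewrite lee_fin; exact: pw.
  - by apply/measurable_EFinP; apply: measurable_funS mw.
  - move=> t _; rewrite lee_fin !mulr_ge0 ?discount_ge0 ?addr_ge0 ?powR_ge0//.
    exact: ltW.
  - exact: measurable_cst.
  apply: filterS (W1r_discounted_weak_derivative_ae Ww oI2 s2 g2).
    exact: (ae_filter_ringOfSetsType mu).
  move=> t H tI; have tH : 0 < t by have := s2 t tI; rewrite /= in_itv/= andbT.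
  have Tt : T < t by move: tI; rewrite /= in_itv => /andP[].
  rewrite lee_fin; apply: ler_pM; [exact: L0_ge0|exact: discount_ge0| |].
    apply: (le_trans (L0_growth _ _ tH)); rewrite (H tI).
    rewrite -[X in euclidean_norm X]/(-1 *: u T + 0) addr0 scaleN1r euclidean_normN.
    exact: lexx.
  by rewrite ler_expR lerN2 ler_wpM2l// ltW.
rewrite integral_cst//= lebesgue_measure_itv/= lte_fin TT1 -EFinB addrAC subrr add0r.
by rewrite mule1.
Qed.
End cutoff_energy.

(** * The limsup inequality *)

Section limsup.
Context {R : realType} {d : nat}.
Local Notation mu := (@lebesgue_measure R).
Local Notation half_line := (`]0, +oo[%classic : set R).
Local Notation ray a := (`]a, +oo[%classic : set R).
Variables (r lambda : R) (r_gt1 : 1 < r) (lambda_gt0 : 0 < lambda).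

Lemma near_succ (P : nat -> Prop) :
  (\forall n \near \oo, P n) -> \forall n \near \oo, P n.+1.
Proof. by move=> [N _ HN]; exists N => // n /= Nn; apply: HN; exact: leqW. Qed.

Section approximation.
Variable u : sobolev_discounted d lambda r_gt1.

Definition truncation (n : nat) : sobolev_discounted d lambda r_gt1 :=
  cutoff_after lambda_gt0 u (ltr0Sn R n).

Lemma truncation_norm_small (eps : R) : 0 < eps ->
  \forall n \near \oo, sobolev_discounted_norm (truncation n - u) <= eps.
Proof.
move=> eps0; have Wu := sobolev_discountedP u.
have er0 : 0 < eps `^ r by rewrite powR_gt0.
have k0 : 0 < 2 `^ r :> R by rewrite powR_gt0.
pose tau := eps `^ r / (2 * 2 `^ r).
have tau0 : 0 < tau by rewrite divr_gt0// mulr_gt0.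
have dp := near_succ (value_decay r_gt1 lambda_gt0 Wu tau0).
have tl := near_succ (tail_small (measurable_deriv_power Wu)
   (fun t _ => deriv_power_ge0 r lambda u t) (deriv_power_lty Wu) tau0).
near=> n.
apply: (cutoff_after_norm lambda_gt0 (ltr0Sn R n) eps0).
have H1 : euclidean_norm (u n.+1%:R) `^ r * discount lambda n.+1%:R <= tau by near: n.
have H2 : (\int[mu]_(t in ray n.+1%:R) (deriv_power r lambda u t)%:E <= tau%:E)%E by near: n.
have H3 : fine (\int[mu]_(t in ray n.+1%:R) (deriv_power r lambda u t)%:E) <= tau.
  rewrite -lee_fin fineK; first exact: H2.
  rewrite ge0_fin_numE; first exact: le_lt_trans H2 (ltry _).
  by apply: integral_ge0 => t _; rewrite lee_fin deriv_power_ge0.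
rewrite /cutoff_error; apply: (@le_trans _ _ (2 `^ r * (tau + tau))).
  by apply: ler_wpM2l; [exact: ltW|exact: lerD].
rewrite le_eqVlt; apply/orP; left; apply/eqP; rewrite /tau.
by field; rewrite gt_eqF.
Unshelve. all: by end_near. Qed.

Lemma truncation_weak_cvg :
  (truncation : nat -> weak_sobolev_discounted d lambda r_gt1) @ \oo -->
  (u : weak_sobolev_discounted d lambda r_gt1).
Proof.
have FF : Filter (\oo : set_system nat) by exact: eventually_filter.
apply: (weak_cvgP _ _ _ FF).2 => l [c lc].
apply/cvgrPdist_le => eps eps0.
pose k := Num.max c 0 + 1.
have k0 : 0 < k by rewrite ltr_wpDl// le_max lexx orbT.
have ek : 0 < eps / k by rewrite divr_gt0.
apply: filterS (truncation_norm_small ek) => n Hn.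
rewrite distrC -linearB; apply: (le_trans (lc _)).
have N0 : 0 <= sobolev_discounted_norm (truncation n - u) by exact: powR_ge0.
apply: (@le_trans _ _ (k * sobolev_discounted_norm (truncation n - u))).
  by apply: ler_wpM2r => //; rewrite /k (@le_trans _ _ (Num.max c 0))// ?lerDl// le_max lexx.
by rewrite mulrC -ler_pdivlMr.
Qed.
End approximation.

Variable L : R -> R -> 'rV[R]_d -> 'rV[R]_d -> R.
Hypotheses (L_borel : forall e : R, 0 < e -> borel_integrand (L e))
  (L_ge0 : forall e : R, 0 < e -> forall (t : R) x xi, 0 < t -> 0 <= L e t x xi).
Variable L0 : R -> 'rV[R]_d -> 'rV[R]_d -> R.
Hypotheses (L0_borel : borel_integrand L0)
  (L0_ge0 : forall (t : R) x xi, 0 < t -> 0 <= L0 t x xi).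
Hypothesis recovery : forall a b : R, 0 <= a -> a < b ->
    forall u : sobolev d a b r_gt1,
    exists u_ : R -> sobolev d a b r_gt1,
      [/\ (u_ : R -> weak_sobolev d a b r_gt1) @ (0 : R)^'+
            --> (u : weak_sobolev d a b r_gt1),
          forall e : R, 0 < e -> u_ e a = u a /\ u_ e b = u b &
          energy `]a, b[ (L e) (u_ e) @[e --> (0 : R)^'+]
            --> energy `]a, b[ L0 u].
Variable C : R.
Hypotheses (C_gt0 : 0 < C)
  (L_bound : forall e t : R, 0 < e -> 0 < t -> L e t 0 0 <= C)
  (L0_growth : forall (t : R) x xi, 0 < t ->
    L0 t x xi <= C * (1 + euclidean_norm xi `^ r)).

Lemma zero_tail_energy (e T : R) (v : sobolev_discounted d lambda r_gt1) : 0 < e -> 0 <= T ->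
  (forall t, T <= t -> v t = 0) ->
  (\int[mu]_(t in ray T) (density (L e) v t * discount lambda t)%:E <=
   C%:E * \int[mu]_(t in ray T) (discount lambda t)%:E)%E.
Proof.
move=> e0 T0 v0; have Wv := sobolev_discountedP v.
have oI : open (ray T) by exact: interval_open.
have sT : ray T `<=` half_line by exact: sub_half_line_ray.
have vD : is_weak_derivative (ray T) v 0.
  apply: eq_is_weak_derivative (is_weak_derivative0 oI) => t /set_mem tI.
  by rewrite v0// ltW//; move: tI; rewrite /= in_itv/= andbT.
have md : measurable_fun (ray T) (fun t => (discount lambda t)%:E).
  by apply/measurable_EFinP; exact: measurable_discount.
rewrite -ge0_integralZl; [|exact: measurable_itv|exact: md| |]; last 2 first.
- by move=> t _; rewrite lee_fin discount_ge0.
- by rewrite lee_fin ltW.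
apply: ae_ge0_le_integral.
- exact: measurable_itv.
- by move=> t /sT/=; rewrite in_itv/= andbT => t0; rewrite lee_fin;
    apply: density_ge0 => //; exact: L_ge0.
- apply/measurable_EFinP.
  by apply: measurable_funS (measurable_discounted_density Wv (L_borel e0)).
- by move=> t _; rewrite -EFinM lee_fin mulr_ge0 ?discount_ge0// ltW.
- exact: (measurable_funeM _ md).
apply: filterS (W1r_discounted_weak_derivative_ae Wv oI sT vD).
  exact: (ae_filter_ringOfSetsType mu).
move=> t H tI; have tT : T < t by move: tI; rewrite /= in_itv/= andbT.
rewrite -EFinM lee_fin; apply: ler_wpM2r; first exact: discount_ge0.
rewrite /density (H tI) (v0 _ (ltW tT)).
by apply: L_bound => //; exact: le_lt_trans tT.
Qed.

(** The error eta is spent as follows: eta / 4 for cutting u off, eta / 8 each for the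
    mesh of the partition, the recovery sequences and the part beyond the
    cutoff, which leaves room. *)
Lemma discounted_limsup (u : sobolev_discounted d lambda r_gt1) :
  (gamma_limsup (X := weak_sobolev_discounted d lambda r_gt1)
    (fun e (u : sobolev_discounted d lambda r_gt1) =>
       discounted_energy lambda (L e) u) u <=
  discounted_energy lambda L0 u)%E.
Proof.
have Wu := sobolev_discountedP u.
have finu := discounted_energy_lty lambda_gt0 L0_borel L0_ge0 C_gt0 L0_growth Wu.
pose Phi := fine (\int[mu]_(t in half_line) (density L0 u t * discount lambda t)%:E).
have PhiE : discounted_energy lambda L0 u = Phi%:E.
  rewrite /Phi fineK; first by [].
  rewrite ge0_fin_numE; [exact: finu|apply: integral_ge0 => t].
  by rewrite /= in_itv/= andbT => t0; rewrite lee_fin density_ge0.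
rewrite PhiE; apply/lee_addgt0Pr => eta eta0; rewrite -EFinD.
apply: gamma_limsup_le => U uU.
have eta8 : 0 < eta / 8 by rewrite divr_gt0.
have eC : 0 < eta / 8 / C by rewrite divr_gt0.
have n1 : \forall n \near \oo, U (truncation u n).
  exact: (truncation_weak_cvg (open_nbhs_nbhs uU)).
have n2 := near_succ (discount_small lambda_gt0 eC).
have n3 := near_succ (value_decay r_gt1 lambda_gt0 Wu eC).
have fd : (\int[mu]_(t in half_line) (discount lambda t)%:E < +oo)%E.
  exact: le_lt_trans (integral_discount lambda_gt0) (ltry _).
have n4 := near_succ (near_succ (tail_small (@measurable_discount _ lambda half_line)
   (fun t _ => discount_ge0 lambda t) fd eC)).
have [n [Un dn un tn]] : exists n : nat, [/\ U (truncation u n),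
    discount lambda n.+1%:R <= eta / 8 / C,
    euclidean_norm (u n.+1%:R) `^ r * discount lambda n.+1%:R <= eta / 8 / C &
    (\int[mu]_(t in ray n.+2%:R) (discount lambda t)%:E <= (eta / 8 / C)%:E)%E].
  near \oo => n; exists n; split.
  - by near: n.
  - by near: n.
  - by near: n.
  - by near: n.
have T2 : n.+1%:R + 1 = n.+2%:R :> R by rewrite natr1.
set w := truncation u n in Un.
have Ww := sobolev_discountedP w.
have finw := discounted_energy_lty lambda_gt0 L0_borel L0_ge0 C_gt0 L0_growth Ww.
pose J := partial_energy lambda L0 w n.+2%:R.
have J0 : 0 <= J.
  apply: fine_ge0; apply: integral_ge0 => t; rewrite /= in_itv/= => /andP[t0 _].
  by rewrite lee_fin density_ge0.
have JE : J <= Phi + eta / 4.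
  have := cutoff_after_energy lambda_gt0 L0_borel L0_ge0 C_gt0 L0_growth u (ltr0Sn R n).
  rewrite T2 -/Phi => /le_trans; apply; rewrite lerD2l.
  have K1 : C * discount lambda n.+1%:R <= eta / 8 by rewrite mulrC -ler_pdivlMr.
  have K2 : C * (euclidean_norm (u n.+1%:R) `^ r * discount lambda n.+1%:R) <= eta / 8.
    by rewrite mulrC -ler_pdivlMr.
  have -> : C * (1 + euclidean_norm (u n.+1%:R) `^ r) * discount lambda n.+1%:R =
    C * discount lambda n.+1%:R + C * (euclidean_norm (u n.+1%:R) `^ r * discount lambda n.+1%:R).
    by ring.
  apply: (le_trans (lerD K1 K2)); lra.
have [m m0 HJ] := exp_scale_le lambda J0 eta8.
have m0' : 0 < m%:R :> R by rewrite ltr0n.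
have del0 : 0 < m%:R^-1 :> R by rewrite invr_gt0.
have [z [z_cvg z0 zE]] := recovery_partition lambda_gt0 L_borel L_ge0 L0_borel L0_ge0 recovery
  finw (n.+2 * m) del0.
have TE : (n.+2 * m)%:R * m%:R^-1 = n.+2%:R :> R by rewrite natrM mulfK// gt_eqF.
rewrite TE in z0 zE.
have wz : (fun e => w + z e : weak_sobolev_discounted d lambda r_gt1) @ (0 : R)^'+ -->
    (w : weak_sobolev_discounted d lambda r_gt1).
  have FF : Filter ((0 : R)^'+) by exact: at_right_proper_filter.
  apply: (weak_cvgP _ _ _ FF).2 => l Nl.
  under eq_fun do rewrite linearD.
  have := cvgD (cvg_cst (l w)) (z_cvg l Nl); rewrite addr0; exact.
have near1 : \forall e \near 0^'+, U (w + z e).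
  have [oU _] := uU; exact: (wz _ (open_nbhs_nbhs (conj oU Un))).
have near2 := zE _ eta8.
near=> e.
have e0 : 0 < e by [].
exists (w + z e); first by near: e.
have Wv := sobolev_discountedP (w + z e).
have mv := measurable_discounted_density Wv (L_borel e0).
have pv := @density_ge0 _ _ lambda _ (L_ge0 e0) (w + z e).
have H1 : (\int[mu]_(t in `]0%R, (n.+2%:R)%R[)
    (density (L e) (w + z e)%R t * discount lambda t)%:E <=
    (expR (lambda * m%:R^-1) * J + eta / 8)%:E)%E by near: e.
have v0 t : n.+2%:R <= t -> (w + z e) t = 0.
  move=> nt; rewrite sobolev_discountedD (z0 e e0 t nt) addr0.
  by apply: cutoff_after_ge; rewrite T2.
have H2 := zero_tail_energy e0 (ler0n R n.+2) v0.
have H3 : (C%:E * \int[mu]_(t in ray n.+2%:R) (discount lambda t)%:E <= (eta / 8)%:E)%E.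
  apply: (@le_trans _ _ (C%:E * (eta / 8 / C)%:E)%E).
    by apply: lee_wpmul2l; [rewrite lee_fin ltW|exact: tn].
  by rewrite -EFinM lee_fin mulrCA mulfV ?mulr1// gt_eqF.
have S := integral_ray_split mv pv (ler0n R n.+2).
rewrite -[X in (X <= _)%E]/(\int[mu]_(t in half_line)
  (density (L e) (w + z e) t * discount lambda t)%:E)%E.
rewrite [X in (X <= _)%E]S; apply: (le_trans (leeD H1 (le_trans H2 H3))).
rewrite -EFinD lee_fin; move: HJ JE; lra.
Unshelve. all: by end_near. Qed.
End limsup.

Theorem theorem4p6 (R : realType) (d : nat) (r lambda : R)
  (d_ge1 : (1 <= d)%N) (r_gt1 : 1 < r) (lambda_gt0 : 0 < lambda)
  (L : R -> R -> 'rV[R]_d -> 'rV[R]_d -> R)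
  (L_borel : forall e : R, 0 < e -> borel_integrand (L e))
  (L_ge0 : forall e : R, 0 < e -> forall (t : R) x xi, 0 < t -> 0 <= L e t x xi)
  (L0 : R -> 'rV[R]_d -> 'rV[R]_d -> R)
  (L0_borel : borel_integrand L0)
  (L0_ge0 : forall (t : R) x xi, 0 < t -> 0 <= L0 t x xi)
  (gamma_intervals : forall a b : R, 0 <= a -> a < b ->
    gamma_cvg (X := weak_sobolev d a b r_gt1)
      (fun e (u : sobolev d a b r_gt1) => energy `]a, b[ (L e) u)
      (fun u : sobolev d a b r_gt1 => energy `]a, b[ L0 u))
  (recovery : forall a b : R, 0 <= a -> a < b ->
    forall u : sobolev d a b r_gt1,
    exists u_ : R -> sobolev d a b r_gt1,
      [/\ (u_ : R -> weak_sobolev d a b r_gt1) @ (0 : R)^'+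
            --> (u : weak_sobolev d a b r_gt1),
          forall e : R, 0 < e -> u_ e a = u a /\ u_ e b = u b &
          energy `]a, b[ (L e) (u_ e) @[e --> (0 : R)^'+]
            --> energy `]a, b[ L0 u])
  (C : R) (C_gt0 : 0 < C)
  (L_bound : forall e t : R, 0 < e -> 0 < t -> L e t 0 0 <= C)
  (L0_caratheodory : caratheodory L0)
  (L0_growth : forall (t : R) x xi, 0 < t ->
    L0 t x xi <= C * (1 + euclidean_norm xi `^ r)) :
  gamma_cvg (X := weak_sobolev_discounted d lambda r_gt1)
    (fun e (u : sobolev_discounted d lambda r_gt1) =>
       discounted_energy lambda (L e) u)
    (fun u : sobolev_discounted d lambda r_gt1 =>
       discounted_energy lambda L0 u).
Proof.
move=> u; have finu := discounted_energy_lty lambda_gt0 L0_borel L0_ge0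
  C_gt0 L0_growth (sobolev_discountedP u).
have inf := discounted_liminf lambda_gt0 L_borel L_ge0 L0_borel L0_ge0
  gamma_intervals finu.
have sup := discounted_limsup lambda_gt0 L_borel L_ge0 L0_borel L0_ge0
  recovery C_gt0 L_bound L0_growth u.
have mid := gamma_liminf_le_limsup (X := weak_sobolev_discounted d lambda r_gt1)
  (fun e (u : sobolev_discounted d lambda r_gt1) =>
     discounted_energy lambda (L e) u) u.
split; apply/le_anti/andP; split.
- exact: inf.
- exact: le_trans mid sup.
- exact: le_trans inf mid.
- exact: sup.
Qed.
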